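(* Let $(Y,v)$ be a symplectic Landau-Ginzburg model with symplectic form $\omega$, and let $C\subset\mathbb{C}$ be the set of regular values of $v$ and $Y_C=v^{-1}(C)$. Let $L$ be a Lagrangian in $Y$ fibered over an embedded curve $\gamma:\mathbb{R}\to C\subset\mathbb{C}$. Let $$h:\mathbb{R}\times[0,1]\to C\subset \mathbb{C},\qquad (t,s)\mapsto h(t,s)=\gamma_s(t)$$ be an isotopy of embedded curves in $C$ such that $\gamma_0=\gamma$. Let $$\psi:L\times[0,1]\to Y_C\subset Y,\qquad (p,s)\mapsto\psi(p,s)=\psi_s(p)$$ be a Lagrangian isotopy in $Y_C$ fibered over $h$ such that $\psi_0(p)=p$ for all $p\in L$. If there exists $t_0\in\mathbb{R}$ such that for every $s\in[0,1]$ one has $h(t_0,s)=\gamma(t_0)$ and $\psi_s(p)=p$ for every $p\in L_{\gamma(t_0)}=L\cap v^{-1}(\gamma(t_0))$, then $\psi$ is an exact Lagrangian isotopy.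
   Context: **Symplectic Landau-Ginzburg model.** A pair $(Y,v)$ where $(Y,\omega)$ is a symplectic manifold and $v:Y\to\mathbb{C}$ is a smooth map whose set of critical values $\mathrm{critv}(v)$ is finite, such that, with $C:=\mathbb{C}\setminus\mathrm{critv}(v)$ and $Y_C:=v^{-1}(C)$, the map $v:Y_C\to C$ is a symplectic fibration (a locally trivial fibration with symplectic generic fiber and structure group contained in the symplectomorphism group of the fiber); in particular each fiber $Y_c=v^{-1}(c)$, $c\in C$, is a symplectic submanifold with symplectic form $\omega_c=\omega|_{Y_c}$. The form $\omega$ is not assumed exact. **Fibered Lagrangian.** Let $\gamma:\mathbb{R}\to C$ be a smooth embedded curve. A Lagrangian in $Y$ fibered over $\gamma$ is a Lagrangian submanifold $L$ of $(Y,\omega)$ such that (1) $v(L)=\gamma(\mathbb{R})$, (2) $v|_L:L\to\gamma(\mathbb{R})$ is a locally trivial fibration, and (3) $L_c:=L\cap Y_c$ is a Lagrangian submanifold of $(Y_c,\omega_c)$ for every $c\in\gamma(\mathbb{R})$. **Lagrangian isotopy.** A smooth map $\psi:L\times[0,1]\to Y$ such that for each $s\in[0,1]$, $\psi_s=\psi(\cdot,s)$ is a smooth embedding with Lagrangian image. Then $\psi^*\omega=b\wedge ds$ for the real 1-form $b=-\iota_{\partial/\partial s}\psi^*\omega$ on $L\times[0,1]$. The isotopy is *exact* if $b\wedge ds=d(H\,ds)$ for some smooth function $H:L\times[0,1]\to\mathbb{R}$. **Fibered Lagrangian isotopy.** Given an isotopy $h(t,s)=\gamma_s(t)$ of embedded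 curves in $C$, a Lagrangian isotopy fibered over $h$ is a Lagrangian isotopy $\psi:L\times[0,1]\to Y$ such that for each $s$, $\psi_s(L)$ is a Lagrangian fibered over $\gamma_s:\mathbb{R}\to C$. *)

(* Defs.v *)
From HB Require Import structures.
From mathcomp Require Import all_boot all_order all_algebra.
From mathcomp Require Import all_classical all_reals all_analysis.

Set Implicit Arguments.
Unset Strict Implicit.
Unset Printing Implicit Defensive.

Import Order.TTheory GRing.Theory Num.Theory.
Import numFieldNormedType.Exports.

Local Open Scope classical_set_scope.
Local Open Scope ring_scope.

(** * Calculus in normed spaces

    All model spaces used below are finite-dimensional; there, the class C^k
    is characterized by continuous iterated directional derivatives. *)
Section Calculus.
Context {R : realType}.

Fixpoint Ck (E F : normedModType R) (k : nat) (U : set E) (f : E -> F) : Prop :=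
  (forall x, U x -> {for x, continuous f}) /\
  (if k is k'.+1 then
     forall u : E, (forall x, U x -> derivable f x u) /\
                   Ck k' U (fun x => 'D_u f x)
   else True).

(* Meaningful for open [U]. *)
Definition Cinf (E F : normedModType R) (U : set E) (f : E -> F) : Prop :=
  forall k, Ck k U f.

(* Derivative of [f] at [x] along [u], computed inside [D]: only the [t] with
   [x + t u] in [D] are used. It is one-sided at the ends of V x [0,1], and
   equals ['D_u f x] when [D] is a neighbourhood of [x]. *)
Definition derive_in (E F : normedModType R) (D : set E) (f : E -> F)
    (x u : E) : F :=
  lim ((fun t : R => t^-1 *: (f (t *: u + x) - f x)) @
         within [set t | D (t *: u + x)] 0^').

(* Forms on a part of a normed space, as functions of a point and vectors. *)
Definition oneform (E : normedModType R) := E -> E -> R.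
Definition twoform (E : normedModType R) := E -> E -> E -> R.

Definition wedge (E : normedModType R) (a b : oneform E) : twoform E :=
  fun x u w => a x u * b x w - a x w * b x u.

(* d alpha (u, w) = u(alpha(w)) - w(alpha(u)) for constant fields u, w. *)
Definition ext_d1 (E : normedModType R) (D : set E) (a : oneform E) :
    twoform E :=
  fun x u w => derive_in D (fun z => a z w) x u
             - derive_in D (fun z => a z u) x w.

Definition closed2 (E : normedModType R) (D : set E) (a : twoform E) : Prop :=
  forall x u w z, D x ->
    derive_in D (fun y => a y w z) x u - derive_in D (fun y => a y u z) x w
      + derive_in D (fun y => a y u w) x z = 0.

End Calculus.

(** * Manifolds *)
Section Manifolds.
Context {R : realType}.

Record chart (E : normedModType R) (T : Type) := Chart {
  dom : set T;
  coord :> T -> E;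
  param : E -> T }.

(* Raw data of a manifold modelled on [E]: a preferred chart at each point;
   the atlas consists of these charts. The axioms are in [manifold]. *)
Record charted (E : normedModType R) := Charted {
  carrier :> topologicalType;
  chart_at : carrier -> chart E carrier }.

Definition codom_chart (E : normedModType R) (T : Type) (c : chart E T) :
  set E := c @` dom c.

Definition is_chart (E : normedModType R) (T : topologicalType)
    (c : chart E T) : Prop :=
  [/\ open (dom c), open (codom_chart c),
      {in dom c, cancel c (param c)},
      (forall p, dom c p -> {for p, continuous c}) &
      (forall x, codom_chart c x -> {for x, continuous (param c)})].

Definition manifold (E : normedModType R) (M : charted E) : Prop :=
  [/\ hausdorff_space M, @second_countable M,
      (forall p : M, dom (chart_at p) p),
      (forall p : M, is_chart (chart_at p)) &
      (forall p q : M,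
         Cinf (chart_at p @` (dom (chart_at p) `&` dom (chart_at q)))
              (chart_at q \o param (chart_at p)))].

Definition vecM (E : normedModType R) : charted E :=
  @Charted E E (fun=> Chart setT id id).

Definition prodM (E F : normedModType R) (M : charted E) (N : charted F) :
    charted (E * F)%type :=
  @Charted (E * F)%type (M * N)%type (fun z =>
    Chart (dom (chart_at z.1) `*` dom (chart_at z.2))
          (fun y => (chart_at z.1 y.1, chart_at z.2 y.2))
          (fun x => (param (chart_at z.1) x.1, param (chart_at z.2) x.2))).

(* Smoothness on an arbitrary subset [A] of [M], as in Milnor's book: [f]
   extends, locally and in charts, to a smooth function on an open set. This
   covers submanifolds and manifolds with boundary such as L x [0,1]. *)
Definition smooth (E F : normedModType R) (M : charted E) (N : charted F)
    (A : set M) (f : M -> N) : Prop :=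
  forall p, A p ->
    exists (U : set E) (g : E -> F),
      [/\ open U, U (chart_at p p), Cinf U g &
          forall q, A q -> dom (chart_at p) q -> U (chart_at p q) ->
            dom (chart_at (f p)) (f q) /\
            chart_at (f p) (f q) = g (chart_at p q)].

Definition diffeo (E F : normedModType R) (M : charted E) (N : charted F)
    (A : set M) (B : set N) (f : M -> N) : Prop :=
  [/\ smooth A f, f @` A = B &
      exists g : N -> M, smooth B g /\ (forall p, A p -> g (f p) = p)].

(* Smooth embedding: a diffeomorphism onto its image. *)
Definition embedding (E F : normedModType R) (M : charted E) (N : charted F)
    (A : set M) (f : M -> N) : Prop :=
  diffeo A (f @` A) f.

(* The tangent space at [p] is identified with [E] by the preferred chart at
   [p]; [mder A f p] is then the differential of [f : A -> N] at [p]. *)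
Definition mder (E F : normedModType R) (M : charted E) (N : charted F)
    (A : set M) (f : M -> N) (p : M) (u : E) : F :=
  derive_in (chart_at p @` (A `&` dom (chart_at p)))
    (fun x => chart_at (f p) (f (param (chart_at p) x))) (chart_at p p) u.

(* A 2-form on [M]: a function of a point [p] and two vectors of T_p M = E. *)
Definition mform2 (E : normedModType R) (M : charted E) := M -> E -> E -> R.

Definition pullback (E F : normedModType R) (M : charted E) (N : charted F)
    (A : set M) (f : M -> N) (w : mform2 N) : mform2 M :=
  fun p u u' => w (f p) (mder A f p u) (mder A f p u').

Definition pullback_vec (E : normedModType R) (F : normedModType R)
    (N : charted F) (D : set E) (f : E -> N) (w : mform2 N) : twoform E :=
  @pullback E F (vecM E) N D f w.

Definition symplectic_form (E : normedModType R) (M : charted E)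
    (w : mform2 M) : Prop :=
  [/\ (forall (p : M) (u' : E), scalar (fun u : E => w p u u')),
      (forall (p : M) (u u' : E), w p u u' = - w p u' u),
      (forall (p : M) (u : E), u != 0 -> exists u' : E, w p u u' != 0),
      (forall (p : M) (u u' : E), let c := chart_at p in
         Cinf (codom_chart c)
              (fun x => pullback_vec (codom_chart c) (param c) w x u u')) &
      (forall p : M, let c := chart_at p in
         closed2 (codom_chart c) (pullback_vec (codom_chart c) (param c) w))].

Definition local_param (E : normedModType R) (M : charted E) (k : nat)
    (S : set M) (V : set 'rV[R]_k) (phi : 'rV[R]_k -> M) : Prop :=
  open V /\ exists U : set M, open U /\
    @diffeo _ _ (vecM 'rV[R]_k) M V (S `&` U) phi.

(* Embedded k-dimensional submanifold. *)
Definition submanifold (E : normedModType R) (M : charted E) (k : nat)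
    (S : set M) : Prop :=
  forall p, S p -> exists (V : set 'rV[R]_k) (phi : 'rV[R]_k -> M),
    local_param S V phi /\ (phi @` V) p.

Definition isotropic (E : normedModType R) (M : charted E) (w : mform2 M)
    (L : set M) : Prop :=
  forall (k : nat) (V : set 'rV[R]_k) (phi : 'rV[R]_k -> M),
    local_param L V phi ->
    forall x u u', V x -> pullback_vec V phi w x u u' = 0.

(* [L] is a Lagrangian submanifold of [S], for [S] a symplectic submanifold
   (with the restriction of the form [w]); a submanifold of M contained in an
   embedded submanifold S is a submanifold of S. *)
Definition lagrangian (E : normedModType R) (M : charted E) (w : mform2 M)
    (S L : set M) : Prop :=
  [/\ L `<=` S, isotropic w L &
      exists k, submanifold (k + k) S /\ submanifold k L].

(* [theta] trivializes [f : A -> B] over [B `&` W], with fibre the part [S] of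
   the manifold [P]. *)
Definition trivialization (E F G : normedModType R) (M : charted E)
    (N : charted F) (P : charted G) (A : set M) (B : set N) (S : set P)
    (f : M -> N) (W : set N) (theta : N * P -> M) : Prop :=
  [/\ open W,
      @diffeo _ _ (prodM N P) M ((B `&` W) `*` S) (A `&` f @^-1` W) theta &
      forall z, (B `&` W) z.1 -> S z.2 -> f (theta z) = z.1].

Definition locally_trivial (E F : normedModType R) (M : charted E)
    (N : charted F) (A : set M) (B : set N) (f : M -> N) : Prop :=
  f @` A `<=` B /\
  forall b, B b -> exists (W : set N) (theta : N * M -> M),
    W b /\ trivialization A B (A `&` f @^-1` [set b]) f W theta.

End Manifolds.

(** * Symplectic Landau-Ginzburg models *)
Section LandauGinzburg.
Context {R : realType}.

(* The plane of complex numbers z = (Re z, Im z); only its structure of real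
   manifold matters. *)
Definition CC : charted (R * R)%type := vecM (R * R)%type.

Definition RR : charted R := vecM R.

Section Model.
Variables (N : nat) (Y : charted 'rV[R]_N) (w : mform2 Y) (v : Y -> CC).

Definition critical_point (p : Y) : Prop :=
  ~ (forall z : R * R, exists u, mder setT v p u = z).

Definition critv : set CC := v @` critical_point.

Definition regv : set CC := ~` critv.

Definition fibre (c : CC) : set Y := v @^-1` [set c].

(* The local trivializations identify each fibre, with the restriction of [w],
   with one symplectic manifold (P, sigma); hence their transition maps are
   symplectomorphisms of (P, sigma). *)
Definition symplectic_fibration (C : set CC) : Prop :=
  exists (m : nat) (P : charted 'rV[R]_m) (sigma : mform2 P),
    [/\ manifold P, symplectic_form sigma &
        forall c, C c -> exists (W : set CC) (theta : CC * P -> Y),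
          [/\ W c, trivialization (v @^-1` C) C setT v W theta &
              forall c', (C `&` W) c' -> forall q u u',
                pullback setT (fun q => theta (c', q)) w q u u' =
                sigma q u u']].

Definition LG_model : Prop :=
  [/\ manifold Y, symplectic_form w, smooth setT v, finite_set critv &
      symplectic_fibration regv].

Definition embedded_curve (C : set CC) (gamma : RR -> CC) : Prop :=
  embedding setT gamma /\ (forall t, C (gamma t)).

Definition fibered_lagrangian (gamma : RR -> CC) (L : set Y) : Prop :=
  [/\ lagrangian w setT L, v @` L = range gamma,
      locally_trivial L (range gamma) v &
      forall c, range gamma c -> lagrangian w (fibre c) (L `&` fibre c)].

Definition curve_isotopy (C : set CC) (h : RR -> R -> CC) : Prop :=
  @smooth _ _ _ (prodM RR RR) CC (setT `*` `[0, 1]) (fun z => h z.1 z.2) /\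
  (forall s : R, s \in `[0, 1] -> embedded_curve C (fun t => h t s)).

Definition lagrangian_isotopy (L : set Y) (psi : Y -> R -> Y) : Prop :=
  @smooth _ _ _ (prodM Y RR) Y (L `*` `[0, 1]) (fun z => psi z.1 z.2) /\
  (forall s : R, s \in `[0, 1] ->
     embedding L (fun p => psi p s) /\
     lagrangian w setT ((fun p => psi p s) @` L)).

Definition fibered_isotopy (h : RR -> R -> CC) (L : set Y)
    (psi : Y -> R -> Y) : Prop :=
  lagrangian_isotopy L psi /\
  (forall s : R, s \in `[0, 1] ->
     fibered_lagrangian (fun t => h t s) ((fun p => psi p s) @` L)).

(* The forms of the definition of exactness, in the coordinates (x, s) of
   V x [0,1] given by a local parametrization [phi : V -> L]. *)
Section Exact.
Variables (k : nat) (V : set 'rV[R]_k) (phi : 'rV[R]_k -> Y).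

Let E : normedModType R := ('rV[R]_k * R)%type.

Definition box : set E := V `*` `[0, 1].

Definition psi_w (psi : Y -> R -> Y) : twoform E :=
  pullback_vec box (fun z => psi (phi z.1) z.2) w.

(* - iota_{d/ds} psi^* w *)
Definition bform (psi : Y -> R -> Y) : oneform E :=
  fun z X => - psi_w psi z (0, 1) X.

Definition dsform : oneform E := fun z X => X.2.

Definition Hds (H : Y -> R -> R) : oneform E :=
  fun z X => H (phi z.1) z.2 * dsform z X.

End Exact.

Definition exact_isotopy (L : set Y) (psi : Y -> R -> Y) : Prop :=
  exists H : Y -> R -> R,
    @smooth _ _ _ (prodM Y RR) RR (L `*` `[0, 1]) (fun z => H z.1 z.2) /\
    forall (k : nat) (V : set 'rV[R]_k) (phi : 'rV[R]_k -> Y),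
      local_param L V phi ->
      forall z X X', box V z ->
        wedge (bform V phi psi) (@dsform k) z X X' =
        ext_d1 (box V) (Hds phi H) z X X'.

End Model.
End LandauGinzburg.

(* Main.v *)
(** For each s, the form b_s on L is closed, because omega is closed and psi_s(L) is isotropic. The
    Poincare lemma with s as a parameter gives local potentials, smooth in (p, s), and two of them
    differ locally by a function of s alone. Since L fibres over the line gamma(R), potentials
    extend over the whole of L once they are prescribed near one fibre: integrate b_s along the
    paths given by the local trivializations. On the fibre over gamma(t0) the isotopy is constant,
    so b_s vanishes there; local potentials can therefore be normalized to vanish on this fibre and
    then agree near it. The global function H obtained from them satisfies d_L H = b, which is
    b /\ ds = d(H ds). *)
Require Import Defs.
From HB Require Import structures.
From mathcomp Require Import all_boot all_order all_algebra.
From mathcomp Require Import all_classical all_reals all_analysis.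
From mathcomp Require Import ring lra.

Set Implicit Arguments.
Unset Strict Implicit.
Unset Printing Implicit Defensive.

Import Order.TTheory GRing.Theory Num.Theory.
Import numFieldNormedType.Exports.

Local Open Scope classical_set_scope.
Local Open Scope ring_scope.

(** The primitives along paths are chosen separately for each starting point and each s, so nothing
    makes them regular transversally; the difficulty is to show that together they form a smooth
    function. Near a point of a path, any potential differs from the glued function by terms
    constant along the nearby paths. If the glued function is itself a potential near one point,
    these terms depend on s alone and smoothly, so it is a potential near the next points too;
    connectedness of the path carries this on from the fibre where values are prescribed.
    Prescribing values on a whole fibre makes uniqueness relative to that fibre, so the fibres may
    have any topology. At s = 0 and s = 1 derivatives are one-sided, while calculus is done on open
    sets: the isotopy is extended locally past [0,1], where its slices need not be isotropic, and
    closedness of b_s is kept for s in [0,1] only. Potentials on slices of constant s are enough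
    because b(d/ds) = 0 by antisymmetry and the s-derivative of H cancels from d(H ds). *)

Lemma connected_transport (R : realType) (J : set R) (Q : R -> Prop) :
  connected J ->
  (forall t, J t -> exists2 d, 0 < d & forall t' t'', J t' -> J t'' ->
     `|t' - t| < d -> `|t'' - t| < d -> Q t' -> Q t'') ->
  forall t t', J t -> J t' -> Q t -> Q t'.
Proof.
move=> cJ loc a b Ja Jb Qa.
pose good c (d : R) := 0 < d /\ forall t' t'', J t' -> J t'' ->
     `|t' - c| < d -> `|t'' - c| < d -> Q t' -> Q t''.
(* The hypothesis is symmetric in [t'] and [t''], so [Q] has one truth value on the trace in [J] of
   each such ball: the balls around points of [Q] and those around points of its complement form two
   open sets that split [J]. *)
pose U (S : set R) := \bigcup_(p in [set p | J p.1 /\ S p.1 /\ good p.1 p.2])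
   ball (p.1 : R) (p.2 : R).
have oU S : open (U S).
  by apply: bigcup_open => -[c d] /= _; exact: ball_open.
have inU S c : J c -> S c -> U S c.
  move=> Jc Sc; have [d d0 Hd] := loc _ Jc.
  exists (c, d) => //=; exact: ballxx.
have UQ : J `&` U Q `<=` Q.
  move=> t [Jt [[c d] /= [Jc [Qc [d0 Hd]]]]]; rewrite /ball /= => ctd.
  by apply: (Hd c t) => //; rewrite ?subrr ?normr0 // distrC.
have UnQ : J `&` U (~` Q) `<=` ~` Q.
  move=> t [Jt [[c d] /= [Jc [Qc [d0 Hd]]]]]; rewrite /ball /= => ctd Qt.
  by apply: Qc; apply: (Hd t c) => //; rewrite ?subrr ?normr0 // distrC.
have : J `&` U Q = J.
  apply: cJ; first by exists a; split => //; exact: inU.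
    by exists (U Q).
  exists (~` U (~` Q)); first exact: open_closedC.
  rewrite eqEsubset; split=> t [Jt Ut]; split=> //.
    by move=> Ut'; apply: (UnQ t) => //; exact: UQ.
  apply: (inU) => //; apply: contrapT => nQ; apply: Ut; exact: inU.
by move=> JE; apply: UQ; rewrite JE.
Qed.

(** * Extension of local solutions along a function to the line *)

Section SliceExtension.
Variables (R : realType) (Z : topologicalType) (A : set Z) (tau : Z -> R).
(* [P z H]: [H] is a solution near [z]. *)
Variable P : Z -> (Z -> R) -> Prop.

Hypothesis tau_cont : forall z, A z -> forall e : R, 0 < e ->
  \forall z' \near z, A z' -> `|tau z' - tau z| < e.
Hypothesis P_germ : forall z H H', P z H ->
  (\forall z' \near z, A z' -> H z' = H' z') -> P z H'.
Hypothesis P_uniq : forall z H H', A z -> P z H -> P z H' ->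
  (\forall z' \near z, A z' -> tau z' = tau z -> H z' = H' z') ->
  \forall z' \near z, A z' -> H z' = H' z'.

(** Values on a slice carry no transversal information, so they are asked to be, near each point of
    the slice, the restriction of an actual solution. *)
Definition solved_at (t : R) (h : Z -> R) := forall z, A z -> tau z = t ->
  exists2 H, P z H & \forall z' \near z, A z' -> tau z' = t -> H z' = h z'.

(** The width [d] depends on [t0] alone, neither on a point of the slice nor on [t] or [h]. This
    uniformity over possibly noncompact slices lets the continuation proceed by whole bands. *)
Hypothesis P_ext : forall t0 : R, exists2 d, 0 < d &
  forall t h, `|t - t0| < d -> solved_at t h ->
  exists2 H, (forall z, A z -> `|tau z - t0| < d -> P z H) &
             (forall z, A z -> tau z = t -> H z = h z).

Variable t1 : R.

Definition solved_within (r : R) H := forall z, A z -> `|tau z - t1| <= r -> P z H.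

(** The band grows at both ends at once: [e] is a radius near [r] and [r'], and [t1 + e], [t1 - e]
    are the centres of the two local extensions glued to [H]. On the boundary slices the pieces have
    the same values, hence the same germs by [P_uniq]. *)
Lemma extend_interval_step (r r' d e : R) H : 0 <= r ->
  let near_ c := forall t h, `|t - c| < d -> solved_at t h ->
  exists2 H, (forall z, A z -> `|tau z - c| < d -> P z H) &
             (forall z, A z -> tau z = t -> H z = h z) in
  near_ (t1 + e) -> near_ (t1 - e) ->
  `|r - e| < d -> `|r' - e| < d -> r < r' -> solved_within r H ->
  exists2 H', solved_within r' H' & forall z, A z -> `|tau z - t1| <= r -> H' z = H z.
Proof.
move=> r0 near_ np nm rd r'd rr' sH.
have sdH t : `|t - t1| <= r -> solved_at t H.
  move=> tr z Az tz; exists H; last by apply: nearW.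
  by apply: sH; rewrite ?tz.
have [||Hp PHp Hpr] := np (t1 + r) H.
- by rewrite (_ : t1 + r - (t1 + e) = r - e) //; ring.
- by apply: sdH; rewrite (_ : t1 + r - t1 = r) ?ger0_norm //; ring.
have [||Hm PHm Hmr] := nm (t1 - r) H.
- by rewrite (_ : t1 - r - (t1 - e) = - (r - e)) ?normrN //; ring.
- by apply: sdH; rewrite (_ : t1 - r - t1 = - r) ?normrN ?ger0_norm //; ring.
pose H' z := if `|tau z - t1| <= r then H z else if tau z > t1 then Hp z else Hm z.
exists H'; last by move=> z Az; rewrite /H' => ->.
move=> z Az zr'.
have Pp : r <= tau z - t1 -> P z Hp.
  move=> h; apply: PHp => //; move: rd r'd zr' => /ltr_normlP[? ?] /ltr_normlP[? ?].
  by move=> /ler_normlP[? ?]; apply/ltr_normlP; split; lra.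
have Pm : tau z - t1 <= -r -> P z Hm.
  move=> h; apply: PHm => //; move: rd r'd zr' => /ltr_normlP[? ?] /ltr_normlP[? ?].
  by move=> /ler_normlP[? ?]; apply/ltr_normlP; split; lra.
have Ep : tau z - t1 = r -> \forall z' \near z, A z' -> H z' = Hp z'.
  move=> h; apply: P_uniq => //.
  - by apply: sH => //; rewrite h ger0_norm.
  - by apply: Pp; rewrite h.
  - by apply: nearW => z' Az' tz'; rewrite Hpr // tz'; lra.
have Em : tau z - t1 = - r -> \forall z' \near z, A z' -> H z' = Hm z'.
  move=> h; apply: P_uniq => //.
  - by apply: sH => //; rewrite h normrN ger0_norm.
  - by apply: Pm; rewrite h.
  - by apply: nearW => z' Az' tz'; rewrite Hmr // tz'; lra.
have [rlt|rgt|req] := ltgtP `|tau z - t1| r.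
- apply: (@P_germ _ H); first by apply: sH => //; exact: ltW.
  have e0 : 0 < r - `|tau z - t1| by rewrite subr_gt0.
  near=> z' => Az'; rewrite /H'; suff -> : `|tau z' - t1| <= r by [].
  have : `|tau z' - tau z| < r - `|tau z - t1|.
    by move: Az'; near: z'; exact: tau_cont.
  have := ler_normD (tau z' - tau z) (tau z - t1).
  by rewrite addrA subrK; lra.
- have e0 : 0 < `|tau z - t1| - r by rewrite subr_gt0.
  have [zp|zm] := ltP t1 (tau z).
  + have az : `|tau z - t1| = tau z - t1 by rewrite gtr0_norm// subr_gt0.
    apply: (@P_germ _ Hp); first by apply: Pp; move: rgt; rewrite az => /ltW.
    near=> z' => Az'.
    have /ltr_normlP[? ?] : `|tau z' - tau z| < `|tau z - t1| - r.
      by move: Az'; near: z'; exact: tau_cont.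
    rewrite /H' ifF ?ifT //; first lra.
    by apply/negP => /ler_normlP[? ?]; lra.
  + have az : `|tau z - t1| = t1 - tau z by rewrite ler0_norm ?subr_le0 // opprB.
    apply: (@P_germ _ Hm); first by apply: Pm; move: rgt; rewrite az; lra.
    near=> z' => Az'.
    have /ltr_normlP[? ?] : `|tau z' - tau z| < `|tau z - t1| - r.
      by move: Az'; near: z'; exact: tau_cont.
    rewrite /H' ifF ?ifF //; first by apply/negbTE; rewrite -leNgt; lra.
    by apply/negP => /ler_normlP[? ?]; lra.
- apply: (@P_germ _ H); first by apply: sH => //; rewrite req.
  (* For [r = 0] both ends are the slice of [t1] itself and neighbours of [z] may lie on either
     side, so [H] is compared with [Hp] and [Hm] together; for [r > 0] a small neighbourhood of [z]
     reaches only one side. *)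
  have [r00|rN0] := eqVneq r 0.
    have Ep' := Ep ltac:(by move: req; rewrite r00 => /normr0P/eqP).
    have Em' := Em ltac:(by move: req; rewrite r00 => /normr0P/eqP->; rewrite oppr0).
    near=> z' => Az'; rewrite /H'; case: ifP => // _; case: ifP => _.
      by move: Az'; near: z'.
    by move: Az'; near: z'.
  have rp : 0 < r by rewrite lt_def rN0.
  have [zp|zm] := ltP t1 (tau z).
    have az : `|tau z - t1| = tau z - t1 by rewrite gtr0_norm// subr_gt0.
    have Ep' := Ep ltac:(by rewrite -az).
    near=> z' => Az'.
    have /ltr_normlP[? ?] : `|tau z' - tau z| < r.
      by move: Az'; near: z'; exact: tau_cont.
    rewrite /H'; case: ifP => // _; rewrite ifT; last lra.
    by move: Az'; near: z'.
  have az : `|tau z - t1| = t1 - tau z by rewrite ler0_norm ?subr_le0 // opprB.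
  have Em' := Em ltac:(by lra).
  near=> z' => Az'.
  have /ltr_normlP[? ?] : `|tau z' - tau z| < r.
    by move: Az'; near: z'; exact: tau_cont.
  rewrite /H'; case: ifP => // _; rewrite ifF.
    by move: Az'; near: z'.
  by apply/negbTE; rewrite -leNgt; lra.
Unshelve. all: end_near. Qed.

(** Being extendable up to radius [s] is locally constant in [s]: smaller radii follow by
    restriction, larger ones by one step of a size fixed by the position. Connectedness of the
    half-line does the rest. *)
Lemma extend_interval (r r' : R) H : 0 <= r -> r <= r' -> solved_within r H ->
  exists2 H', solved_within r' H' & forall z, A z -> `|tau z - t1| <= r -> H' z = H z.
Proof.
move=> r0 rr' sH.
pose Q s := exists2 H', solved_within s H' & forall z, A z -> `|tau z - t1| <= r -> H' z = H z.
have cJ : connected (`[r, +oo[%classic : set R).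
  by apply/connected_intervalP; exact: interval_is_interval.
apply: (@connected_transport _ _ Q cJ _ r r');
  [|by rewrite /= in_itv /= lexx|by rewrite /= in_itv /= rr'|by exists H].
move=> e; rewrite /= in_itv /= andbT => re.
have [dp dp0 Hp] := P_ext (t1 + e).
have [dm dm0 Hm] := P_ext (t1 - e).
exists (Num.min dp dm); first by rewrite lt_min dp0.
move=> s s'; rewrite /= !in_itv /= !andbT => rs rs' se s'e [H1 sH1 H1H].
have [s's|ss'] := leP s' s.
  by exists H1 => // z Az zs'; apply: sH1 => //; exact: le_trans s's.
have sub c d : Num.min dp dm <= d ->
    (forall t h, `|t - c| < d -> solved_at t h -> exists2 H0,
        (forall z, A z -> `|tau z - c| < d -> P z H0) &
        (forall z, A z -> tau z = t -> H0 z = h z)) ->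
    (forall t h, `|t - c| < Num.min dp dm -> solved_at t h -> exists2 H0,
        (forall z, A z -> `|tau z - c| < Num.min dp dm -> P z H0) &
        (forall z, A z -> tau z = t -> H0 z = h z)).
  move=> dd Hd t h tc sd; have [|H0 PH0 H0h] := Hd t h _ sd; first exact: lt_le_trans dd.
  by exists H0 => // z Az zc; apply: PH0 => //; exact: lt_le_trans dd.
have [||H2 sH2 H2H] := extend_interval_step (le_trans r0 rs) _ _ se s'e ss' sH1.
- by apply: (sub _ dp) => //; rewrite ge_min lexx.
- by apply: (sub _ dm) => //; rewrite ge_min lexx orbT.
exists H2 => // z Az zr; rewrite H2H ?H1H //; exact: le_trans rs.
Qed.

Lemma extend_from_slice (h0 : Z -> R) : solved_at t1 h0 ->
  exists2 H, (forall z, A z -> P z H) & (forall z, A z -> tau z = t1 -> H z = h0 z).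
Proof.
move=> sd; have [d d0 Hd] := P_ext t1.
have [|H0 PH0 H0h] := Hd t1 h0 _ sd; first by rewrite subrr normr0.
have sH0 : solved_within 0 H0.
  by move=> z Az z0; apply: PH0 => //; exact: le_lt_trans d0.
have step (n : nat) (H : {H | solved_within n%:R H}) : {H' : {H' | solved_within n.+1%:R H'} |
    forall z, A z -> `|tau z - t1| <= n%:R -> sval H' z = sval H z}.
  apply: cid; case: H => H sH /=.
  have [||H' sH' H'H] := @extend_interval n%:R n.+1%:R H _ _ sH => //; first by rewrite ler_nat.
  by exists (exist _ H' sH').
pose F := fix F n : {H | solved_within n%:R H} :=
  if n is m.+1 then sval (step m (F m)) else exist _ H0 sH0.
have [G [G0 sG GS]] : exists G : nat -> Z -> R, [/\ G 0 = H0,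
    forall n, solved_within n%:R (G n) &
    forall n z, A z -> `|tau z - t1| <= n%:R -> G n.+1 z = G n z].
  exists (fun n => sval (F n)); split=> // [n|n z Az zn]; first exact: (svalP (F n)).
  exact: (svalP (step n (F n))).
have GD n m z : A z -> `|tau z - t1| <= n%:R -> G (m + n)%N z = G n z.
  move=> Az zn; elim: m => // m <-; rewrite addSn GS //; apply: le_trans zn _.
  by rewrite ler_nat leq_addl.
pose N z := Num.bound `|tau z - t1|.
have NP z : `|tau z - t1| <= (N z)%:R by apply/ltW/archi_boundP/normr_ge0.
have GN n z : A z -> `|tau z - t1| <= n%:R -> G n z = G (N z) z.
  move=> Az zn; case: (leqP n (N z)) => [|/ltnW] nN.
    by rewrite -(subnK nN) GD.
  by rewrite -(subnK nN) GD.
exists (fun z => G (N z) z) => [z Az|z Az zt].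
  (* The index [N z'] changes with [z']. At [(N z).+1] there is room 1 for the neighbours of [z], so
     all their values come from this one solution. *)
  apply: (@P_germ _ (G (N z).+1)).
    by apply: sG => //; apply: le_trans (NP z) _; rewrite ler_nat.
  near=> z' => Az'; apply: GN => //.
  have : `|tau z' - tau z| < 1.
    by move: Az'; near: z'; exact: tau_cont.
  have := ler_normD (tau z' - tau z) (tau z - t1).
  by rewrite addrA subrK => ? ?; have := NP z; rewrite -natr1; lra.
rewrite -(GN 0) //; first by rewrite G0; exact: H0h.
by rewrite zt subrr normr0.
Unshelve. all: end_near. Qed.
End SliceExtension.

(** * Continuation of solutions across a fibration, with parameters *)

Section Continuation.
Variables (R : realType) (Y T : topologicalType) (L : set Y) (I : set T).
Variable P : Y * T -> (Y * T -> R) -> Prop.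
Let A : set (Y * T) := L `*` I.

Hypothesis P_germ : forall z H H', P z H ->
  (\forall z' \near z, A z' -> H z' = H' z') -> P z H'.
Hypothesis P_open : forall z H, A z -> P z H ->
  \forall z' \near z, A z' -> P z' H.
Hypothesis P_ex : forall z, A z -> exists H, P z H.
Hypothesis P_diff : forall z H H', A z -> P z H -> P z H' ->
  exists c : T -> R, \forall z' \near z, A z' -> H z' = H' z' + c z'.2.
(** Which functions [c] of the parameter are admissible corrections (smooth ones, in the
    application) is invisible to an abstract [P]. Here admissibility, once seen at one point over
    [s], holds at every point over [s]. *)
Hypothesis P_add : forall p p' s G (c : T -> R), L p -> L p' -> I s ->
  P (p, s) G -> P (p, s) (fun z => G z + c z.2) ->
  P (p', s) G -> P (p', s) (fun z => G z + c z.2).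

(** The integral of b_s along the path [c], expressed without derivatives: locally a potential
    composed with [c]. The ambiguity is a constant [k], since [s] is fixed. *)
Definition primitive_along (c : R -> Y) (s : T) (t : R) (f : R -> R) :=
  exists2 G, P (c t, s) G &
  exists k, \forall t' \near t, f t' = G (c t', s) + k.

Lemma continuous_pairl (c : R -> Y) (s : T) : continuous c ->
  continuous (fun t => (c t, s)).
Proof. by move=> cc t; apply: cvg_pair; [exact: cc|exact: cvg_cst]. Qed.

Lemma primitive_along_diff c s t f G : continuous c -> (forall t, L (c t)) -> I s ->
  primitive_along c s t f -> P (c t, s) G ->
  exists k, \forall t' \near t, f t' = G (c t', s) + k.
Proof.
move=> cc Lc Is [G' PG' [k Hk]] PG.
have [d Hd] := @P_diff (c t, s) _ _ (conj (Lc t) Is) PG' PG.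
exists (d s + k); near=> t'; rewrite addrA.
have -> : f t' = G' (c t', s) + k by near: t'.
congr (_ + _).
suff : A (c t', s) -> G' (c t', s) = G (c t', s) + d (c t', s).2.
  by apply; split; [exact: Lc|exact: Is].
by near: t'; exact: (continuous_pairl cc Hd).
Unshelve. all: end_near. Qed.

(** The slice extension is applied to the line itself with [tau] the identity: a slice is a point,
    and uniqueness says that the constant is determined by the value there. *)
Lemma exists_primitive_along c s t1 a : continuous c -> (forall t, L (c t)) -> I s ->
  exists2 f, f t1 = a & forall t, primitive_along c s t f.
Proof.
move=> cc Lc Is.
have near_P t G : P (c t, s) G -> \forall t' \near t, P (c t', s) G.
  move=> PG; near=> t'.
  suff : A (c t', s) -> P (c t', s) G by apply; split; [exact: Lc|exact: Is].
  by near: t'; exact: (continuous_pairl cc (@P_open (c t, s) G (conj (Lc t) Is) PG)).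
suff [f Pf ft1] : exists2 f, forall t, setT t -> primitive_along c s t f &
    forall t, setT t -> id t = t1 -> f t = cst a t.
  by exists f => [|t]; [exact: ft1|exact: Pf].
apply: (@extend_from_slice R R setT id (primitive_along c s)).
- by move=> t _ e e0; near=> t' => _ /=; rewrite distrC; near: t'; exact: nbhsx_ballx.
- move=> t H H' [G PG [k Hk]] HH'; exists G => //; exists k; near=> t'.
  by rewrite -(near HH' t') //; near: t'.
- move=> t H H' _ Ht [G PG [k' Hk']] HH'.
  have [k Hk] := primitive_along_diff cc Lc Is Ht PG.
  have : H t = H' t by exact: (nbhs_singleton HH').
  rewrite (nbhs_singleton Hk) (nbhs_singleton Hk') => /addrI kk'.
  near=> t' => _; transitivity (G (c t', s) + k); first by near: t'.
  by rewrite kk'; apply/esym; near: t'.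
- move=> t0; have [G PG] := @P_ex (c t0, s) (conj (Lc t0) Is).
  have /nbhs_ballP[d d0 Hd] := near_P _ _ PG.
  exists d => // t h _ _; exists (fun t' => G (c t', s) + (h t - G (c t, s))).
    move=> t' _ tt'; exists G; first by apply: Hd; rewrite /ball/= distrC.
    by exists (h t - G (c t, s)); near=> t''.
  by move=> z _ ->; rewrite addrC subrK.
- move=> t _ tt1; have [G PG] := @P_ex (c t1, s) (conj (Lc t1) Is).
  exists (fun t' => G (c t', s) + (a - G (c t1, s))).
    by rewrite tt1; exists G => //; exists (a - G (c t1, s)); near=> t''.
  by near=> t' => _ /= ->; rewrite addrC subrK.
Unshelve. all: end_near. Qed.

Variable tau : Y -> R.
Hypothesis tau_cont : forall p, L p -> forall e : R, 0 < e ->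
  \forall p' \near p, L p' -> `|tau p' - tau p| < e.
(* transport t q moves the point q of the fibre over t0 along a path, defined for all t but only
   over t for t close to t0 *)
Hypothesis triv : forall t0 : R, exists2 d, 0 < d &
  exists (transport : R -> Y -> Y) (proj : Y -> Y),
  [/\ forall p, L p -> `|tau p - t0| < d ->
        [/\ L (proj p), tau (proj p) = t0 & transport (tau p) (proj p) = p],
      forall q, L q -> tau q = t0 -> continuous (transport^~ q) /\
        (forall t, L (transport t q)),
      forall t q, L q -> tau q = t0 -> `|t - t0| < d ->
        tau (transport t q) = t /\ proj (transport t q) = q,
      forall p, L p -> `|tau p - t0| < d -> forall O, nbhs (proj p) O ->
        \forall p' \near p, L p' -> O (proj p') &
      forall t q O, L q -> tau q = t0 -> `|t - t0| < d -> nbhs (transport t q) O ->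
        \forall t' \near t & q' \near q, L q' -> tau q' = t0 -> O (transport t' q')].

Variables t1 : R.
Hypothesis P_init : forall z, A z -> tau z.1 = t1 ->
  exists2 H, P z H & \forall z' \near z, A z' -> tau z'.1 = t1 -> H z' = 0.

Lemma near_fst (p : Y) (s : T) (Q : set Y) : nbhs p Q ->
  \forall z \near (p, s), Q z.1.
Proof. exact: cvg_fst. Qed.

Lemma near_snd (p : Y) (s : T) (Q : set T) : nbhs s Q ->
  \forall z \near (p, s), Q z.2.
Proof. exact: cvg_snd. Qed.

Lemma prod_nbhsP (X X' : topologicalType) (p : X) (s : X') (Q : set (X * X')) :
  nbhs (p, s) Q -> exists2 O, nbhs p O & exists2 S, nbhs s S &
  forall p' s', O p' -> S s' -> Q (p', s').
Proof.
by move=> [[W S] /= [Op Ss] sub]; exists W => //; exists S => // *; exact: sub.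
Qed.

Lemma continuation : exists H, forall z, A z -> P z H.
Proof.
suff [H PH _] : exists2 H, forall z, A z -> P z H &
    forall z, A z -> (tau \o fst) z = t1 -> H z = cst 0 z by exists H.
apply: (@extend_from_slice R (Y * T)%type A (tau \o fst) P).
- move=> [p s] /= [Lz Iz] e e0.
  by apply: filterS (near_fst s (tau_cont Lz e0)) => z' /= + [Lz' _]; exact.
- exact: P_germ.
- move=> [p s] H H' Az PH PH' HH'.
  have [c Hc] := P_diff Az PH PH'.
  (* All points [(p, s')] lie on the slice of [(p, s)], so comparing the two solutions there shows
     that their difference [c] vanishes at every [s'] of [I] near [s]. *)
  have c0 : \forall s' \near s, I s' -> c s' = 0.
    have [W Op [S Ss OS]] := prod_nbhsP (filterI HH' Hc).
    apply: filterS Ss => s' Ss' Is'.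
    have [] := OS p s' (nbhs_singleton Op) Ss'.
    have [Lp _] := Az.
    move=> /(_ (conj Lp Is') erefl) -> /(_ (conj Lp Is')) /=.
    by rewrite -[LHS]addr0 => /addrI.
  near=> z => Az'.
  rewrite (_ : H z = H' z + c z.2); last by move: Az'; near: z.
  suff -> : c z.2 = 0 by rewrite addr0.
  have : I z.2 by case: Az'.
  by near: z; exact: (near_snd p c0).
- move=> t0; have [d d0 [transp [proj [tr1 tr2 tr3 tr4 tr5]]]] := triv t0.
  exists d => // t h td sd.
  (* One primitive for each label [q] and each [s], with the prescribed value [h] at time [t];
     nothing relates [F] at different [(q, s)] yet. *)
  have /choice[F HF] : forall qs : Y * T, exists f : R -> R,
      L qs.1 -> tau qs.1 = t0 -> I qs.2 -> f t = h (transp t qs.1, qs.2) /\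
      forall t', primitive_along (transp^~ qs.1) qs.2 t' f.
    move=> [q s] /=; have [[Lq tq Is]|nH] := pselect [/\ L q, tau q = t0 & I s].
      have [cq LT] := tr2 q Lq tq.
      have [f ft Hf] := @exists_primitive_along (transp^~ q) s t (h (transp t q, s))
        cq LT Is.
      by exists f.
    by exists (cst 0) => Lq tq Is; case: nH.
  pose H (z : Y * T) : R := F (proj z.1, z.2) (tau z.1).
  exists H; last first.
    move=> [p s] /= [Lp Is] tp; rewrite /H /= tp.
    have [|Lq tq Tq] := tr1 p Lp; first by rewrite tp.
    by rewrite (HF (proj p, s) Lq tq Is).1 /= -tp Tq.
  move=> [p s] /= [Lp Is] tpd; set q0 := proj p.
  have [Lq0 tq0 Tq0] := tr1 p Lp tpd.
  (* Along the paths of all [(q', s')] near [(q0, s)], [F] and [G] differ by a constant of the path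
     on one common time interval. The interval comes from joint continuity of the transport, the
     constancy from its connectedness. *)
  have key t3 G : `|t3 - t0| < d -> P (transp t3 q0, s) G ->
      exists2 e, 0 < e & (forall t', `|t' - t3| < e -> `|t' - t0| < d) /\
      exists2 Q, nbhs q0 Q & exists2 S, nbhs s S &
      forall q' s', Q q' -> S s' -> L q' -> tau q' = t0 -> I s' ->
      (forall t', `|t' - t3| < e -> P (transp t' q', s') G) /\
      (forall t' t'', `|t' - t3| < e -> `|t'' - t3| < e ->
        F (q', s') t' - G (transp t' q', s') = F (q', s') t'' - G (transp t'' q', s')).
    move=> t3d PG; have [_ LT0] := tr2 q0 Lq0 tq0.
    have [W Op [S Ss OS]] := prod_nbhsP (@P_open (transp t3 q0, s) G (conj (LT0 t3) Is) PG).
    have [B Bt3 [Q Qq0 BQ]] := prod_nbhsP (tr5 _ _ _ Lq0 tq0 t3d Op).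
    have Bt3' : nbhs t3 (B `&` ball t0 d).
      apply: filterI => //; apply: open_nbhs_nbhs; split; first exact: ball_open.
      by rewrite /ball /= distrC.
    have /nbhs_ballP[e e0 He] := Bt3'.
    have Hee t' : `|t' - t3| < e -> (B `&` ball t0 d) t'.
      by move=> h'; apply: He; rewrite /ball /= distrC.
    exists e => //; split=> [t' /Hee[_]|]; first by rewrite /ball /= distrC.
    exists Q => //; exists S => // q' s' Qq' Ss' Lq' tq' Is'.
    have [cq' LT'] := tr2 q' Lq' tq'.
    have PG' t' : `|t' - t3| < e -> P (transp t' q', s') G.
      move=> /Hee[Bt' _]; apply: (OS (transp t' q') s' _ Ss' (conj (LT' t') Is')).
      exact (BQ t' q' Bt' Qq' Lq' tq').
    split=> // a b ae be.
    have cJ : connected (ball t3 e).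
      apply/connected_intervalP => x y; rewrite /ball /= => + + z /andP[xz zy].
      by move=> /ltr_normlP[? ?] /ltr_normlP[? ?]; apply/ltr_normlP; split; lra.
    have balle x : ball t3 e x <-> `|x - t3| < e by rewrite /ball /= distrC.
    apply/esym; apply: (@connected_transport _ _ (fun x => F (q', s') x - G (transp x q', s') =
      F (q', s') a - G (transp a q', s')) cJ _ a b) => //; [|exact/balle|exact/balle].
    move=> x /balle xe.
    have [k /nbhs_ballP[e' e'0 Hk]] := primitive_along_diff cq' LT' Is'
       ((HF (q', s') Lq' tq' Is').2 x) (PG' x xe).
    exists e' => // x' x'' _ _ xx' xx'' <-.
    rewrite (Hk x') ?(Hk x'') /ball /= 1?distrC //; ring.
  (* An identity [F = G + c] known at the single time [t'] moves to a full neighbourhood of the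
     point at time [t''], because [F - G] does not change with time on each path near that of
     [q0]. *)
  have near_eq t' t'' t3 e G (c : T -> R) : `|t' - t0| < d -> `|t'' - t0| < d ->
      (exists2 Q, nbhs q0 Q & exists2 S, nbhs s S &
      forall q' s', Q q' -> S s' -> L q' -> tau q' = t0 -> I s' ->
      (forall t' t'', `|t' - t3| < e -> `|t'' - t3| < e ->
        F (q', s') t' - G (transp t' q', s') = F (q', s') t'' - G (transp t'' q', s'))) ->
      `|t' - t3| < e -> `|t'' - t3| < e ->
      (\forall z \near (q0, s), L z.1 -> tau z.1 = t0 -> I z.2 ->
         F z t' = G (transp t' z.1, z.2) + c z.2) ->
      \forall z \near (transp t'' q0, s), A z -> H z = G z + c z.2.
    move=> t'd t''d [Q Qq [S Ss QS]] t'e t''e Hc.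
    have [cq LT] := tr2 q0 Lq0 tq0.
    have [tT pT] := tr3 t'' q0 Lq0 tq0 t''d.
    have [Q1 Q1q [S1 S1s QS1]] := prod_nbhsP Hc.
    have e1 : 0 < e - `|t'' - t3| by rewrite subr_gt0.
    have e2 : 0 < d - `|t'' - t0| by rewrite subr_gt0.
    have m0 : 0 < Num.min (e - `|t'' - t3|) (d - `|t'' - t0|) by rewrite lt_min e1.
    have N1 := near_fst s (tau_cont (LT t'') m0).
    have N2 : \forall z \near (transp t'' q0, s), L z.1 -> (Q `&` Q1) (proj z.1).
      apply: (@near_fst _ s (fun p' => L p' -> (Q `&` Q1) (proj p'))).
      by apply: tr4; rewrite ?tT // pT; exact: filterI.
    have N3 : \forall z \near (transp t'' q0, s), (S `&` S1) z.2.
      by apply: near_snd; exact: filterI.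
    near=> z => -[Lz Iz].
    have tz : `|tau z.1 - t''| < Num.min (e - `|t'' - t3|) (d - `|t'' - t0|).
      by rewrite -{1}tT; apply: (near N1 z).
    have tz3 : `|tau z.1 - t3| < e.
      move: tz; rewrite lt_min => /andP[+ _].
      have := ler_normD (tau z.1 - t'') (t'' - t3); rewrite addrA subrK; lra.
    have tz0 : `|tau z.1 - t0| < d.
      move: tz; rewrite lt_min => /andP[_].
      have := ler_normD (tau z.1 - t'') (t'' - t0); rewrite addrA subrK; lra.
    have [Lp' tp' Tp'] := tr1 z.1 Lz tz0.
    have [Qz Q1z] : (Q `&` Q1) (proj z.1).
      by apply: (near N2 z).
    have [Sz S1z] : (S `&` S1) z.2 by apply: (near N3 z).
    have := QS _ _ Qz Sz Lp' tp' Iz _ _ tz3 t'e.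
    have := QS1 _ _ Q1z S1z Lp' tp' Iz; rewrite /= => ->.
    rewrite Tp' -surjective_pairing /H => /eqP.
    by rewrite subr_eq => /eqP ->; ring.
  have cJ : connected (ball t0 d).
    apply/connected_intervalP => x y; rewrite /ball /= => + + z /andP[xz zy].
    by move=> /ltr_normlP[? ?] /ltr_normlP[? ?]; apply/ltr_normlP; split; lra.
  have balle x : ball t0 d x <-> `|x - t0| < d by rewrite /ball /= distrC.
  have [cq LT] := tr2 q0 Lq0 tq0.
  rewrite -Tq0.
  (* [p] is the point at time [tau p] of the path of [q0]. What is carried along this path is that
     the whole function [H] is a solution near the point reached; it starts at time [t], on the
     slice where [h] is prescribed. *)
  apply: (@connected_transport _ _ (fun x => P (transp x q0, s) H) cJ _ t (tau p)) => //;
    [|exact/balle|exact/balle|].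
    move=> t3 /balle t3d.
    have [G PG] := @P_ex (transp t3 q0, s) (conj (LT t3) Is).
    have [e e0 [ed [Q Qq [S Ss QS]]]] := key t3 G t3d PG.
    exists e => // t' t'' /balle t'd /balle t''d t'e t''e PH.
    have QSq := QS q0 s (nbhs_singleton Qq) (nbhs_singleton Ss) Lq0 tq0 Is.
    have [c Hc] := @P_diff (transp t' q0, s) H G (conj (LT t') Is) PH (QSq.1 t' t'e).
    (* Near time [t'] the solution [H] equals [G] plus [c], so adding [c] is admissible there, and
       by [P_add] also at time [t'']. *)
    apply: (@P_germ _ (fun z => G z + c z.2)).
      apply: (@P_add (transp t' q0)) => //; [exact: QSq.1| |exact: QSq.1].
      exact: P_germ PH Hc.
    suff : \forall z \near (transp t'' q0, s), A z -> H z = G z + c z.2.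
      by apply: filterS => z Hz Az; rewrite Hz.
    apply: (@near_eq t' t'' t3 e) => //.
      exists Q => //; exists S => // q' s' Qq' Ss' Lq' tq' Is'.
      by have [] := QS q' s' Qq' Ss' Lq' tq' Is'.
    have [W Oq [S' S's OS']] := prod_nbhsP Hc.
    have [B Bt [Q' Q'q BQ]] := prod_nbhsP (tr5 _ _ _ Lq0 tq0 t'd Oq).
    near=> z => Lz tz Iz.
    have [tT pT] := tr3 t' z.1 Lz tz t'd.
    have [_ LTz] := tr2 z.1 Lz tz.
    have Q'z : Q' z.1 by near: z; exact: near_fst.
    have S'z : S' z.2 by near: z; exact: near_snd.
    have := OS' (transp t' z.1) z.2 (BQ _ _ (nbhs_singleton Bt) Q'z Lz tz) S'z
      (conj (LTz t') Iz).
    by rewrite /H /= pT tT -surjective_pairing.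
  have [tT pT] := tr3 t q0 Lq0 tq0 td.
  have [G PG Gh] := sd (transp t q0, s) (conj (LT t) Is) tT.
  have [e e0 [ed [Q Qq [S Ss QS]]]] := key t G td PG.
  apply: P_germ PG _.
  suff : \forall z \near (transp t q0, s), A z -> H z = G z + (cst 0 z.2).
    by apply: filterS => z Hz Az; rewrite Hz // addr0.
  apply: (@near_eq t t t e) => //; rewrite ?subrr ?normr0 //.
    exists Q => //; exists S => // q' s' Qq' Ss' Lq' tq' Is'.
    by have [] := QS q' s' Qq' Ss' Lq' tq' Is'.
  have [W Oq [S' S's OS']] := prod_nbhsP Gh.
  have [B Bt [Q' Q'q BQ]] := prod_nbhsP (tr5 _ _ _ Lq0 tq0 td Oq).
  near=> z => Lz tz Iz.
  have [tTz _] := tr3 t z.1 Lz tz td.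
  have [_ LTz] := tr2 z.1 Lz tz.
  have Q'z : Q' z.1 by near: z; exact: near_fst.
  have S'z : S' z.2 by near: z; exact: near_snd.
  have := OS' (transp t z.1) z.2 (BQ _ _ (nbhs_singleton Bt) Q'z Lz tz) S'z
    (conj (LTz t) Iz) tTz.
  by move=> ->; rewrite (HF z Lz tz Iz).1 addr0.
- by move=> z Az zt; have [H PH H0] := P_init Az zt; exists H.
Unshelve. all: end_near. Qed.

End Continuation.

(** * Calculus in finite-dimensional spaces *)

(** Continuous coordinates reduce vector-valued statements to real-valued ones, where the mean value
    theorem is available, and replace moving vectors by the fixed [e i] with varying
    coefficients. *)
Class finite_dim (R : realType) (E : normedModType R) : Prop := finite_dimP :
  exists (I : finType) (e : I -> E) (c : I -> {linear E -> R}),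
    (forall i, continuous (c i)) /\ (forall x, x = \sum_i c i x *: e i).

Section FiniteDim.
Context {R : realType}.

#[export] Instance finite_dim_real : finite_dim (R : normedModType R).
Proof.
exists unit, (fun=> 1), (fun=> idfun); split=> [_ x|x]; first exact: cvg_id.
by rewrite big_const card_unit /= addr0 /GRing.scale /= mulr1.
Qed.

#[export] Instance finite_dim_rV n : finite_dim ('rV[R]_n : normedModType R).
Proof.
have lin i : linear (fun x : 'rV[R]_n => x ord0 i) by move=> a u v; rewrite !mxE.
pose c i : {linear 'rV[R]_n -> R} := HB.pack (fun x : 'rV[R]_n => x ord0 i)
  (GRing.isLinear.Build _ _ _ _ _ (lin i)).
exists 'I_n, (delta_mx ord0), c; split=> [i|x] /=.
  exact: coord_continuous.
by rewrite [LHS]row_sum_delta.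
Qed.

#[export] Instance finite_dim_prod (E F : normedModType R) :
  finite_dim E -> finite_dim F -> finite_dim (E * F)%type.
Proof.
move=> [I [e [c [cc ec]]]] [J [f [d [dc fd]]]].
exists (I + J)%type, (fun k => match k with inl i => (e i, 0) | inr j => (0, f j) end).
exists (fun k => match k with inl i => (c i \o fst : {linear (E * F)%type -> R})
  | inr j => (d j \o snd : {linear (E * F)%type -> R}) end).
split=> [[i|j]|[x y]].
- by move=> z; apply: continuous_comp; [exact: cvg_fst|exact: cc].
- by move=> z; apply: continuous_comp; [exact: cvg_snd|exact: dc].
- rewrite big_sumType /=; congr pair; rewrite /= (raddf_sum fst, raddf_sum snd) /=.
  rewrite raddf_sum [X in _ + X]big1 ?addr0 /=; first exact: ec.
  by move=> i _; rewrite scaler0.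
rewrite (raddf_sum snd) /= [X in X + _]big1 ?add0r /=; last by move=> i _; rewrite scaler0.
exact: fd.
Qed.

End FiniteDim.

Section Line.
Context {R : realType} {E F : normedModType R}.
Implicit Types (f : E -> F) (x u : E).

Lemma derivable_line f x u t : derivable f (t *: u + x) u ->
  is_derive t (1 : R) (fun s => f (s *: u + x)) ('D_u f (t *: u + x)).
Proof.
move=> fd.
have key : (fun h : R => h^-1 *: ((fun s => f (s *: u + x)) (h *: (1 : R) + t)
                                   - f (t *: u + x))) =
           (fun h => h^-1 *: (f (h *: u + (t *: u + x)) - f (t *: u + x))).
  by apply/funext => h; rewrite addrA -scalerDl /GRing.scale /= mulr1.
by split; rewrite /derivable /derive /= key.
Qed.

End Line.

Section MeanValue.
Context {R : realType} {E : normedModType R}.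
Implicit Types (f : E -> R) (x u : E).

Lemma mean_value_line f x u (a : R) :
  (forall t, `|t| <= `|a| -> derivable f (t *: u + x) u) ->
  exists2 t, `|t| <= `|a| & f (a *: u + x) - f x = a * 'D_u f (t *: u + x).
Proof.
move=> fd; pose g (t : R) := f (t *: u + x).
have gd t : `|t| <= `|a| -> is_derive t (1 : R) g ('D_u f (t *: u + x)).
  by move=> ta; apply: derivable_line; exact: fd.
have gc b c : (forall t, t \in `[b, c] -> `|t| <= `|a|) -> {within `[b, c], continuous g}.
  move=> bc; apply: derivable_within_continuous => t tbc.
  by have [] := gd t (bc t tbc).
have g0 : g 0 = f x by rewrite /g scale0r add0r.
have [a0|a0] := leP 0 a.
  have ta t : t \in `[0, a] -> `|t| <= `|a|.
    by rewrite in_itv /= => /andP[t0 ta]; rewrite !ger0_norm.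
  have [t tab E1] := MVT_segment a0
    (fun t tab => gd t (ta t (subset_itv_oo_cc tab))) (gc _ _ ta).
  exists t; first exact: ta.
  by rewrite -g0 -/(g a) E1 subr0 mulrC.
have ta t : t \in `[a, 0] -> `|t| <= `|a|.
  rewrite in_itv /= => /andP[t0 ta]; rewrite !ler0_norm ?lerN2 //; exact: ltW.
have [t tab E1] := MVT_segment (ltW a0)
  (fun t tab => gd t (ta t (subset_itv_oo_cc tab))) (gc _ _ ta).
exists t; first exact: ta.
by rewrite -g0 -/(g a) -opprB E1 sub0r mulrN opprK mulrC.
Qed.

End MeanValue.

Section Differentiable.
Context {R : realType}.

Lemma differentiable_of_bound (E F : normedModType R) (f : E -> F) x (l : {linear E -> F}) :
  continuous l ->
  (forall e : R, 0 < e -> \forall h \near (0 : E),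
     `|f (h + x) - f x - l h| <= e * `|h|) -> differentiable f x.
Proof.
move=> lc Hl.
have fl : f \o shift x = cst (f x) + l +o_ (0 : E) id.
  apply/eqaddoP => e e0; near=> h.
  rewrite /= -![(_ + _ : _ -> _) _]/(_ + _) -![(- _ : _ -> _) _]/(- _) /=.
  by rewrite opprD addrA; near: h; exact: Hl.
apply/diff_locallyP; have dl : 'd f x = l :> (E -> F) by exact: diff_unique.
by rewrite dl.
Unshelve. all: end_near. Qed.

(** The increment is split into steps along one [e i] at a time; on each step the mean value theorem
    leaves an error controlled by continuity of ['D_(e i) f] at [x]. The induction is on the list of
    directions used, for all [eps] at once. *)
Lemma C1_differentiable_real (E : normedModType R) (fE : finite_dim E) (f : E -> R)
    (U : set E) x :
  open U -> U x -> (forall y u, U y -> derivable f y u) ->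
  (forall u, {for x, continuous ('D_u f)}) -> differentiable f x.
Proof.
move=> oU Ux fd fc; have [I [e [c [cc ec]]]] := fE.
pose l (h : E) : R := \sum_i c i h * 'D_(e i) f x.
have ll : linear (l : E -> R).
  move=> a u v; rewrite /l scaler_sumr -big_split /=; apply: eq_bigr => i _.
  by rewrite linearP mulrDl -mulrA.
pose L : {linear E -> R} := HB.pack l (GRing.isLinear.Build _ _ _ _ _ ll).
have Lc : continuous L.
  apply: (continuous_big (op := +%R)); first exact: add_continuous.
  by move=> i _ y; apply: cvgMr_tmp; exact: cc.
apply: (differentiable_of_bound Lc) => eps eps0.
pose hs (s : seq I) (h : E) := \sum_(i <- s) c i h *: e i.
have hs0 s : hs s h @[h --> 0] --> (0 : E).
  suff : continuous (hs s).
    by move=> /(_ 0); rewrite /continuous_at /hs big1 // => i _; rewrite linear0 scale0r.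
  apply: (continuous_big (op := +%R)); first exact: add_continuous.
  by move=> i _ y; apply: cvgZr_tmp; exact: cc.
suff key (s : seq I) : forall eps, 0 < eps -> \forall h \near (0 : E),
    `|f (hs s h + x) - f x - \sum_(i <- s) c i h * 'D_(e i) f x| <= eps * `|h|.
  apply: filterS (key (index_enum I) eps eps0) => h.
  by rewrite /hs -ec.
elim: s => [|i s IH] {eps eps0} eps eps0.
  by near=> h; rewrite /hs !big_nil add0r !subrr normr0 mulr_ge0 // ltW.
(* Half of [eps] goes to the direction [i], half to the remaining list. The step along [e i] has
   coefficient [c i h], at most [k] times the norm of [h], hence the tolerance [eps / 2 / k] for the
   derivative. *)
have [k k0 ck] := linear_lipschitz (cc i).
have e2 : 0 < eps / 2 by exact: divr_gt0.
have ek : 0 < eps / 2 / k by exact: divr_gt0.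
have : \forall y \near x, U y /\ `|'D_(e i) f x - 'D_(e i) f y| <= eps / 2 / k.
  apply: filterI; first exact: open_nbhs_nbhs.
  by have /cvgrPdist_le := fc (e i); apply.
move=> /nbhs_ballP[r r0 Hr].
have small : \forall h \near (0 : E), `|hs s h| + `|c i h| * `|e i| < r.
  have : (fun h => `|hs s h| + `|c i h| * `|e i|) h @[h --> 0] --> (0 : R).
    rewrite -[X in _ --> X](addr0 (0 : R)); apply: cvgD.
      by rewrite -(normr0 E); apply: cvg_norm; exact: hs0.
    rewrite -[X in _ --> X](mul0r `|e i|); apply: cvgMr_tmp.
    rewrite -(normr0 R) -(linear0 (c i)); apply: cvg_norm; exact: cc.
  by move=> /cvgr_lt; apply.
near=> h.
have sh : `|hs s h| + `|c i h| * `|e i| < r by near: h.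
have inb t : `|t| <= `|c i h| -> ball x r (t *: e i + (hs s h + x)).
  move=> tc; rewrite -ball_normE /= addrA opprD addrC subrKC normrN.
  apply: le_lt_trans sh; apply: le_trans (ler_normD _ _) _; rewrite lerD2l normrZ.
  by rewrite ler_wpM2r.
have [t tc Et] := @mean_value_line _ _ f (hs s h + x) (e i) (c i h)
   (fun t tc => fd _ _ (Hr _ (inb t tc)).1).
rewrite /hs !big_cons -/(hs s h).
have -> : f (c i h *: e i + hs s h + x) =
    f (hs s h + x) + c i h * 'D_(e i) f (t *: e i + (hs s h + x)).
  by rewrite -Et subrKC addrA.
set S := \sum_(j <- s) _; set D := 'D_(e i) f x; set D' := 'D_(e i) f _.
have -> : f (hs s h + x) + c i h * D' - f x - (c i h * D + S) =
   (f (hs s h + x) - f x - S) - c i h * (D - D') by ring.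
apply: le_trans (ler_normB _ _) _; rewrite [eps](splitr eps) mulrDl; apply: lerD.
  by rewrite /S; near: h; exact: IH.
rewrite normrM.
apply: (@le_trans _ _ (k * `|h| * (eps / 2 / k))).
  apply: ler_pM => //; exact: (Hr _ (inb t tc)).2.
rewrite le_eqVlt; apply/orP; left; apply/eqP; field; exact: lt0r_neq0.
Unshelve. all: end_near. Qed.

End Differentiable.

Section CkTheory.
Context {R : realType}.

Lemma is_derive_linear (E F G : normedModType R) (l : {linear F -> G}) (f : E -> F) x u :
  continuous l -> derivable f x u -> is_derive x u (l \o f) (l ('D_u f x)).
Proof.
move=> lc fd.
have key : (fun h : R => h^-1 *: ((l \o f) (h *: u + x) - (l \o f) x)) =
    l \o (fun h => h^-1 *: (f (h *: u + x) - f x)).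
  by apply/funext => h /=; rewrite -linearB -linearZ.
have cv : (fun h : R => h^-1 *: ((l \o f) (h *: u + x) - (l \o f) x)) h @[h --> 0^'] -->
    l ('D_u f x).
  by rewrite key; apply: cvg_comp; [exact: fd | exact: lc].
by split; [apply/cvg_ex; exists (l ('D_u f x))|exact: cvg_lim cv].
Qed.

Lemma Ck_continuous (E F : normedModType R) k (U : set E) (f : E -> F) x :
  Ck k U f -> U x -> {for x, continuous f}.
Proof. by case: k => [|k] [cf _]; exact: cf. Qed.

Lemma Ck_derivable (E F : normedModType R) k (U : set E) (f : E -> F) x u :
  Ck k.+1 U f -> U x -> derivable f x u.
Proof. by move=> [_ /(_ u)[+ _]]; exact. Qed.

Lemma Ck_derive (E F : normedModType R) k (U : set E) (f : E -> F) u :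
  Ck k.+1 U f -> Ck k U ('D_u f).
Proof. by move=> [_ /(_ u)[_]]. Qed.

Lemma CkW (E F : normedModType R) k (U : set E) (f : E -> F) : Ck k.+1 U f -> Ck k U f.
Proof.
elim: k f => [|k IH] f [cf df]; split=> // u; have [fd fk] := df u.
by split=> //; exact: IH.
Qed.

Lemma Ck_subset (E F : normedModType R) k (U V : set E) (f : E -> F) :
  V `<=` U -> Ck k U f -> Ck k V f.
Proof.
move=> VU; elim: k f => [|k IH] f [cf df]; (split; first by move=> x /VU; exact: cf) => // u.
by have [fd fk] := df u; split; [move=> x /VU; exact: fd|exact: IH].
Qed.

Lemma Ck_eq (E F : normedModType R) k (U : set E) (f g : E -> F) : open U ->
  (forall x, U x -> f x = g x) -> Ck k U f -> Ck k U g.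
Proof.
move=> oU.
have near_fg (f' g' : E -> F) x : (forall x, U x -> f' x = g' x) -> U x ->
    {near x, f' =1 g'}.
  by move=> fg Ux; apply: filterS fg (open_nbhs_nbhs _).
have eqc (f' g' : E -> F) x : (forall x, U x -> f' x = g' x) -> U x ->
    {for x, continuous f'} -> {for x, continuous g'}.
  move=> fg Ux cf; change (g' y @[y --> x] --> g' x); rewrite -(fg x Ux).
  apply: cvg_trans cf; apply: near_eq_cvg; exact: near_fg.
elim: k f g => [|k IH] f g fg [cf df];
  (split; first by move=> x Ux; exact: eqc fg Ux (cf x Ux)) => // u.
have [fd fk] := df u; split=> [x Ux|].
  by apply: near_eq_derivable (fd x Ux); exact: near_fg.
apply: IH fk => x Ux; exact: near_eq_derive (near_fg _ _ _ fg Ux).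
Unshelve. all: end_near. Qed.

Lemma Ck_cst (E F : normedModType R) k (U : set E) (a : F) : Ck k U (cst a : E -> F).
Proof.
elim: k a => [|k IH] a; (split; first by move=> x _; exact: cvg_cst) => // u.
split=> [x _|]; first exact: derivable_cst.
rewrite (_ : 'D_u _ = cst 0); first exact: IH.
by apply/funext => x; rewrite derive_cst.
Qed.

Lemma Ck_add (E F : normedModType R) k (U : set E) (f g : E -> F) : open U ->
  Ck k U f -> Ck k U g -> Ck k U (f \+ g).
Proof.
move=> oU; elim: k f g => [|k IH] f g [cf df] [cg dg];
  (split; first by move=> x Ux; apply: cvgD; [exact: cf|exact: cg]) => // u.
have [[fd fk] [gd gk]] := (df u, dg u).
split=> [x Ux|]; first by apply: derivableD; [exact: fd|exact: gd].
apply: Ck_eq (IH _ _ fk gk) => // x Ux; rewrite deriveD //; [exact: fd|exact: gd].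
Qed.

Lemma Ck_linear (E F G : normedModType R) k (U : set E) (l : {linear F -> G}) (f : E -> F) :
  open U -> continuous l -> Ck k U f -> Ck k U (l \o f).
Proof.
move=> oU lc; elim: k f => [|k IH] f [cf df];
  (split; first by move=> x Ux; apply: continuous_comp; [exact: cf|exact: lc]) => // u.
have [fd fk] := df u; split=> [x Ux|].
  by have [] := is_derive_linear lc (fd x Ux).
apply: Ck_eq (IH _ fk) => // x Ux /=; by have [_ ->] := is_derive_linear lc (fd x Ux).
Qed.

Lemma is_derive_scale (E F : normedModType R) (k : E -> R) (f : E -> F) x u :
  {for x, continuous k} -> derivable k x u -> derivable f x u ->
  is_derive x u (fun y => k y *: f y) ('D_u k x *: f x + k x *: 'D_u f x).
Proof.
move=> kc kd fd.
have fc : (fun h : R => f (h *: u + x)) h @[h --> 0^'] --> f x.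
  have := @derivable_line _ _ _ f x u 0; rewrite scale0r add0r => /(_ fd)[fd0 _].
  have fc : (fun s : R => f (s *: u + x)) s @[s --> (0 : R)] --> f (0 *: u + x).
    exact: (differentiable_continuous ((derivable1_diffP _ _).1 fd0)).
  by move: fc; rewrite scale0r add0r; exact: cvg_within_filter.
have key : (fun h : R => h^-1 *: (k (h *: u + x) *: f (h *: u + x) - k x *: f x)) =
    (fun h => (h^-1 *: (k (h *: u + x) - k x)) *: f (h *: u + x) +
      k x *: (h^-1 *: (f (h *: u + x) - f x))).
  apply/funext => h; rewrite scalerA [k x * _]mulrC -!scalerA -scalerDr; congr (_ *: _).
  by rewrite scalerBl scalerBr addrA subrK.
have cv : (fun h : R => h^-1 *: (k (h *: u + x) *: f (h *: u + x) - k x *: f x)) h @[h --> 0^'] -->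
    'D_u k x *: f x + k x *: 'D_u f x.
  rewrite key; apply: cvgD; first by apply: cvgZ => //; exact: kd.
  by apply: cvgZl_tmp; exact: fd.
by split; [apply/cvg_ex; exists ('D_u k x *: f x + k x *: 'D_u f x)|exact: cvg_lim cv].
Qed.

Lemma Ck_scale (E F : normedModType R) n (U : set E) (k : E -> R) (f : E -> F) : open U ->
  Ck n U k -> Ck n U f -> Ck n U (fun x => k x *: f x).
Proof.
move=> oU; elim: n k f => [|n IH] k f Ck_k Ck_f;
  (split; first by move=> x Ux; apply: cvgZ;
    [exact: Ck_continuous Ck_k Ux|exact: Ck_continuous Ck_f Ux]) => // u.
have kd x : U x -> derivable k x u := fun Ux => Ck_derivable (u := u) Ck_k Ux.
have fd x : U x -> derivable f x u := fun Ux => Ck_derivable (u := u) Ck_f Ux.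
have D x (Ux : U x) := is_derive_scale (Ck_continuous Ck_k Ux) (kd x Ux) (fd x Ux).
split=> [x Ux|]; first by have [] := D x Ux.
have := Ck_add oU (IH _ _ (Ck_derive u Ck_k) (CkW Ck_f)) (IH _ _ (CkW Ck_k) (Ck_derive u Ck_f)).
by apply: Ck_eq => // x Ux; have [_ ->] := D x Ux.
Qed.

Lemma Ck_sum (E F : normedModType R) n (U : set E) (I : Type) (s : seq I)
    (f : I -> E -> F) : open U ->
  (forall i, Ck n U (f i)) -> Ck n U (fun x => \sum_(i <- s) f i x).
Proof.
move=> oU fC; elim: s => [|i s IH].
  by apply: Ck_eq (Ck_cst n U (0 : F)) => // x _; rewrite big_nil.
by apply: Ck_eq (Ck_add oU (fC i) IH) => // x _; rewrite big_cons.
Qed.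

Lemma C1_differentiable (E F : normedModType R) {fE : finite_dim E} {fF : finite_dim F}
  (U : set E) (f : E -> F) x : open U -> Ck 1 U f -> U x -> differentiable f x.
Proof.
move=> oU Cf Ux; have [I [e [c [cc ec]]]] := fF.
have -> : f = (fun y => \sum_(i <- index_enum I) c i (f y) *: e i).
  by apply/funext => y; exact: ec.
elim: (index_enum I) => [|i s IH].
  rewrite (_ : (fun _ => _) = cst 0); first exact: differentiable_cst.
  by apply/funext => y; rewrite big_nil.
rewrite (_ : (fun _ => _) = (fun y => (c i \o f) y *: e i) +
   (fun y => \sum_(j <- s) c j (f y) *: e j)); last first.
  by apply/funext => y; rewrite big_cons.
apply: differentiableD => //; apply: differentiableZl.
have Cif := Ck_linear oU (cc i) Cf.
apply: (@C1_differentiable_real _ _ fE _ U) => // [y u Uy|u].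
  exact: Ck_derivable Cif Uy.
exact: (Ck_continuous (Ck_derive u Cif) Ux).
Qed.

Lemma Ck_le (E F : normedModType R) n m (U : set E) (f : E -> F) : (n <= m)%N ->
  Ck m U f -> Ck n U f.
Proof.
by move=> nm; rewrite -(subnK nm); elim: (m - n)%N => [|k IH]; rewrite ?add0n // addSn => /CkW.
Qed.

(** [Ck] iterates derivatives in fixed directions, whereas the chain rule differentiates [g] in the
    moving direction ['D_u f x]. Expanded in the [e i], the derivative becomes a sum of products to
    which the induction applies. *)
Lemma Ck_comp (E F G : normedModType R) {fE : finite_dim E} {fF : finite_dim F}
    {fG : finite_dim G} n (U : set E) (V : set F) (f : E -> F) (g : F -> G) :
  open U -> open V -> (forall x, U x -> V (f x)) ->
  Ck n U f -> Ck n V g -> Ck n U (g \o f).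
Proof.
move=> oU oV UV; elim: n f g UV => [|n IH] f g UV Cf Cg;
  (split; first by move=> x Ux; apply: continuous_comp;
    [exact: Ck_continuous Cf Ux|exact: Ck_continuous Cg (UV x Ux)]) => // u.
have fd x : U x -> differentiable f x.
  by move=> Ux; apply: (C1_differentiable oU _ Ux); exact: Ck_le Cf.
have gd x : U x -> differentiable g (f x).
  by move=> Ux; apply: (C1_differentiable oV _ (UV x Ux)); exact: Ck_le Cg.
split=> [x Ux|].
  by apply: diff_derivable; apply: differentiable_comp; [exact: fd|exact: gd].
have [I [e [c [cc ec]]]] := fF.
apply: (@Ck_eq _ _ _ _ (fun x => \sum_(i <- index_enum I) c i ('D_u f x) *: 'D_(e i) g (f x))).
- exact: oU.
- move=> x Ux; rewrite [RHS]deriveE; last by apply: differentiable_comp; [exact: fd|exact: gd].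
  rewrite diff_comp; [|exact: fd|exact: gd].
  rewrite /= -(deriveE u (fd x Ux)).
  rewrite [in RHS](ec ('D_u f x)) linear_sum; apply: eq_bigr => i _.
  by rewrite linearZ -(deriveE (e i) (gd x Ux)).
apply: Ck_sum => // i; apply: Ck_scale => //.
  exact: (Ck_linear oU (cc i) (Ck_derive u Cf)).
exact: (IH f ('D_(e i) g) UV (CkW Cf) (Ck_derive (e i) Cg)).
Qed.

End CkTheory.

(** * Symmetry of second derivatives *)

Section Schwarz.
Context {R : realType}.

Lemma subr_subACA (V : zmodType) (a b c d : V) : a - b - (c - d) = a - c - (b - d).
Proof. by rewrite !opprB addrACA [RHS]addrACA [- c - b]addrC. Qed.

Lemma dist_le_half (x y z e : R) : `|x - z| <= e / 2 -> `|y - z| <= e / 2 -> `|x - y| <= e.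
Proof.
move=> xz yz; apply: le_trans (ler_distD z _ _) _.
by rewrite [e]splitr [`|z - _|]distrC; exact: lerD.
Qed.

Lemma mean_value_line_pos (E : normedModType R) (f : E -> R) x u (a : R) : 0 <= a ->
  (forall t, 0 <= t <= a -> derivable f (t *: u + x) u) ->
  exists2 t, 0 <= t <= a & f (a *: u + x) - f x = a * 'D_u f (t *: u + x).
Proof.
move=> a0 fd; pose g (t : R) := f (t *: u + x).
have gd t : 0 <= t <= a -> is_derive t (1 : R) g ('D_u f (t *: u + x)).
  by move=> ta; apply: derivable_line; exact: fd.
have gc : {within `[0, a], continuous g}.
  by apply: derivable_within_continuous => t; rewrite in_itv /= => /gd[].
have [t tab E1] := MVT_segment a0
  (fun t tab => gd t (subset_itv_oo_cc tab)) gc.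
exists t; first by move: tab; rewrite in_itv.
have g0 : g 0 = f x by rewrite /g scale0r add0r.
by rewrite -g0 -/(g a) E1 subr0 mulrC.
Qed.

(** The mean value theorem is applied in direction [u] to the difference [phi] of two translates,
    then in direction [v] to the derivative. The second difference is symmetric in [u] and [v], so
    exchanging them gives Schwarz's theorem. *)
Lemma second_difference (E : normedModType R) (f : E -> R) x (u v : E) (t : R) :
  0 <= t ->
  (forall a b : R, 0 <= a <= t -> 0 <= b <= t ->
     derivable f (a *: u + (b *: v + x)) u /\
     derivable ('D_u f) (b *: v + (a *: u + x)) v) ->
  exists a b, [/\ 0 <= a <= t, 0 <= b <= t &
    f (t *: u + (t *: v + x)) - f (t *: v + x) - (f (t *: u + x) - f x) =
    t * (t * 'D_v ('D_u f) (b *: v + (a *: u + x)))].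
Proof.
move=> t0 fd; pose phi y := f (y + t *: v) - f y.
have tt : 0 <= t <= t by apply/andP; split.
have oo : (0 : R) <= 0 <= t by apply/andP; split.
have shiftd y w : derivable f (w + (t *: v + y)) u ->
    is_derive (w + y) u (fun y => f (y + t *: v)) ('D_u f (w + (t *: v + y))).
  move=> fdy.
  have key : (fun h : R => h^-1 *: (f (h *: u + (w + y) + t *: v) - f (w + y + t *: v))) =
    (fun h : R => h^-1 *: (f (h *: u + (w + (t *: v + y))) - f (w + (t *: v + y)))).
    by apply/funext => h; rewrite -!addrA [y + _]addrC.
  by split; rewrite /derivable /derive /= key.
have [a at_ Ea] : exists2 a, 0 <= a <= t &
   phi (t *: u + x) - phi x = t * 'D_u phi (a *: u + x).
  apply: mean_value_line_pos => // a at_.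
  apply: derivableB; first by have [] := shiftd x _ (fd a t at_ tt).1.
  by have := (fd a 0 at_ oo).1; rewrite scale0r add0r.
have phiE : 'D_u phi (a *: u + x) = 'D_u f (t *: v + (a *: u + x)) - 'D_u f (a *: u + x).
  rewrite /phi deriveB.
  - by have [_ ->] := shiftd x _ (fd a t at_ tt).1; rewrite addrCA.
  - by have [] := shiftd x _ (fd a t at_ tt).1.
  - by have := (fd a 0 at_ oo).1; rewrite scale0r add0r.
have [b bt Eb] := @mean_value_line_pos _ ('D_u f) (a *: u + x) v t t0
  (fun b bt => (fd a b at_ bt).2).
exists a, b; split=> //; rewrite -Eb -phiE -Ea /phi.
by rewrite -(addrA (t *: u) x) [x + _]addrC subr_subACA.
Qed.

Lemma schwarz_real (E : normedModType R) (f : E -> R) (U : set E) x u v :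
  open U -> Ck 2 U f -> U x -> 'D_u ('D_v f) x = 'D_v ('D_u f) x.
Proof.
move=> oU Cf Ux.
have cont w w' : {for x, continuous ('D_w ('D_w' f))}.
  exact: (Ck_continuous (Ck_derive w (Ck_derive w' Cf)) Ux).
apply/eqP; rewrite -subr_eq0 -normr_le0; apply/ler_addgt0Pl => e e0; rewrite addr0.
have e2 : 0 < e / 2 by exact: divr_gt0.
have : \forall y \near x, [/\ U y, `|'D_u ('D_v f) x - 'D_u ('D_v f) y| <= e / 2 &
   `|'D_v ('D_u f) x - 'D_v ('D_u f) y| <= e / 2].
  have N1 : nbhs x U by exact: (open_nbhs_nbhs (conj oU Ux)).
  have N2 : \forall y \near x, `|'D_u ('D_v f) x - 'D_u ('D_v f) y| <= e / 2.
    by have /cvgrPdist_le := cont u v; apply.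
  have N3 : \forall y \near x, `|'D_v ('D_u f) x - 'D_v ('D_u f) y| <= e / 2.
    by have /cvgrPdist_le := cont v u; apply.
  apply: filterS (filterI N1 (filterI N2 N3)) => y [h1 [h2 h3]].
  exact: And3 h1 h2 h3.
move=> /nbhs_ballP[r r0 Hr].
(* Small enough for the parallelogram spanned at [x] by [u] and [v], scaled by [t], to stay in the
   ball of radius [r]; the summand 1 keeps the denominator positive when both vectors vanish. *)
pose t := r / (2 * (`|u| + `|v| + 1)).
have uv0 : 0 < `|u| + `|v| + 1 by rewrite ltr_wpDl // addr_ge0.
have t0 : 0 < t by rewrite divr_gt0 // mulr_gt0.
have inb a b (w w' : E) : `|w| + `|w'| = `|u| + `|v| -> 0 <= a <= t -> 0 <= b <= t ->
    ball x r (a *: w + (b *: w' + x)).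
  move=> ww' /andP[a0 at_] /andP[b0 bt].
  rewrite -ball_normE /= addrA opprD addrC subrKC normrN.
  apply: le_lt_trans (ler_normD _ _) _; rewrite !normrZ !ger0_norm //.
  apply: (@le_lt_trans _ _ (t * (`|u| + `|v|))).
    by rewrite -ww' mulrDr addrC; apply: lerD; apply: ler_pM.
  rewrite /t mulrAC ltr_pdivrMr ?mulr_gt0 // ltr_pM2l //; have := normr_ge0 u; have := normr_ge0 v.
  lra.
have D2 w w' y : U y -> derivable f y w /\ derivable ('D_w f) y w'.
  move=> Uy; split; first exact: Ck_derivable Cf Uy.
  exact: Ck_derivable (Ck_derive w Cf) Uy.
have uvC : `|v| + `|u| = `|u| + `|v| by rewrite addrC.
have [|a [b [at_ bt Eab]]] := @second_difference _ f x u v t (ltW t0).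
  move=> a b at_ bt; split.
    by have [Uy _ _] := Hr _ (inb a b u v erefl at_ bt); exact: (D2 u u _ Uy).1.
  by have [Uy _ _] := Hr _ (inb b a v u uvC bt at_); exact: (D2 u v _ Uy).2.
have [|a' [b' [at' bt' Eab']]] := @second_difference _ f x v u t (ltW t0).
  move=> a' b' at' bt'; split.
    by have [Uy _ _] := Hr _ (inb a' b' v u uvC at' bt'); exact: (D2 v v _ Uy).1.
  by have [Uy _ _] := Hr _ (inb b' a' u v erefl bt' at'); exact: (D2 v u _ Uy).2.
have EE : 'D_v ('D_u f) (b *: v + (a *: u + x)) = 'D_u ('D_v f) (b' *: u + (a' *: v + x)).
  apply: (mulfI (lt0r_neq0 t0)); apply: (mulfI (lt0r_neq0 t0)).
  etransitivity; first exact: (esym Eab).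
  etransitivity; last exact: Eab'.
  by rewrite subr_subACA (addrCA (t *: u)).
have [_ _ H1] := Hr _ (inb b a v u uvC bt at_).
have [_ H2 _] := Hr _ (inb b' a' u v erefl bt' at').
rewrite EE in H1; exact: dist_le_half H2 H1.
Unshelve. all: end_near. Qed.

Lemma schwarz (E F : normedModType R) {fF : finite_dim F} (f : E -> F) (U : set E) x u v :
  open U -> Ck 2 U f -> U x -> 'D_u ('D_v f) x = 'D_v ('D_u f) x.
Proof.
move=> oU Cf Ux; have [I [e [c [cc ec]]]] := fF.
have inj a b : (forall i, c i a = c i b) -> a = b.
  by move=> ab; rewrite (ec a) (ec b); apply: eq_bigr => i _; rewrite ab.
apply: inj => i.
have D w w' : 'D_w ('D_w' (c i \o f)) x = c i ('D_w ('D_w' f) x).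
  have [_ <-] := is_derive_linear (cc i) (Ck_derivable (u := w) (Ck_derive w' Cf) Ux).
  apply: near_eq_derive; near=> y.
  have Uy : U y by near: y; exact: (open_nbhs_nbhs (conj oU Ux)).
  by have [_ ->] := is_derive_linear (cc i) (Ck_derivable (u := w') Cf Uy).
rewrite -!D; exact: (schwarz_real _ _ oU (Ck_linear oU (cc i) Cf) Ux).
Unshelve. all: end_near. Qed.

End Schwarz.

(** * Integrals over the unit interval depending on a parameter *)

Section UnitIntegral.
Context {R : realType}.
Implicit Types (f g F : R -> R).

Definition unit_integral f : R := \int[lebesgue_measure]_(x in `[0, 1]) f x.

Definition unit_continuous f := forall x : R, 0 <= x <= 1 -> {for x, continuous f}.

Lemma unit_within f : unit_continuous f -> {within `[0, 1], continuous f}.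
Proof.
by move=> fc; apply: continuous_in_subspaceT => x; rewrite inE /= in_itv => /fc.
Qed.

Lemma unit_integrable f : unit_continuous f ->
  lebesgue_measure.-integrable `[0, 1] (EFin \o f).
Proof.
move=> /unit_within fc; apply: continuous_compact_integrable => //.
exact: segment_compact.
Qed.

Lemma unit_integralB f g : unit_continuous f -> unit_continuous g ->
  unit_integral (f \- g) = unit_integral f - unit_integral g.
Proof. by move=> fc gc; apply: RintegralB => //; exact: unit_integrable. Qed.

Lemma unit_integralZ (a : R) f : unit_continuous f ->
  unit_integral (fun x => a * f x) = a * unit_integral f.
Proof. by move=> fc; apply: RintegralZl => //; exact: unit_integrable. Qed.

Lemma unit_integral_cst (a : R) : unit_integral (fun=> a) = a.
Proof.
by rewrite /unit_integral Rintegral_cst//= lebesgue_measure_itv//= lte01 oppr0 addr0 mulr1.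
Qed.

Lemma le_unit_integral f g : unit_continuous f -> unit_continuous g ->
  (forall x : R, 0 <= x <= 1 -> f x <= g x) -> unit_integral f <= unit_integral g.
Proof.
move=> fc gc fg; apply: le_Rintegral => //; try exact: unit_integrable.
Qed.

Lemma unit_integral_bound f (e : R) : unit_continuous f ->
  (forall x : R, 0 <= x <= 1 -> `|f x| <= e) -> `|unit_integral f| <= e.
Proof.
move=> fc fe; have cc (a : R) : unit_continuous (fun=> a) by move=> x _; exact: cvg_cst.
apply/ler_normlP; split.
  rewrite lerNl -(unit_integral_cst (- e)); apply: le_unit_integral => // x /fe.
  by move=> /ler_normlP[? ?]; rewrite lerNl.
rewrite -(unit_integral_cst e); apply: le_unit_integral => // x /fe.
by move=> /ler_normlP[].
Qed.

Lemma unit_integral_FTC F f : unit_continuous f ->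
  (forall x : R, 0 <= x <= 1 -> is_derive x 1 F (f x)) -> unit_integral f = F 1 - F 0.
Proof.
move=> fc dF.
have Fc x : 0 <= x <= 1 -> {for x, continuous F}.
  by move=> x01; apply/differentiable_continuous/derivable1_diffP; have [] := dF x x01.
rewrite /unit_integral /Rintegral (continuous_FTC2 ltr01 (unit_within fc) (F := F)) //.
  split=> [x /subset_itv_oo_cc||].
  - by rewrite in_itv /= => /dF[].
  - by apply: cvg_at_right_filter; apply: Fc; rewrite lexx ler01.
  - by apply: cvg_at_left_filter; apply: Fc; rewrite lexx ler01.
by move=> x /subset_itv_oo_cc; rewrite in_itv /= derive1E => /dF[_ ->].
Qed.

(** The tube lemma, from compactness of [0,1]. *)
Lemma near_unit (E : topologicalType) (y0 : E) (Q : set (R * E)) :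
  (forall t : R, 0 <= t <= 1 -> \forall z \near (t, y0), Q z) ->
  \forall y \near y0, forall t : R, 0 <= t <= 1 -> Q (t, y).
Proof.
move=> HQ.
have /compact_near_coveringP nc := @segment_compact R 0 1.
have H : \forall y \near y0, `[0, 1]%classic `<=` (fun t => Q (t, y)).
  apply: nc => t; rewrite /= in_itv /= => /HQ.
  by apply: filterS => -[].
by apply: filterS H => y H t t01; apply: H; rewrite /= in_itv.
Qed.

Section ParametricIntegral.
Variables (E : normedModType R) (W : set (R * E)%type) (U : set E).
Hypothesis oU : open U.
Hypothesis UW : forall (t : R) y, 0 <= t <= 1 -> U y -> W (t, y).

Lemma parameter_unit_continuous (f : R * E -> R) y :
  (forall z, W z -> {for z, continuous f}) -> U y -> unit_continuous (fun t => f (t, y)).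
Proof.
move=> fc Uy t t01; have ft := fc (t, y) (UW t01 Uy).
have pc : (fun t' : R => (t', y)) t' @[t' --> t] --> (t, y).
  by apply: (cvg_pair (F := nbhs t) (G := nbhs t) (H := nbhs y)); [exact: cvg_id|exact: cvg_cst].
exact: (cvg_comp _ _ pc ft).
Qed.

Lemma parameter_near (f : R * E -> R) y0 (e : R) :
  (forall z, W z -> {for z, continuous f}) -> U y0 -> 0 < e ->
  \forall y \near y0, forall t : R, 0 <= t <= 1 -> `|f (t, y) - f (t, y0)| <= e.
Proof.
move=> fc Uy e0; apply: (@near_unit _ _ (fun z => `|f z - f (z.1, y0)| <= e)) => t t01.
have e2 : 0 < e / 2 by exact: divr_gt0.
have /cvgrPdist_le/(_ _ e2) Hn := fc (t, y0) (UW t01 Uy).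
have Hn' : \forall z \near (t, y0), `|f (t, y0) - f (z.1, y0)| <= e / 2.
  have pc : (fun z : R * E => (z.1, y0)) z @[z --> (t, y0)] --> (t, y0).
    by apply: (cvg_pair (F := nbhs (t, y0)) (G := nbhs t) (H := nbhs y0));
      [exact: cvg_fst|exact: cvg_cst].
  exact: (pc _ Hn).
apply: filterS (filterI Hn Hn') => z [h1 h2].
by apply: (@dist_le_half _ _ _ (f (t, y0))); rewrite distrC.
Qed.

Lemma parameter_continuous (f : R * E -> R) y0 :
  (forall z, W z -> {for z, continuous f}) -> U y0 ->
  {for y0, continuous (fun y => unit_integral (fun t => f (t, y)))}.
Proof.
move=> fc Uy; apply/cvgrPdist_le => e e0.
have NU : nbhs y0 U by exact: (open_nbhs_nbhs (conj oU Uy)).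
apply: filterS (filterI NU (parameter_near fc Uy e0)) => y [Uy' Hy].
have c0 := parameter_unit_continuous fc Uy; have c1 := parameter_unit_continuous fc Uy'.
rewrite -unit_integralB //; apply: unit_integral_bound => [t t01|t t01].
  by apply: cvgB; [exact: c0|exact: c1].
by rewrite distrC; exact: Hy.
Qed.

(** By the mean value theorem, the difference quotient at each [t] is a value of the partial
    derivative at a nearby point of the line through [y]; the tube lemma makes it close to the value
    at [y] uniformly in [t]. *)
Lemma parameter_derive (f : R * E -> R) y u :
  Ck 1 W f -> U y ->
  is_derive y u (fun y => unit_integral (fun t => f (t, y)))
    (unit_integral (fun t => 'D_((0, u) : R * E) f (t, y))).
Proof.
move=> Cf Uy.
have fc z : W z -> {for z, continuous f} by exact: Ck_continuous Cf.
have dc z : W z -> {for z, continuous ('D_((0, u) : R * E) f)}.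
  exact: (Ck_continuous (Ck_derive _ Cf)).
set G := fun y => _; set D := unit_integral _.
have cv : (fun h : R => h^-1 *: (G (h *: u + y) - G y)) h @[h --> 0^'] --> D.
  apply/cvgrPdist_le => e e0.
  have NU : nbhs y U by exact: (open_nbhs_nbhs (conj oU Uy)).
  have /nbhs_ballP[r r0 Hr] : nbhs y (U `&` [set y' | forall t : R, 0 <= t <= 1 ->
      `|'D_((0, u) : R * E) f (t, y') - 'D_((0, u) : R * E) f (t, y)| <= e]).
    exact: (filterI NU (parameter_near dc Uy e0)).
  have small : \forall h \near (0 : R), `|h| * `|u| < r.
    have : (fun h : R => `|h| * `|u|) h @[h --> (0 : R)] --> `|0 : R| * `|u|.
      by apply: cvgMr_tmp; apply: cvg_norm; exact: cvg_id.
    rewrite normr0 mul0r.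
    by move=> /cvgr_lt; apply.
  rewrite near_withinE; apply: filterS small => h hr h0.
  have inb t : `|t| <= `|h| -> ball y r (t *: u + y).
    move=> th; rewrite -ball_normE /= opprD addrC subrK normrN normrZ.
    by apply: le_lt_trans hr; rewrite ler_wpM2r.
  have [Uh _] := Hr _ (inb h (lexx _)).
  have c0 := parameter_unit_continuous fc Uy; have c1 := parameter_unit_continuous fc Uh.
  have cd := parameter_unit_continuous dc Uy.
  have cdiff : unit_continuous (fun t => h^-1 * (f (t, h *: u + y) - f (t, y))).
    by move=> t t01; apply: cvgMl_tmp; apply: cvgB; [exact: c1|exact: c0].
  have -> : h^-1 *: (G (h *: u + y) - G y) =
      unit_integral (fun t => h^-1 * (f (t, h *: u + y) - f (t, y))).
    rewrite unit_integralZ; last by move=> t t01; apply: cvgB; [exact: c1|exact: c0].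
    by rewrite -unit_integralB.
  rewrite -unit_integralB //; apply: unit_integral_bound => [t t01|t t01].
    by apply: cvgB; [exact: cd|exact: cdiff].
  have lineE (s : R) : s *: ((0, u) : R * E) + (t, y) = (t, s *: u + y).
    by congr pair; rewrite /= scaler0 add0r.
  have [s sh] := @mean_value_line _ _ f (t, y) ((0, u) : R * E) h
    (fun s sh => Ck_derivable Cf (eq_ind_r W (UW t01 (Hr _ (inb s sh)).1) (lineE s))).
  rewrite !lineE /= => ->; rewrite mulKf // distrC.
  by apply: (Hr _ (inb s sh)).2.
by split; [apply/cvg_ex; exists D|exact: cvg_lim cv].
Qed.

Lemma parameter_Ck n (f : R * E -> R) : Ck n W f ->
  Ck n U (fun y => unit_integral (fun t => f (t, y))).
Proof.
elim: n f => [|n IH] f Cf;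
  (split; first by move=> y Uy; apply: parameter_continuous Uy => z;
    exact: Ck_continuous Cf) => // u.
have C1f : Ck 1 W f by apply: Ck_le Cf.
split=> [y Uy|]; first by have [] := parameter_derive u C1f Uy.
apply: Ck_eq (IH _ (Ck_derive (0, u) Cf)) => // y Uy.
by have [_ ->] := parameter_derive u C1f Uy.
Qed.

End ParametricIntegral.
End UnitIntegral.

Section CkConstructions.
Context {R : realType}.

Lemma is_derive_affine (E F : normedModType R) (f : E -> F) x u w :
  (forall h : R, f (h *: u + x) = f x + h *: w) -> is_derive x u f w.
Proof.
move=> fw.
have cv : (fun h : R => h^-1 *: (f (h *: u + x) - f x)) h @[h --> 0^'] --> w.
  apply: cvg_near_cst; rewrite near_withinE; apply: nearW => h h0.
  by rewrite fw addrAC subrr add0r scalerA mulVf // scale1r.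
by split; [apply/cvg_ex; exists w|exact: cvg_lim cv].
Qed.

Lemma is_derive_sum_seq (E F : normedModType R) (I : Type) (s : seq I) (f : I -> E -> F)
    (df : I -> F) x u : (forall i, is_derive x u (f i) (df i)) ->
  is_derive x u (fun y => \sum_(i <- s) f i y) (\sum_(i <- s) df i).
Proof.
move=> fd; elim: s => [|i s IH].
  rewrite big_nil (_ : (fun _ => _) = cst 0) //; last by apply/funext => y; rewrite big_nil.
  exact: is_derive_cst.
rewrite big_cons (_ : (fun _ => _) = f i + (fun y => \sum_(j <- s) f j y)).
  exact: is_deriveD.
by apply/funext => y; rewrite big_cons.
Qed.

Lemma derive_comp (E F G : normedModType R) (f : E -> F) (g : F -> G) x u :
  differentiable f x -> differentiable g (f x) ->
  'D_u (g \o f) x = 'D_('D_u f x) g (f x).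
Proof.
move=> fd gd; rewrite deriveE; last exact: differentiable_comp.
by rewrite diff_comp //= -(deriveE u fd) -deriveE.
Qed.

Lemma Ck_pair (E F G : normedModType R) n (U : set E) (f : E -> F) (g : E -> G) : open U ->
  Ck n U f -> Ck n U g -> Ck n U (fun x => (f x, g x)).
Proof.
move=> oU Cf Cg.
have li : linear (fun a : F => (a, 0 : G)).
  by move=> a p q; congr pair; rewrite /= scaler0 addr0.
have lj : linear (fun a : G => (0 : F, a)).
  by move=> a p q; congr pair; rewrite /= scaler0 addr0.
pose i : {linear F -> (F * G)%type} := HB.pack (fun a : F => (a, 0 : G))
  (GRing.isLinear.Build _ _ _ _ _ li).
pose j : {linear G -> (F * G)%type} := HB.pack (fun a : G => (0 : F, a))
  (GRing.isLinear.Build _ _ _ _ _ lj).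
have ic : continuous i.
  by move=> a; apply: (cvg_pair (F := nbhs a) (G := nbhs a) (H := nbhs (0 : G)));
    [exact: cvg_id|exact: cvg_cst].
have jc : continuous j.
  by move=> a; apply: (cvg_pair (F := nbhs a) (G := nbhs (0 : F)) (H := nbhs a));
    [exact: cvg_cst|exact: cvg_id].
apply: Ck_eq (Ck_add oU (Ck_linear oU ic Cf) (Ck_linear oU jc Cg)) => // x Ux.
by congr pair; rewrite /= (addr0, add0r).
Qed.

Lemma Ck_id (E : normedModType R) n (U : set E) : Ck n U (id : E -> E).
Proof.
case: n => [|n]; (split; first by move=> x _; exact: cvg_id) => // u.
split=> [x _|]; first exact: derivable_id.
rewrite (_ : 'D_u _ = cst u); first exact: Ck_cst.
by apply/funext => x; rewrite derive_id.
Qed.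

Lemma Ck_fst (E F : normedModType R) n (U : set (E * F)%type) : open U ->
  Ck n U (fst : E * F -> E).
Proof.
move=> oU; apply: (@Ck_linear _ _ _ _ _ _ (fst : {linear (E * F)%type -> E}) id) => //.
  by move=> z; exact: cvg_fst.
exact: Ck_id.
Qed.

Lemma Ck_snd (E F : normedModType R) n (U : set (E * F)%type) : open U ->
  Ck n U (snd : E * F -> F).
Proof.
move=> oU; apply: (@Ck_linear _ _ _ _ _ _ (snd : {linear (E * F)%type -> F}) id) => //.
  by move=> z; exact: cvg_snd.
exact: Ck_id.
Qed.

Lemma open_preimage (T T' : topologicalType) (f : T -> T') (U : set T) (V : set T') :
  open U -> open V -> (forall x, U x -> {for x, continuous f}) ->
  open (U `&` f @^-1` V).
Proof.
move=> oU oV fc; rewrite openE => x [Ux Vfx]; apply: filterI.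
  exact: (open_nbhs_nbhs (conj oU Ux)).
exact: (fc x Ux _ (open_nbhs_nbhs (conj oV Vfx))).
Qed.

Lemma open_setX (T T' : topologicalType) (A : set T) (B : set T') :
  open A -> open B -> open (A `*` B).
Proof.
move=> oA oB; rewrite openE => -[x y] /= [Ax By]; exists (A, B) => //=.
by split; [exact: (open_nbhs_nbhs (conj oA Ax))|exact: (open_nbhs_nbhs (conj oB By))].
Qed.

End CkConstructions.

(** * The Poincare lemma with a parameter *)

Section Poincare.
Context {R : realType}.
Variables (F : normedModType R) (fF : finite_dim F) (x0 : F) (r : R) (S K : set R).
(* A family of 1-forms on a ball with parameter in [S], closed only for the parameters in [K]:
   smoothness in the parameter needs an open set, while the isotopy lives on [0,1]. *)
Variable B : F * R -> F -> R.
Let U : set (F * R)%type := ball x0 r `*` S.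
Hypotheses (oS : open S).
Hypothesis B_linear : forall y a u v, U y -> B y (a *: u + v) = a * B y u + B y v.
Hypothesis B_smooth : forall u, Cinf U (fun y => B y u).
Hypothesis B_closed : forall y u w, U y -> K y.2 ->
  'D_((u, 0) : F * R) (fun z => B z w) y = 'D_((w, 0) : F * R) (fun z => B z u) y.

(** The radial homotopy operator in the first variable: [G (x, s)] is the integral of the form with
    parameter [s] along the segment from [x0] to [x]. The dilation [m] keeps [s], so closedness is
    invoked only for the parameter of the point itself. *)
Lemma poincare : exists2 G : F * R -> R, Cinf U G &
  forall y u, U y -> K y.2 -> 'D_((u, 0) : F * R) G y = B y u.
Proof.
have oU : open U by apply: open_setX => //; exact: ball_open.
have [I [e [c [cc ec]]]] := fF.
pose m (z : R * (F * R)) : F * R := (z.1 *: (z.2.1 - x0) + x0, z.2.2).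
pose W := m @^-1` U.
(* For [z = (t, (x, s))] in [W] this is [B (m z) (x - x0)] by linearity; it is expanded in the [e i]
   because smoothness of [B] is known for fixed vectors. *)
pose f (z : R * (F * R)) : R := \sum_(i <- index_enum I) c i (z.2.1 - x0) * B (m z) (e i).
pose N : normedModType R := (R * (F * R))%type.
have oT : open [set: N] by exact: openT.
have m_smooth n : Ck n [set: N] m.
  apply: Ck_pair => //; last first.
    by apply: (Ck_comp (V := setT)) (Ck_snd n oT) (Ck_snd n openT) => //; exact: openT.
  apply: Ck_add => //; last exact: Ck_cst.
  apply: Ck_scale => //; first exact: Ck_fst.
  apply: Ck_add => //; last exact: Ck_cst.
  by apply: (Ck_comp (V := setT)) (Ck_snd n oT) (Ck_fst n openT) => //; exact: openT.
have oW : open W.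
  rewrite (_ : W = [set: N] `&` m @^-1` U); last by rewrite setTI.
  apply: open_preimage => // z _; exact: (Ck_continuous (m_smooth 0)).
have Wm n : Ck n W m by exact: Ck_subset (m_smooth n).
have f_smooth n : Ck n W f.
  apply: Ck_sum => // i; apply: Ck_scale => //.
    apply: (Ck_linear oW (cc i)); apply: Ck_add => //; last exact: Ck_cst.
    by apply: (Ck_comp (V := setT)) (Ck_snd n oW) (Ck_fst n openT) => //; exact: openT.
  by apply: (Ck_comp (V := U)) (Wm n) (B_smooth (e i) n).
have UW (t : R) y : 0 <= t <= 1 -> U y -> W (t, y).
  move=> /andP[t0 t1] [yb yS]; split=> //=.
  move: yb; rewrite -!ball_normE /= opprD addrCA subrr addr0 normrN normrZ distrC.
  apply: le_lt_trans; rewrite ger0_norm //; exact: ler_piMl.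
pose G y := unit_integral (fun t => f (t, y)).
exists G => [n|y u Uy Ky]; first exact: (parameter_Ck oU UW).
have [_ ->] := parameter_derive oU UW ((u, 0) : F * R) (f_smooth 1) Uy.
pose xi := y.1 - x0.
have Bu_diff z w : U z -> differentiable (fun z => B z w) z.
  exact: (C1_differentiable oU (B_smooth w 1)).
have m_diff z : differentiable m z by exact: (C1_differentiable oT (m_smooth 1)).
have mu (t : R) : is_derive (t, y) ((0, (u, 0)) : N) m ((t *: u, 0) : F * R).
  apply: is_derive_affine => h; congr pair; rewrite /= ?scaler0 ?add0r ?addr0 //.
  rewrite -(addrA (h *: u)) scalerDr -(addrA (t *: (h *: u))) [LHS]addrC; congr (_ + _).
  by rewrite !scalerA mulrC.
have mt (t : R) : is_derive (t, y) ((1, 0) : N) m ((xi, 0) : F * R).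
  apply: is_derive_affine => h; congr pair; rewrite /= ?scaler0 ?add0r ?addr0 //.
  by rewrite [h *: 1]mulr1 scalerDl -addrA [LHS]addrC.
have B0 z : U z -> B z 0 = 0.
  by move=> Uz; have := B_linear (-1) 0 0 Uz; rewrite scaler0 addr0 mulN1r addNr.
have Bsum z (a : I -> R) s : U z ->
    B z (\sum_(i <- s) a i *: e i) = \sum_(i <- s) a i * B z (e i).
  move=> Uz; elim: s => [|i s IH]; first by rewrite !big_nil B0.
  by rewrite !big_cons B_linear // IH.
have Dlin (g : F * R -> R) z (k : R) (w : F) : differentiable g z ->
    'D_((k *: w, 0) : F * R) g z = k * 'D_((w, 0) : F * R) g z.
  move=> gd; rewrite !deriveE //; transitivity ('d g z (k *: ((w, 0) : F * R))).
    by congr ('d g z _); congr pair; rewrite /= scaler0.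
  exact: linearZ.
have Dsum (g : F * R -> R) z s (w : F) : differentiable g z ->
    'D_((\sum_(i <- s) c i w *: e i, 0) : F * R) g z =
    \sum_(i <- s) c i w * 'D_((e i, 0) : F * R) g z.
  move=> gd; elim: s => [|i s IH]; first by rewrite !big_nil derive0.
  rewrite !big_cons -IH -Dlin // !deriveE // -linearD; congr ('d g z _).
  by congr pair; rewrite /= addr0.
have slice (t : R) : t *: ((1, 0) : N) + (0, y) = (t, y).
  by congr pair; rewrite /= ?scaler0 ?add0r ?addr0 // [LHS]mulr1.
(* The derivative of the integrand along [u] is a total derivative in [t]. Closedness is what turns
   the derivative of [B] along [u] into one along the radial vector [xi]. *)
have key (t : R) : 0 <= t <= 1 ->
    is_derive t (1 : R) (fun t => t * B (m (t, y)) u) ('D_((0, (u, 0)) : N) f (t, y)).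
  move=> t01; have Uz : U (m (t, y)) := UW _ _ t01 Uy.
  have D1 i : is_derive (t, y) ((0, (u, 0)) : N) (fun z => c i (z.2.1 - x0) * B (m z) (e i))
     (c i u * B (m (t, y)) (e i) +
      t * (c i xi * 'D_((e i, 0) : F * R) (fun z => B z u) (m (t, y)))).
    have k1 : is_derive (t, y) ((0, (u, 0)) : N) (fun z : N => c i (z.2.1 - x0)) (c i u).
      apply: is_derive_affine => h /=.
      rewrite -(addrA (h *: u)) linearD linearZ; exact: addrC.
    have kd : differentiable (fun z : N => c i (z.2.1 - x0)) (t, y).
      apply: (C1_differentiable oW _ (UW _ _ t01 Uy)).
      apply: (Ck_linear oW (cc i)); apply: Ck_add => //; last exact: Ck_cst.
      by apply: (Ck_comp (V := setT)) (Ck_snd 1 oW) (Ck_fst 1 openT) => //; exact: openT.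
    have g1 : is_derive (t, y) ((0, (u, 0)) : N) (fun z : N => B (m z) (e i))
        ('D_((t *: u, 0) : F * R) (fun z => B z (e i)) (m (t, y))).
      have gd := Bu_diff _ (e i) Uz.
      split.
        by apply: diff_derivable; apply: (differentiable_comp (m_diff _) gd).
      by rewrite (derive_comp _ (m_diff _) gd); have [_ ->] := mu t.
    have [k1d k1E] := k1; have [g1d g1E] := g1.
    have := is_derive_scale (differentiable_continuous kd) k1d g1d.
    rewrite k1E g1E Dlin; last exact: Bu_diff.
    rewrite (B_closed u (e i) Uz Ky) => dk; apply: is_derive_eq dk _.
    by congr (_ + _); exact: mulrCA.
  have [_ ->] := is_derive_sum_seq (index_enum I) D1.
  rewrite big_split /= -mulr_sumr -Dsum; last exact: Bu_diff.
  rewrite -Bsum // -ec -ec.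
  have gd : differentiable ((fun z => B z u) \o m) (t, y).
    by apply: differentiable_comp; [exact: m_diff|exact: Bu_diff].
  have := @derivable_line _ _ _ ((fun z => B z u) \o m) (0, y) ((1, 0) : N) t.
  have gv : derivable ((fun z => B z u) \o m) (t, y) ((1, 0) : N) by exact: diff_derivable.
  rewrite slice => /(_ gv).
  rewrite (derive_comp _ (m_diff _) (Bu_diff _ u Uz)).
  have [_ ->] := mt t.
  have -> : (fun s : R => ((fun z => B z u) \o m) (s *: ((1, 0) : N) + (0, y))) =
      (fun s => B (m (s, y)) u) by apply/funext => s; rewrite slice.
  move=> dB; apply: is_derive_eq; rewrite addrC; congr (_ + _).
  by rewrite -[RHS]mulr1.
have fc : unit_continuous (fun t => 'D_((0, (u, 0)) : N) f (t, y)).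
  have dc z : W z -> {for z, continuous ('D_((0, (u, 0)) : N) f)}.
    exact: (Ck_continuous (Ck_derive _ (f_smooth 1))).
  exact: (parameter_unit_continuous UW dc Uy).
rewrite (unit_integral_FTC fc key) mul1r mul0r subr0; congr (B _ u).
by rewrite /m /= scale1r subrK -surjective_pairing.
Qed.
End Poincare.

(** * Smooth maps and forms in charts *)

Section DeriveIn.
Context {R : realType} {E F : normedModType R}.
Implicit Types (D : set E) (f g : E -> F) (x u : E).

(* Guarantees that the filter in [derive_in D f x u] is proper, so that this limit is not junk. *)
Definition line_adherent D x u := forall A : set R, (\forall t \near 0^', A t) ->
  exists t : R, A t /\ D (t *: u + x).

Lemma near_line x u (A : set E) : nbhs x A -> \forall t \near (0 : R), A (t *: u + x).
Proof.
move=> Ax; have lc : (fun t : R => t *: u + x) t @[t --> (0 : R)] --> (0 *: u + x).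
  by apply: cvgD; [apply: cvgZr_tmp; exact: cvg_id|exact: cvg_cst].
by apply: lc; rewrite scale0r add0r.
Qed.

Lemma line_adherent_within D x u : line_adherent D x u ->
  ProperFilter (within [set t : R | D (t *: u + x)] 0^').
Proof.
move=> acc; apply: Build_ProperFilter_ex => A.
rewrite /within /= => /acc[t [At Dt]].
by exists t; exact: At.
Qed.

Lemma derive_in_near D f g x u : D x -> (\forall y \near x, D y -> f y = g y) ->
  derive_in D f x u = derive_in D g x u.
Proof.
move=> Dx fg; rewrite /derive_in; congr (lim _).
have fgx : f x = g x by exact: (nbhs_singleton fg Dx).
have fg0 : \forall t \near (0 : R)^', D (t *: u + x) -> f (t *: u + x) = g (t *: u + x).
  exact: (nbhs_dnbhs (near_line u fg)).
pose q (k : E -> F) (t : R) := t^-1 *: (k (t *: u + x) - k x).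
have qq k k' (A : set F) : k x = k' x ->
    (\forall t \near (0 : R)^', D (t *: u + x) -> k (t *: u + x) = k' (t *: u + x)) ->
    (\forall t \near (0 : R)^', D (t *: u + x) -> A (q k t)) ->
    \forall t \near (0 : R)^', D (t *: u + x) -> A (q k' t).
  move=> kx kk' HA; apply: filterS (filterI HA kk') => t [h1 h2] Dt.
  by rewrite /q -kx -(h2 Dt); exact: h1.
rewrite eqEsubset; split=> A; first exact: qq fgx fg0.
apply: (qq g f A (esym fgx)); apply: filterS fg0 => t ft Dt; exact: esym (ft Dt).
Qed.

Lemma derive_in_eq D f g x u : D x -> line_adherent D x u ->
  (\forall y \near x, D y -> f y = g y) -> derivable g x u ->
  derive_in D f x u = 'D_u g x.
Proof.
move=> Dx acc fg gd; rewrite (derive_in_near u Dx fg) /derive_in.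
have PF := line_adherent_within acc.
apply: cvg_lim => //.
apply: (@cvg_trans _ ((fun t : R => t^-1 *: (g (t *: u + x) - g x)) @ 0^')); last exact: gd.
by apply: cvg_app; exact: cvg_within.
Qed.

Lemma line_adherent_open D x u : open D -> D x -> line_adherent D x u.
Proof.
move=> oD Dx A At.
have AD : \forall t \near (0 : R)^', A t /\ D (t *: u + x).
  apply: filterI => //.
  exact: (nbhs_dnbhs (near_line u (open_nbhs_nbhs (conj oD Dx)))).
have [t [At' Dt]] := @filter_ex _ _ (Proper_dnbhs_numFieldType (0 : R)) _ AD.
by exists t.
Qed.

End DeriveIn.

Section Box.
Context {R : realType}.

(** At an end of [0,1] only one sign of [t] may be allowed. With [t * a] at most 1/2 in absolute
    value, the parameter is moved up if [s] is at most 1/2 and down otherwise, which selects [t0] or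
    [- t0] according to the sign of [a]. *)
Lemma line_adherent_box k (V : set 'rV[R]_k) (z X : 'rV[R]_k * R) :
  open V -> box V z -> line_adherent (box V) z X.
Proof.
case: z X => [x s] [u a] oV [Vx]; rewrite /= in_itv /= => /andP[s0 s1] A At. move: Vx => /= Vx.
have NA : \forall t \near (0 : R), t != 0 -> A t by [].
have NV : \forall t \near (0 : R), V (t *: u + x).
  exact: (near_line u (open_nbhs_nbhs (conj oV Vx))).
have Na : \forall t \near (0 : R), `|t * a| <= 2^-1.
  have : (fun t : R => `|t * a|) t @[t --> (0 : R)] --> `|0 * a|.
    by apply: cvg_norm; apply: cvgMr_tmp; exact: cvg_id.
  by rewrite mul0r normr0 => /cvgr_le; apply; rewrite invr_gt0.
have /nbhs_ballP[d /= d0 Hd] : \forall t \near (0 : R),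
    (t != 0 -> A t) /\ V (t *: u + x) /\ `|t * a| <= 2^-1.
  exact: (filterI NA (filterI NV Na)).
pose t0 := d / 2; have t00 : 0 < t0 by rewrite divr_gt0.
have key (t : R) : `|t| = t0 -> 0 <= t * a + s <= 1 ->
    exists t : R, A t /\ box V (t *: ((u, a) : 'rV[R]_k * R) + (x, s)).
  move=> tt0 ts; exists t.
  have [|At' [Vt _]] := Hd t.
    by rewrite -ball_normE /= sub0r normrN tt0 /t0 ltr_pdivrMr // ltr_pMr // ltr1n.
  split; first by apply: At'; rewrite -normr_gt0 tt0.
  by split=> //=; rewrite in_itv.
have [|_ [_ ta]] := Hd t0.
  by rewrite -ball_normE /= sub0r normrN gtr0_norm // /t0 ltr_pdivrMr // ltr_pMr // ltr1n.
move: ta; have [a0|a0] := leP 0 a.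
  rewrite ger0_norm; last by rewrite mulr_ge0 // ltW.
  move=> ta; have ta0 : 0 <= t0 * a by rewrite mulr_ge0 // ltW.
  have [s2|s2] := leP s 2^-1.
    by apply: (key t0); [rewrite gtr0_norm|lra].
  by apply: (key (- t0)); [rewrite normrN gtr0_norm|rewrite mulNr; lra].
rewrite ler0_norm; last by rewrite mulr_ge0_le0 // ltW.
move=> ta; have ta0 : t0 * a <= 0 by rewrite mulr_ge0_le0 // ltW.
have [s2|s2] := leP s 2^-1.
  by apply: (key (- t0)); [rewrite normrN gtr0_norm|rewrite mulNr; lra].
by apply: (key t0); [rewrite gtr0_norm|lra].
Qed.

End Box.

Section SmoothMaps.
Context {R : realType}.

Definition charted_by_charts (E : normedModType R) (M : charted E) :=
  forall p : M, dom (chart_at p) p /\ is_chart (chart_at p).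

Lemma charted_vecM (E : normedModType R) : charted_by_charts (vecM E).
Proof.
move=> p; split=> //; rewrite /is_chart /codom_chart /= image_id.
by split=> //; [exact: openT|exact: openT|move=> q _; exact: cvg_id|move=> q _; exact: cvg_id].
Qed.

Lemma charted_manifold (E : normedModType R) (M : charted E) :
  manifold M -> charted_by_charts M.
Proof. by move=> [_ _ dM cM _] p; split; [exact: dM|exact: cM]. Qed.

Lemma charted_prodM (E F : normedModType R) (M : charted E) (N : charted F) :
  charted_by_charts M -> charted_by_charts N -> charted_by_charts (prodM M N).
Proof.
move=> gM gN [p q]; have [pp [od oc K cc cp]] := gM p; have [qq [od' oc' K' cc' cp']] := gN q.
have codomE : codom_chart (@chart_at _ _ (prodM M N) (p, q)) =
    codom_chart (chart_at p) `*` codom_chart (chart_at q).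
  rewrite /codom_chart eqEsubset; split=> [_ [[a b] /= [da db] <-]|[x y]] /=.
    by split; [exists a|exists b].
  by move=> [[a da <-] [b db <-]]; exists (a, b).
split; first by split.
split.
- exact: open_setX.
- by rewrite codomE; exact: open_setX.
- move=> [a b] /set_mem[da db]; congr pair; [apply: K|apply: K']; exact: mem_set.
- move=> [a b] [da db]; apply: (cvg_pair (F := nbhs (a, b))
    (G := nbhs (chart_at p a)) (H := nbhs (chart_at q b))).
  + by apply: (@cvg_comp _ _ _ fst (chart_at p) _ (nbhs a)); [exact: cvg_fst|exact: cc].
  + by apply: (@cvg_comp _ _ _ snd (chart_at q) _ (nbhs b)); [exact: cvg_snd|exact: cc'].
- move=> [x y]; rewrite codomE => -[dx dy].
  apply: (cvg_pair (F := nbhs (x, y))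
    (G := nbhs (param (chart_at p) x)) (H := nbhs (param (chart_at q) y))).
  + by apply: (@cvg_comp _ _ _ fst (param (chart_at p)) _ (nbhs x)); [exact: cvg_fst|exact: cp].
  + by apply: (@cvg_comp _ _ _ snd (param (chart_at q)) _ (nbhs y)); [exact: cvg_snd|exact: cp'].
Qed.

Section Maps.
Variables (E F : normedModType R) (M : charted E) (N : charted F).
Implicit Types (A : set M) (f : M -> N).

Lemma smooth_subset A A' f : A' `<=` A -> smooth A f -> smooth A' f.
Proof.
move=> AA fs p /AA /fs[U [g [oU Up gU fg]]]; exists U, g; split=> // q /AA; exact: fg.
Qed.

Lemma smooth_eq A f f' : (forall p, A p -> f p = f' p) -> smooth A f -> smooth A f'.
Proof.
move=> ff fs p Ap; have [U [g [oU Up gU fg]]] := fs p Ap; exists U, g; split=> // q Aq dq Uq.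
by rewrite -(ff p Ap) -(ff q Aq); exact: fg.
Qed.

Lemma near_chart (p : M) (U : set E) : charted_by_charts M -> open U -> U (chart_at p p) ->
  \forall q \near p, dom (chart_at p) q /\ U (chart_at p q).
Proof.
move=> gM oU Up; have [dp [od _ _ cc _]] := gM p.
apply: filterI; first exact: (open_nbhs_nbhs (conj od dp)).
exact: (cc p dp _ (open_nbhs_nbhs (conj oU Up))).
Qed.

Lemma smooth_near A f p (O : set N) : charted_by_charts M -> charted_by_charts N ->
  smooth A f -> A p -> nbhs (f p) O -> \forall q \near p, A q -> O (f q).
Proof.
move=> gM gN fs Ap Of; have [U [g [oU Up gU fg]]] := fs p Ap.
have [dp [od _ _ cc _]] := gM p; have [df [odf ocf Kf ccf cpf]] := gN (f p).
have gp : g (chart_at p p) = chart_at (f p) (f p) by have [_ ->] := fg p Ap dp Up.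
have Og : \forall x \near chart_at p p, O (param (chart_at (f p)) (g x)).
  have gc : {for chart_at p p, continuous g} := Ck_continuous (gU 0) Up.
  have cf : {for chart_at (f p) (f p), continuous (param (chart_at (f p)))}.
    by apply: cpf; exists (f p).
  apply: (gc (fun x => O (param (chart_at (f p)) x))); rewrite gp.
  by apply: (cf O); rewrite (Kf (f p) (mem_set df)).
have Ogq := cc p dp _ Og.
apply: filterS (filterI (near_chart gM oU Up) Ogq) => q [[dq Uq] Oq] Aq.
have [dfq fqE] := fg q Aq dq Uq.
by rewrite -(Kf (f q) (mem_set dfq)) fqE.
Qed.

Lemma smooth_local A f : charted_by_charts M ->
  (forall p, A p -> exists2 O, nbhs p O & smooth (A `&` O) f) -> smooth A f.
Proof.
move=> gM loc p Ap; have [ O Op fs] := loc p Ap.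
have [U [g [oU Up gU fg]]] := fs p (conj Ap (nbhs_singleton Op)).
have [dp [od oc K cc cp]] := gM p.
have cpp : codom_chart (chart_at p) (chart_at p p) by exists p.
pose U' := U `&` (codom_chart (chart_at p) `&` param (chart_at p) @^-1` O^°).
exists U', g; split.
- apply: openI => //; apply: open_preimage => //; exact: open_interior.
- split=> //; split=> //; rewrite /preimage /mkset (K p (mem_set dp)).
  exact: nbhs_singleton (nbhs_interior Op).
- by move=> k; apply: Ck_subset (gU k); exact: subIsetl.
- move=> q Aq dq [Uq [_ Oq]]; apply: fg => //; split=> //.
  by move: Oq; rewrite /preimage /mkset (K q (mem_set dq)) => /interior_subset.
Qed.

End Maps.

Lemma smooth_comp (E F G : normedModType R) {fE : finite_dim E} {fF : finite_dim F}
    {fG : finite_dim G} (M : charted E) (N : charted F) (Q : charted G)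
    (A : set M) (B : set N) (f : M -> N) (g : N -> Q) : charted_by_charts M ->
  smooth A f -> (forall p, A p -> B (f p)) -> smooth B g -> smooth A (g \o f).
Proof.
move=> gM fs fB gs p Ap; have [U [a [oU Up aU fa]]] := fs p Ap.
have [V [b [oV Vp bV gb]]] := gs (f p) (fB p Ap).
have [dp _] := gM p; have [dfp fpE] := fa p Ap dp Up.
have oW : open (U `&` a @^-1` V).
  by apply: open_preimage => // x Ux; exact: (Ck_continuous (aU 0) Ux).
exists (U `&` a @^-1` V), (b \o a); split.
- exact: oW.
- by split=> //; rewrite /preimage /= -fpE.
- move=> k; apply: (Ck_comp oW oV (fun x h => h.2) _ (bV k)).
  exact: (Ck_subset (@subIsetl _ _ _) (aU k)).
- move=> q Aq dq [Uq Vq]; have [dfq fqE] := fa q Aq dq Uq.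
  by have := gb (f q) (fB q Aq) dfq; rewrite fqE; apply.
Qed.

Lemma smooth_vecM_prod (E F G : normedModType R) (N : charted G) (A : set (E * F)%type)
    (f : E * F -> N) :
  @smooth _ _ _ (prodM (vecM E) (vecM F)) N A f -> @smooth _ _ _ (vecM (E * F)%type) N A f.
Proof.
move=> fs [p s] Ap; have [U [g [oU Up gU fg]]] := fs (p, s) Ap.
exists U, g; split=> // -[q t] Aq _ Uq; apply: (fg (q, t) Aq) => //; by split.
Qed.

Lemma smooth_prod_map (E F : normedModType R) {fE : finite_dim E} {fF : finite_dim F}
    (M : charted E) (N : charted F)
    (A : set M) (B : set R) (f : M -> N) : smooth A f ->
  @smooth _ _ _ (prodM M (@RR R)) (prodM N (@RR R)) (A `*` B) (fun z => (f z.1, z.2)).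
Proof.
move=> fs [p s] /= [Ap Bs]; have [U [g [oU Up gU fg]]] := fs p Ap.
have oW : open (U `*` [set: R]) by apply: open_setX => //; exact: openT.
exists (U `*` [set: R]), (fun y => (g y.1, y.2)); split=> //.
- move=> k; apply: Ck_pair => //; last exact: Ck_snd.
  exact: (Ck_comp oW oU (fun x h => h.1) (Ck_fst k oW) (gU k)).
- move=> [q s'] [Aq _] [dq _] [Uq _]; have [dfq fqE] := fg q Aq dq Uq.
  by split; [split|congr pair].
Qed.

Lemma smooth_rep (E F : normedModType R) (N : charted F) (D : set E) (f : E -> N) x :
  @smooth _ _ _ (vecM E) N D f -> D x ->
  exists U g, [/\ open U, U x, Cinf U g & forall y, D y -> U y ->
    dom (chart_at (f x)) (f y) /\ chart_at (f x) (f y) = g y].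
Proof.
by move=> fs Dx; have [U [g [oU Up gU fg]]] := fs x Dx; exists U, g; split=> // y Dy Uy; exact: fg.
Qed.

End SmoothMaps.

(** * Pullbacks of closed 2-forms between open sets of vector spaces *)

Section PullbackClosed.
Context {R : realType}.
Variables (E F : normedModType R) (fE : finite_dim E) (fF : finite_dim F).
Variables (U : set E) (C : set F) (g : E -> F) (Om : F -> F -> F -> R).
Hypotheses (oU : open U) (oC : open C) (gU : Cinf U g) (gC : forall y, U y -> C (g y)).
Hypothesis Om_linear : forall a k u v z, C a -> Om a (k *: u + v) z = k * Om a u z + Om a v z.
Hypothesis Om_anti : forall a u v, C a -> Om a u v = - Om a v u.
Hypothesis Om_smooth : forall u v, Cinf C (fun a => Om a u v).

Lemma form_sum (I : Type) (s : seq I) (k : I -> R) (u : I -> F) a z : C a ->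
  Om a (\sum_(i <- s) k i *: u i) z = \sum_(i <- s) k i * Om a (u i) z.
Proof.
move=> Ca; elim: s => [|i s IH].
  rewrite !big_nil; have := Om_linear (-1) 0 0 z Ca.
  by rewrite scaler0 addr0 mulN1r addNr.
by rewrite !big_cons Om_linear // IH.
Qed.

Lemma form_sumr (I : Type) (s : seq I) (k : I -> R) (u : I -> F) a z : C a ->
  Om a z (\sum_(i <- s) k i *: u i) = \sum_(i <- s) k i * Om a z (u i).
Proof.
move=> Ca; rewrite Om_anti // form_sum // -sumrN; apply: eq_bigr => i _.
by rewrite (Om_anti z) // mulrN.
Qed.

Section Basis.
Variables (I : finType) (e : I -> F) (c : I -> {linear F -> R}).
Hypotheses (cc : forall i, continuous (c i)) (ec : forall x, x = \sum_i c i x *: e i).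

Lemma form_expand a u v : C a ->
  Om a u v = \sum_(i <- index_enum I) \sum_(j <- index_enum I)
    c i u * (c j v * Om a (e i) (e j)).
Proof.
move=> Ca; rewrite {1}(ec u) form_sum //; apply: eq_bigr => i _.
by rewrite {1}(ec v) form_sumr // mulr_sumr.
Qed.

(** Differentiability of [Om] in its base point is known for fixed vectors, so the three moving
    arguments are handled by expanding in the basis and differentiating products. *)
Lemma form_leibniz (a b : E -> F) y X : U y -> differentiable a y -> differentiable b y ->
  is_derive y X (fun y => Om (g y) (a y) (b y))
   ('D_('D_X g y) (fun z => Om z (a y) (b y)) (g y) +
    (Om (g y) ('D_X a y) (b y) + Om (g y) (a y) ('D_X b y))).
Proof.
move=> Uy ad bd.
have gd : differentiable g y by exact: (C1_differentiable oU (gU 1) Uy).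
have Od u v z : C z -> differentiable (fun z => Om z u v) z.
  exact: (C1_differentiable oC (Om_smooth u v 1)).
have Cy := gC Uy.
pose D i j := c i ('D_X a y) * (c j (b y) * Om (g y) (e i) (e j)) +
  c i (a y) * (c j ('D_X b y) * Om (g y) (e i) (e j) +
    c j (b y) * 'D_('D_X g y) (fun z => Om z (e i) (e j)) (g y)).
have lin_d (l : {linear F -> R}) (f : E -> F) : continuous l -> differentiable f y ->
    differentiable (l \o f) y /\ 'D_X (l \o f) y = l ('D_X f y).
  move=> lc fd; split; first exact: (differentiable_comp fd (linear_differentiable _ lc)).
  by have [_ ->] := is_derive_linear lc (diff_derivable (v := X) fd).
have term i j : is_derive y X
    (fun y => c i (a y) * (c j (b y) * Om (g y) (e i) (e j))) (D i j).
  have [ai aiE] := lin_d (c i) a (@cc i) ad.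
  have [bj bjE] := lin_d (c j) b (@cc j) bd.
  have Oij := Od (e i) (e j) _ Cy.
  have Og : differentiable ((fun z => Om z (e i) (e j)) \o g) y.
    exact: differentiable_comp gd Oij.
  have OgE := derive_comp X gd Oij.
  have [inner innerE] := is_derive_scale (differentiable_continuous bj)
    (diff_derivable (v := X) bj) (diff_derivable (v := X) Og).
  have outer := is_derive_scale (differentiable_continuous ai)
    (diff_derivable (v := X) ai) inner.
  apply: is_derive_eq outer _; rewrite innerE aiE bjE OgE; exact: erefl.
have dsum := is_derive_sum_seq (index_enum I) (fun i => is_derive_sum_seq (index_enum I) (term i)).
have dOm (u v : F) : 'D_('D_X g y) (fun z => Om z u v) (g y) =
    \sum_(i <- index_enum I) \sum_(j <- index_enum I)
      c i u * (c j v * 'D_('D_X g y) (fun z => Om z (e i) (e j)) (g y)).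
  have oterm i j : is_derive (g y) ('D_X g y) (fun z => c i u * (c j v * Om z (e i) (e j)))
      (c i u * (c j v * 'D_('D_X g y) (fun z => Om z (e i) (e j)) (g y))).
    have od := DeriveDef (diff_derivable (v := 'D_X g y) (Od (e i) (e j) _ Cy)) erefl.
    have od1 := is_deriveZ (c j v) od.
    exact: (is_deriveZ (c i u) od1).
  have [_ <-] := is_derive_sum_seq (index_enum I)
    (fun i => is_derive_sum_seq (index_enum I) (oterm i)).
  apply: near_eq_derive.
  apply: filterS (open_nbhs_nbhs (conj oC Cy)) => z Cz; exact: form_expand.
have eqn : {near y, (fun y => \sum_(i <- index_enum I) \sum_(j <- index_enum I)
    c i (a y) * (c j (b y) * Om (g y) (e i) (e j))) =1 (fun y => Om (g y) (a y) (b y))}.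
  apply: filterS (open_nbhs_nbhs (conj oU Uy)) => z Uz; rewrite -form_expand //; exact: gC.
have [dS dSE] := dsum.
split; first by apply: near_eq_derivable dS; exact: eqn.
rewrite -(near_eq_derive _ eqn) dSE dOm !form_expand // -!big_split /=.
apply: eq_bigr => i _; rewrite -!big_split /=; apply: eq_bigr => j _.
by rewrite /D mulrDr addrA [RHS]addrC.
Qed.
End Basis.

Lemma cyclic_cancel (a1 a2 a3 b c c' d : R) : c' = - c -> a1 - a2 + a3 = 0 ->
  a1 + (b + c) - (a2 + (b + d)) + (a3 + (c' + d)) = 0.
Proof. by move=> ->; lra. Qed.

(** In the cyclic sum the derivatives of [Om] add up to its closedness on the images of [X], [Z],
    [W]; the six terms with second derivatives of [g] cancel in pairs by Schwarz and
    antisymmetry. *)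
Lemma pullback_closed X Z W y : U y ->
  (forall a u v z, C a -> 'D_u (fun x => Om x v z) a - 'D_v (fun x => Om x u z) a
     + 'D_z (fun x => Om x u v) a = 0) ->
  let Q X Z y := Om (g y) ('D_X g y) ('D_Z g y) in
  'D_X (Q Z W) y - 'D_Z (Q X W) y + 'D_W (Q X Z) y = 0.
Proof.
move=> Uy cl Q.
have [I [e [c [cc ec]]]] := fF.
have dd X' : differentiable ('D_X' g) y.
  exact: (C1_differentiable oU (Ck_derive X' (gU 2)) Uy).
have DQ X1 X2 X3 : 'D_X1 (Q X2 X3) y =
   'D_('D_X1 g y) (fun z => Om z ('D_X2 g y) ('D_X3 g y)) (g y) +
    (Om (g y) ('D_X1 ('D_X2 g) y) ('D_X3 g y) + Om (g y) ('D_X2 g y) ('D_X1 ('D_X3 g) y)).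
  by have [_ ->] := form_leibniz cc ec X1 Uy (dd X2) (dd X3).
rewrite !DQ.
have S X1 X2 : 'D_X1 ('D_X2 g) y = 'D_X2 ('D_X1 g) y.
  exact: (schwarz X1 X2 oU (gU 2) Uy).
have Cy := gC Uy.
have := cl (g y) ('D_X g y) ('D_Z g y) ('D_W g y) Cy.
rewrite (S Z X) (S W X) (S W Z).
exact: cyclic_cancel (Om_anti ('D_X ('D_W g) y) ('D_Z g y) Cy).
Qed.

Lemma pullback_smooth X Z : Cinf U (fun y => Om (g y) ('D_X g y) ('D_Z g y)).
Proof.
have [I [e [c [cc ec]]]] := fF.
move=> n; apply: (@Ck_eq _ _ _ _ _ (fun y => \sum_(i <- index_enum I) \sum_(j <- index_enum I)
    c i ('D_X g y) * (c j ('D_Z g y) * Om (g y) (e i) (e j)))) => //.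
  by move=> y Uy; rewrite -form_expand //; exact: gC.
apply: Ck_sum => // i; apply: Ck_sum => // j.
apply: Ck_scale => //; first exact: (Ck_linear oU (cc i) (Ck_derive X (gU n.+1))).
apply: Ck_scale => //; first exact: (Ck_linear oU (cc j) (Ck_derive Z (gU n.+1))).
exact: (Ck_comp oU oC gC (gU n) (Om_smooth (e i) (e j) n)).
Qed.

End PullbackClosed.

(** * Pullbacks of the symplectic form computed in one chart *)

Section ChartForm.
Context {R : realType}.

Lemma mder_vecM (E F : normedModType R) (N : charted F) (D : set E) (f : E -> N) (x u : E) :
  @mder R E F (vecM E) N D f x u = derive_in D (fun y => chart_at (f x) (f y)) x u.
Proof. by rewrite /mder /= setIT image_id. Qed.

Variables (N : nat) (Y : charted 'rV[R]_N) (w : mform2 Y).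
Hypotheses (mY : manifold Y) (sw : symplectic_form w).

Let gY : charted_by_charts Y := charted_manifold mY.

Definition chart_form (c : chart 'rV[R]_N Y) : 'rV[R]_N -> 'rV[R]_N -> 'rV[R]_N -> R :=
  pullback_vec (codom_chart c) (param c) w.

Lemma transition_differentiable (p q : Y) a : codom_chart (chart_at p) a ->
  dom (chart_at q) (param (chart_at p) a) ->
  differentiable (chart_at q \o param (chart_at p)) a.
Proof.
move=> ca da; have [_ [od oc K cc cp]] := gY p; have [_ [od' _ _ _ _]] := gY q.
have [_ _ _ _ tr] := mY.
have TE : chart_at p @` (dom (chart_at p) `&` dom (chart_at q)) =
   codom_chart (chart_at p) `&` param (chart_at p) @^-1` dom (chart_at q).
  rewrite eqEsubset; split=> [_ [x [px qx] <-]|_ [[x px <-]]].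
    by split; [exists x|rewrite /preimage /mkset (K x (mem_set px))].
  by rewrite /preimage /mkset (K x (mem_set px)) => qx; exists x.
have oT : open (chart_at p @` (dom (chart_at p) `&` dom (chart_at q))).
  by rewrite TE; apply: open_preimage => //.
apply: (C1_differentiable oT (tr p q 1)); by rewrite TE.
Qed.

(** [w q] acts on vectors read in the preferred chart at [q], which changes with [q]. Reading them
    in the fixed chart at [p] brings in the differential of the transition map. *)
Lemma chart_formE (p : Y) a u v : codom_chart (chart_at p) a ->
  let q := param (chart_at p) a in
  chart_form (chart_at p) a u v =
  w q ('D_u (chart_at q \o param (chart_at p)) a) ('D_v (chart_at q \o param (chart_at p)) a).
Proof.
move=> ca q; have [_ [_ oc _ _ _]] := gY p.
rewrite /chart_form /pullback_vec /pullback !mder_vecM.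
have D u' : derive_in (codom_chart (chart_at p)) (fun y => chart_at q (param (chart_at p) y)) a u' =
   'D_u' (chart_at q \o param (chart_at p)) a.
  apply: derive_in_eq => //; first exact: line_adherent_open.
    by apply: filterE.
  apply: diff_derivable; apply: transition_differentiable => //.
  by have [] := gY q.
by rewrite !D.
Qed.

Lemma chart_form_linear (p : Y) a k u v z : codom_chart (chart_at p) a ->
  chart_form (chart_at p) a (k *: u + v) z =
  k * chart_form (chart_at p) a u z + chart_form (chart_at p) a v z.
Proof.
move=> ca; rewrite !chart_formE //=; set q := param _ a.
have [lw _ _ _ _] := sw.
have Td : differentiable (chart_at q \o param (chart_at p)) a.
  by apply: transition_differentiable => //; have [] := gY q.
by rewrite deriveE // linearP -!deriveE // -(lw q).
Qed.

Lemma chart_form_anti (p : Y) a u v : codom_chart (chart_at p) a ->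
  chart_form (chart_at p) a u v = - chart_form (chart_at p) a v u.
Proof. by have [_ aw _ _ _] := sw => _; exact: aw. Qed.

Lemma chart_form_smooth (p : Y) u v :
  Cinf (codom_chart (chart_at p)) (fun a => chart_form (chart_at p) a u v).
Proof. by have [_ _ _ + _] := sw; apply. Qed.

Lemma chart_form_closed (p : Y) a u v z : codom_chart (chart_at p) a ->
  'D_u (fun x => chart_form (chart_at p) x v z) a
    - 'D_v (fun x => chart_form (chart_at p) x u z) a
    + 'D_z (fun x => chart_form (chart_at p) x u v) a = 0.
Proof.
move=> ca; have [_ _ _ _ cl] := sw; rewrite -[RHS](cl p a u v z ca).
have [_ [_ oc _ _ _]] := gY p.
have D x y t : derive_in (codom_chart (chart_at p)) (fun b => chart_form (chart_at p) b x y) a t =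
   'D_t (fun b => chart_form (chart_at p) b x y) a.
  apply: derive_in_eq => //; first exact: line_adherent_open.
    by apply: filterE.
  exact: (Ck_derivable (chart_form_smooth p x y 1) ca).
by symmetry; congr (_ - _ + _); exact: D.
Qed.

Section Pullback.
Variables (E : normedModType R) (fE : finite_dim E) (D : set E) (f : E -> Y) (p : Y).
Variables (U : set E) (g : E -> 'rV[R]_N).
Hypotheses (oU : open U) (gU : Cinf U g).
Hypothesis fg : forall y, D y -> U y ->
  dom (chart_at p) (f y) /\ chart_at p (f y) = g y.

Lemma mder_chart y X : D y -> U y -> line_adherent D y X ->
  @mder R E _ (vecM E) Y D f y X =
  'D_('D_X g y) (chart_at (f y) \o param (chart_at p)) (g y).
Proof.
move=> Dy Uy acc; rewrite mder_vecM.
have [_ [_ _ K _ _]] := gY p.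
have [dfy fyE] := fg Dy Uy.
have gd : differentiable g y by exact: (C1_differentiable oU (gU 1) Uy).
have Td : differentiable (chart_at (f y) \o param (chart_at p)) (g y).
  apply: transition_differentiable; first by exists (f y).
  by rewrite -fyE (K _ (mem_set dfy)); have [] := gY (f y).
rewrite -(derive_comp X gd Td); apply: derive_in_eq => //.
  apply: filterS (open_nbhs_nbhs (conj oU Uy)) => z Uz Dz /=.
  by have [dz <-] := fg Dz Uz; rewrite (K _ (mem_set dz)).
by apply: diff_derivable; exact: differentiable_comp.
Qed.

(** The target chart in [mder] moves with the point. In this form the pullback is that of a form on
    an open set by the smooth extension [g], so that the results for vector spaces apply, also at
    the boundary of [D]. *)
Lemma pullback_chart y X X' : D y -> U y -> line_adherent D y X -> line_adherent D y X' ->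
  pullback_vec D f w y X X' = chart_form (chart_at p) (g y) ('D_X g y) ('D_X' g y).
Proof.
move=> Dy Uy acc acc'; have [dfy fyE] := fg Dy Uy.
have [_ [_ _ K _ _]] := gY p.
rewrite chart_formE; last by exists (f y).
rewrite /= -fyE (K _ (mem_set dfy)) fyE /pullback_vec /pullback.
by rewrite !mder_chart.
Qed.

End Pullback.

End ChartForm.

(** * Local parametrizations of the Lagrangian and of its images *)

Section LocalParam.
Context {R : realType}.
Variables (N : nat) (Y : charted 'rV[R]_N) (w : mform2 Y).
Hypotheses (mY : manifold Y).

Let gY : charted_by_charts Y := charted_manifold mY.

(** [chi] extends the inverse of [phi] composed with [f]. The dimensions [k] and [k'] may differ:
    the lemma compares two parametrizations of the Lagrangian, and also factors one of the fixed
    fibre through one of the Lagrangian. *)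
Lemma local_param_transition (k k' : nat) (S : set Y) (V : set 'rV[R]_k) (phi : 'rV[R]_k -> Y)
    (V' : set 'rV[R]_k') (f : 'rV[R]_k' -> Y) x0 x1 :
  local_param S V phi -> open V' -> @smooth _ _ _ (vecM 'rV[R]_k') Y V' f ->
  (forall x, V' x -> S (f x)) -> V' x0 -> V x1 -> f x0 = phi x1 ->
  exists W chi, [/\ open W, W x0 /\ chi x0 = x1, W `<=` V', Cinf W chi &
    forall x, W x -> V (chi x) /\ f x = phi (chi x)].
Proof.
move=> [oV [U0 [oU0 [phs phV [ginv [gs gphi]]]]]] oV' fs fS Vx0 Vx1 fx.
have U0f : U0 (f x0).
  have : (S `&` U0) (phi x1) by rewrite -phV; exists x1.
  by rewrite fx => -[].
have /nbhs_ballP[r r0 Hr] : \forall x \near x0, V' x /\ (V' x -> U0 (f x)).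
  apply: filterI; first exact: (open_nbhs_nbhs (conj oV' Vx0)).
  exact: (smooth_near (@charted_vecM _ _) gY fs Vx0 (open_nbhs_nbhs (conj oU0 U0f))).
have Bsub x : ball x0 r x -> V' x /\ (S `&` U0) (f x).
  by move=> /Hr[V'x Uf]; split=> //; split; [exact: fS|exact: Uf].
have Bx0 : ball x0 r x0 by exact: ballxx.
have cs : @smooth _ _ _ (vecM 'rV[R]_k') (vecM 'rV[R]_k) (ball x0 r) (ginv \o f).
  apply: (smooth_comp (N := Y) (B := S `&` U0)) => //; first exact: charted_vecM.
    by apply: smooth_subset fs => x /Bsub[].
  by move=> x /Bsub[].
have [W [chi [oW Wx0 cW chiE]]] := smooth_rep cs Bx0.
exists (W `&` ball x0 r), chi; split.
- by apply: openI => //; exact: ball_open.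
- split; first by split.
  have [_ /= <-] := chiE x0 Bx0 Wx0; by rewrite fx gphi.
- by move=> x [_ /Bsub[]].
- by move=> n; apply: Ck_subset (cW n); exact: subIsetl.
- move=> x [Wx Bx]; have [_ /= <-] := chiE x Bx Wx.
  have [_ Sf] := Bsub x Bx; move: Sf; rewrite -phV => -[y Vy <-].
  by rewrite gphi.
Qed.

Section Isotopy.
Variables (L : set Y) (psi : Y -> R -> Y).
Hypothesis isot : lagrangian_isotopy w L psi.

Lemma isotopy_local_param k (V : set 'rV[R]_k) (phi : 'rV[R]_k -> Y) s :
  local_param L V phi -> s \in `[0, 1] ->
  local_param ((fun p => psi p s) @` L) V (fun x => psi (phi x) s).
Proof.
move=> [oV [U0 [oU0 [phs phV [ginv [gs gphi]]]]]] s01.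
have [_ /(_ s s01)[[fs _ [g [gsm gf]]] _]] := isot.
set f := (fun p => psi p s) in fs gsm gf *.
have phL x : V x -> (L `&` U0) (phi x) by move=> Vx; rewrite -phV; exists x.
have gU0 y : (f @` L) y -> L (g y) /\ f (g y) = y.
  by move=> [p Lp <-]; rewrite gf.
(* The inverse [g] of the embedding is meaningful on the image only, so the condition bears on image
   points and the interior is taken; continuity of [g] on the image puts the parametrized piece
   inside it. *)
split=> //; exists [set y | (f @` L) y -> U0 (g y)]^°; split; first exact: open_interior.
split.
- exact: (smooth_comp (@charted_vecM _ _) phs (fun x h => (phL x h).1) fs).
- rewrite eqEsubset; split=> [_ [x Vx <-]|y [fLy /interior_subset U0y]].
    have [Lx Ux] := phL x Vx; split; first by exists (phi x).
    apply: (smooth_near gY gY gsm); first by exists (phi x).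
    by rewrite -/(f (phi x)) gf //; exact: (open_nbhs_nbhs (conj oU0 Ux)).
  have [Lg fg] := gU0 y fLy.
  have : (L `&` U0) (g y) by split=> //; exact: U0y.
  by rewrite -phV => -[x Vx xg]; exists x => //; rewrite xg.
- exists (ginv \o g); split=> [|x Vx]; last first.
    by have [Lx _] := phL x Vx; rewrite /= -/(f (phi x)) gf // gphi.
  apply: (smooth_comp (N := Y) (B := L `&` U0)) => //.
    by apply: smooth_subset gsm => y [].
  move=> y [fLy /interior_subset U0y]; have [Lg _] := gU0 y fLy.
  by split=> //; exact: U0y.
Qed.

(** Moving in a direction [(v, 0)] stays in the slice of constant [s], where the difference
    quotients on the box are exactly those of the time-[s] map on [V]. *)
Lemma isotopy_isotropic k (V : set 'rV[R]_k) (phi : 'rV[R]_k -> Y) x s u u' :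
  local_param L V phi -> V x -> s \in `[0, 1] ->
  psi_w w V phi psi (x, s) (u, 0) (u', 0) = 0.
Proof.
move=> lp Vx s01.
have [_ /(_ s s01)[_ [_ iso _]]] := isot.
have := iso _ _ _ (isotopy_local_param lp s01) x u u' Vx.
rewrite /psi_w /pullback_vec /pullback !mder_vecM /= => iso0; rewrite -[RHS]iso0.
have lineE (t : R) v : t *: ((v, 0) : 'rV[R]_k * R) + (x, s) = (t *: v + x, s).
  by congr pair; rewrite /= scaler0 add0r.
have D v (h : 'rV[R]_k -> 'rV[R]_N) (h' : 'rV[R]_k * R -> 'rV[R]_N) :
    (forall x, h' (x, s) = h x) -> derive_in (box V) h' (x, s) (v, 0) = derive_in V h x v.
  move=> hh; rewrite /derive_in.
  have -> : (fun t : R => t^-1 *: (h' (t *: ((v, 0) : 'rV[R]_k * R) + (x, s)) - h' (x, s))) =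
      (fun t => t^-1 *: (h (t *: v + x) - h x)).
    by apply: funext => t; rewrite lineE !hh.
  have -> // : [set t : R | box V (t *: ((v, 0) : 'rV[R]_k * R) + (x, s))] =
      [set t | V (t *: v + x)].
  by apply/seteqP; split=> t; rewrite /mkset lineE; [case|split].
by congr (w _ _ _); apply: D.
Qed.

Lemma smooth_isotopy_param k (V : set 'rV[R]_k) (phi : 'rV[R]_k -> Y) :
  local_param L V phi ->
  @smooth _ _ _ (vecM ('rV[R]_k * R)%type) Y (box V) (fun z => psi (phi z.1) z.2).
Proof.
move=> [oV [U0 [oU0 [phs phV _]]]]; apply: smooth_vecM_prod.
have [psis _] := isot.
have phLs := smooth_prod_map (fE := finite_dim_rV k) (fF := finite_dim_rV N)
  (B := `[0, 1]%classic) phs.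
apply: (smooth_comp (charted_prodM (@charted_vecM _ _) (@charted_vecM _ _)) phLs _ psis).
move=> [x s] [Vx s01]; split; last exact: s01.
have : (L `&` U0) (phi x) by rewrite -phV; exists x.
by case.
Qed.

End Isotopy.
End LocalParam.

Section DerivativeLemmas.
Context {R : realType}.

Lemma derive_in_line_cst (E F : normedModType R) (D : set E) (f : E -> F) x u :
  line_adherent D x u -> (forall t : R, D (t *: u + x) -> f (t *: u + x) = f x) ->
  derive_in D f x u = 0.
Proof.
move=> acc fx; have PF := line_adherent_within acc.
rewrite /derive_in; apply: cvg_lim => //; apply: cvg_near_cst.
rewrite near_withinE; apply: filterE => t Dt.
by rewrite (fx t Dt) subrr scaler0.
Qed.

Lemma derive_prod_map (E F : normedModType R) (chi : E -> F) x (s a : R) u :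
  derivable chi x u ->
  is_derive (x, s) ((u, a) : E * R) (fun y => (chi y.1, y.2)) (('D_u chi x, a) : F * R).
Proof.
move=> cd.
have cv : (fun h : R => h^-1 *: ((chi (h *: ((u, a) : E * R) + (x, s)).1,
    (h *: ((u, a) : E * R) + (x, s)).2) - (chi x, s))) h @[h --> 0^'] --> (('D_u chi x, a) : F * R).
  have : (fun h : R => (h^-1 *: (chi (h *: u + x) - chi x), h^-1 * (h * a + s - s))) h @[h --> 0^']
      --> (('D_u chi x, a) : F * R).
    apply: (cvg_pair (F := 0^') (G := nbhs ('D_u chi x)) (H := nbhs a)); first exact: cd.
    apply: cvg_near_cst; rewrite near_withinE; apply: filterE => h h0.
    by rewrite addrK mulKf.
  exact.
by split; [apply/cvg_ex; exists (('D_u chi x, a) : F * R)|exact: cvg_lim cv].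
Qed.

Lemma smooth_prod_of_Cinf (E F G : normedModType R) (U : set (E * F)%type) (f : E * F -> G) :
  open U -> Cinf U f -> @smooth _ _ _ (prodM (vecM E) (vecM F)) (vecM G) U f.
Proof.
by move=> oU fU [x s] Ux; exists U, f; split=> // -[q t] _ _ _; split.
Qed.

(** Mean value theorem along the segment from [x0], with [f] replaced near each point by some [g].
    The segment never leaves the slice, so agreement on the slice suffices, even when [s] is an end
    of [0,1]. *)
Lemma slice_constant (E : normedModType R) (x0 : E) (r : R) (s : R) (f : E * R -> R) :
  (forall x u, ball x0 r x -> exists2 g : E * R -> R,
     (\forall y \near (x, s), ball x0 r y.1 -> y.2 = s -> f y = g y) &
     is_derive (x, s) ((u, 0) : E * R) g 0) ->
  forall x, ball x0 r x -> f (x, s) = f (x0, s).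
Proof.
move=> loc x Bx; pose u := x - x0.
have lineE (t : R) : t *: ((u, 0) : E * R) + (x0, s) = (t *: u + x0, s).
  by congr pair; rewrite /= scaler0 add0r.
have Bt (t : R) : 0 <= t <= 1 -> ball x0 r (t *: u + x0).
  move=> /andP[t0 t1]; move: Bx; rewrite -!ball_normE /=.
  have -> : x0 - (t *: u + x0) = - (t *: u) by rewrite opprD addrCA subrr addr0.
  rewrite normrN normrZ distrC.
  by apply: le_lt_trans; rewrite ger0_norm //; exact: ler_piMl.
have Dk (t : R) : 0 <= t <= 1 -> is_derive t (1 : R) (fun t => f (t *: u + x0, s)) 0.
  move=> t01; have [g fg dg] := loc _ u (Bt t t01).
  have := @derivable_line _ _ _ g (x0, s) ((u, 0) : E * R) t; rewrite lineE.
  have [gd gE] := dg; rewrite gE => /(_ gd) dline.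
  have rp : r > 0 by move: Bx; rewrite -ball_normE /=; apply: le_lt_trans.
  have eqn : {near t, (fun t => g (t *: ((u, 0) : E * R) + (x0, s))) =1
     (fun t => f (t *: u + x0, s))}.
    have lc : (fun t : R => (t *: u + x0, s)) t' @[t' --> t] --> (t *: u + x0, s).
      apply: (cvg_pair (F := nbhs t) (G := nbhs (t *: u + x0)) (H := nbhs s)); last exact: cvg_cst.
      by apply: cvgD; [apply: cvgZr_tmp; exact: cvg_id|exact: cvg_cst].
    have Bn : \forall y \near (t *: u + x0, s), ball x0 r y.1.
      have Bo : nbhs (t *: u + x0) (ball x0 r).
        by apply: open_nbhs_nbhs; split; [exact: ball_open|exact: Bt].
      exact: cvg_fst Bo.
    have Nt : \forall t' \near t, (ball x0 r (t' *: u + x0) -> s = s ->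
        f (t' *: u + x0, s) = g (t' *: u + x0, s)) /\ ball x0 r (t' *: u + x0).
      exact: (lc _ (filterI fg Bn)).
    by apply: filterS Nt => t' [fg' B']; rewrite lineE fg'.
  have [ld lE] := dline; split; first by apply: near_eq_derivable ld; exact: eqn.
  by rewrite -(near_eq_derive _ eqn).
have gc : {within `[0, 1], continuous (fun t : R => f (t *: u + x0, s))}.
  by apply: derivable_within_continuous => t; rewrite in_itv /= => /Dk[].
have [t _] := MVT_segment ler01 (fun t tab => Dk t (subset_itv_oo_cc tab)) gc.
rewrite /= scale0r add0r scale1r subrK mul0r => /eqP; rewrite subr_eq0 => /eqP.
exact.
Qed.

End DerivativeLemmas.

(** * Potentials of the isotopy *)

Section Solutions.
Context {R : realType}.
Variables (N : nat) (Y : charted 'rV[R]_N) (w : mform2 Y).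
Hypotheses (mY : manifold Y) (sw : symplectic_form w).
Variables (L : set Y) (psi : Y -> R -> Y).
Hypothesis isot : lagrangian_isotopy w L psi.

Let gY : charted_by_charts Y := charted_manifold mY.
Let YR := prodM Y (@RR R).
Let A : set YR := L `*` `[0, 1].
Let gYR : charted_by_charts YR := charted_prodM gY (@charted_vecM R R).

Definition lift k (phi : 'rV[R]_k -> Y) (y : 'rV[R]_k * R) : YR := (phi y.1, y.2).

(* [H] restricts, for each s, to a potential of b_s on the part of L in [O]. *)
Definition solution_on (O : set YR) (H : Y * R -> R) :=
  [/\ open O, @smooth _ _ _ YR (@RR R) (A `&` O) H &
    forall k (V : set 'rV[R]_k) (phi : 'rV[R]_k -> Y), local_param L V phi ->
    forall y u, box V y -> O (lift phi y) ->
      derive_in (box V) (H \o lift phi) y (u, 0) = bform w V phi psi y (u, 0)].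

Definition solution_near (z : YR) H := exists2 O, O z & solution_on O H.

Lemma smooth_lift k (V : set 'rV[R]_k) (phi : 'rV[R]_k -> Y) (B : set R) :
  @smooth _ _ _ (vecM 'rV[R]_k) Y V phi ->
  @smooth _ _ _ (vecM ('rV[R]_k * R)%type) YR (V `*` B) (lift phi).
Proof. by move=> ps; apply: smooth_vecM_prod; exact: smooth_prod_map. Qed.

Lemma local_param_smooth k (V : set 'rV[R]_k) (phi : 'rV[R]_k -> Y) (S : set Y) :
  local_param S V phi -> @smooth _ _ _ (vecM 'rV[R]_k) Y V phi.
Proof. by move=> [oV [U0 [oU0 []]]]. Qed.

Lemma local_param_in k (V : set 'rV[R]_k) (phi : 'rV[R]_k -> Y) (S : set Y) x :
  local_param S V phi -> V x -> S (phi x).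
Proof.
move=> [oV [U0 [oU0 [_ pV _]]]] Vx; have : (S `&` U0) (phi x) by rewrite -pV; exists x.
by case.
Qed.

Lemma solution_germ z H H' : solution_near z H ->
  (\forall z' \near z, A z' -> H z' = H' z') -> solution_near z H'.
Proof.
move=> [ O Oz [oO sH dH]] HH'.
pose O' : set YR := [set z' | A z' -> H z' = H' z']^°.
have oO' : open (O `&` O') by apply: openI => //; exact: open_interior.
have HE z' : A z' -> O' z' -> H z' = H' z' by move=> Az' /interior_subset; apply.
exists (O `&` O'); first by split.
split=> //.
  apply: smooth_eq (smooth_subset _ sH); first by move=> z' [Az' [_ /HE]]; apply.
  by move=> z' [Az' []].
move=> k V phi lp y u Vy [Oy O'y]; rewrite -(dH k V phi lp y u Vy Oy).
have Ay y' : box V y' -> A (lift phi y').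
  by move=> [Vy' s01]; split=> //; exact: local_param_in lp Vy'.
apply: derive_in_near => //.
have ls := smooth_lift (B := `[0, 1]%classic) (local_param_smooth lp).
have := smooth_near (@charted_vecM _ _) gYR ls Vy (open_nbhs_nbhs (conj oO' (conj Oy O'y))).
apply: filterS => y' H1 Vy'; apply/esym; apply: HE; first exact: Ay.
by have [] := H1 Vy'.
Qed.

Lemma solution_open z H : solution_near z H -> \forall z' \near z, solution_near z' H.
Proof.
move=> [ O Oz sO]; have [oO _ _] := sO.
by apply: filterS (open_nbhs_nbhs (conj oO Oz)) => z' Oz'; exists O.
Qed.

(* In the directions tangent to the slices of constant [s], the derivative inside the box is the
   derivative of any smooth extension. *)
Lemma solution_rep O H k (V : set 'rV[R]_k) (phi : 'rV[R]_k -> Y) y :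
  solution_on O H -> local_param L V phi -> box V y -> O (lift phi y) ->
  exists U (g : 'rV[R]_k * R -> R), [/\ open U, U y, Cinf U g,
    forall y', box V y' -> U y' -> H (lift phi y') = g y' &
    forall u, 'D_((u, 0) : 'rV[R]_k * R) g y = bform w V phi psi y (u, 0)].
Proof.
move=> [oO sH dH] lp Vy Oy.
have ls := smooth_lift (B := `[0, 1]%classic) (local_param_smooth lp).
have NO : \forall y' \near y, box V y' -> O (lift phi y').
  exact: (smooth_near (@charted_vecM _ _) gYR ls Vy (open_nbhs_nbhs (conj oO Oy))).
have Ay y' : box V y' -> A (lift phi y').
  by move=> [Vy' s01]; split=> //; exact: local_param_in lp Vy'.
pose O' := [set y' | box V y' -> O (lift phi y')]^°.
have oO' : open O' by exact: open_interior.
have sl : @smooth _ _ _ (vecM ('rV[R]_k * R)%type) (@RR R) (box V `&` O') (H \o lift phi).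
  have ls' : @smooth _ _ _ (vecM ('rV[R]_k * R)%type) YR (box V `&` O') (lift phi).
    by apply: smooth_subset ls; exact: subIsetl.
  apply: (smooth_comp (@charted_vecM _ _) ls' _ sH) => y' [Vy' /interior_subset O'y'].
  by split; [exact: Ay|exact: O'y'].
have [U [g [oU Uy gU Hg]]] := smooth_rep sl (conj Vy NO).
have oW : open (U `&` O') by exact: openI.
have gE y' : box V y' -> (U `&` O') y' -> H (lift phi y') = g y'.
  by move=> Vy' [Uy' O'y']; have [_] := Hg y' (conj Vy' O'y') Uy'.
exists (U `&` O'), g; split=> //.
  by move=> n; apply: Ck_subset (gU n); exact: subIsetl.
move=> u; rewrite -(dH k V phi lp y u Vy Oy); apply/esym; apply: derive_in_eq => //.
- by have [oV _] := lp; exact: line_adherent_box.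
- apply: filterS (open_nbhs_nbhs (conj oW (conj Uy NO))) => y' Wy' Vy'; exact: gE.
- exact: (Ck_derivable (gU 1) Uy).
Qed.

End Solutions.

Lemma eq_of_cyclic (R : zmodType) (a b c : R) : a - b + c = 0 -> c = 0 -> a = b.
Proof. by move=> + c0; rewrite c0 addr0 => /eqP; rewrite subr_eq0 => /eqP. Qed.

(** * Local existence of potentials *)

Section Existence.
Context {R : realType}.
Variables (N : nat) (Y : charted 'rV[R]_N) (w : mform2 Y).
Hypotheses (mY : manifold Y) (sw : symplectic_form w).
Variables (L : set Y) (psi : Y -> R -> Y).
Hypothesis isot : lagrangian_isotopy w L psi.

Let gY : charted_by_charts Y := charted_manifold mY.
Let YR := prodM Y (@RR R).

Variables (k : nat) (V : set 'rV[R]_k) (phi : 'rV[R]_k -> Y).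
Hypothesis lp : local_param L V phi.

Let EV : normedModType R := ('rV[R]_k * R)%type.

Let fEV : finite_dim EV := finite_dim_prod (finite_dim_rV k) finite_dim_real.

Section InChart.
Variables (p0 : Y) (U : set EV) (g : EV -> 'rV[R]_N).
Hypotheses (oU : open U) (gU : Cinf U g) (UV : U `<=` V `*` [set: R]).
Hypothesis gE : forall y, box V y -> U y ->
  dom (chart_at p0) (psi (phi y.1) y.2) /\ chart_at p0 (psi (phi y.1) y.2) = g y.
Hypothesis gC : forall y, U y -> codom_chart (chart_at p0) (g y).

Let Q (X Z : EV) (y : EV) := chart_form w (chart_at p0) (g y) ('D_X g y) ('D_Z g y).

Let oC : open (codom_chart (chart_at p0)).
Proof. by have [_ []] := gY p0. Qed.

Lemma psi_wE y X X' : box V y -> U y -> psi_w w V phi psi y X X' = Q X X' y.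
Proof.
move=> Vy Uy; have [oV _] := lp.
exact: (@pullback_chart _ _ _ w mY _ fEV (box V)
  (fun z => psi (phi z.1) z.2) p0 U g oU gU gE y X X' Vy Uy
  (line_adherent_box _ oV Vy) (line_adherent_box _ oV Vy)).
Qed.

(** This is closedness of the pullback of omega on [(u, 0)], [(v, 0)], [(0, 1)]: the third term is
    the s-derivative of its value on the first two vectors, which is zero on every slice since the
    images are isotropic. *)
Lemma potential_closed y u v : U y -> y.2 \in `[0, 1] ->
  'D_((u, 0) : EV) (Q (v, 0) (0, 1)) y = 'D_((v, 0) : EV) (Q (u, 0) (0, 1)) y.
Proof.
move=> Uy s01; have [oV _] := lp.
have Vy : box V y by split=> //; have [] := UV Uy.
have Qs X Z : Cinf U (Q X Z).
  exact: (pullback_smooth fEV (finite_dim_rV N) oU oC gU gC (@chart_form_linear _ _ _ _ mY sw p0)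
    (@chart_form_anti _ _ _ _ sw p0) (@chart_form_smooth _ _ _ _ sw p0) X Z).
have := pullback_closed fEV (finite_dim_rV N)
  oU oC gU gC (@chart_form_linear _ _ _ _ mY sw p0)
  (@chart_form_anti _ _ _ _ sw p0) (@chart_form_smooth _ _ _ _ sw p0)
  ((u, 0) : EV) ((v, 0) : EV) ((0, 1) : EV) Uy (@chart_form_closed _ _ _ _ mY sw p0).
have acc : line_adherent (box V) y ((0, 1) : EV) by exact: line_adherent_box.
(* The vanishing of [Q (u, 0) (v, 0)] is known on the box only, as the extension [g] need not be
   isotropic beyond [0,1]; its derivative in s is therefore read inside the box, one-sided at the
   ends. *)
have Q0 : 'D_((0, 1) : EV) (Q (u, 0) (v, 0)) y = 0.
  transitivity (derive_in (box V) (cst (0 : R)) y ((0, 1) : EV)); last first.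
    by apply: derive_in_line_cst.
  apply/esym; apply: derive_in_eq => //.
    apply: filterS (open_nbhs_nbhs (conj oU Uy)) => -[x s] Uz [Vx s01z].
    rewrite -psi_wE //.
    by rewrite (isotopy_isotropic mY isot _ _ lp Vx s01z).
  exact: (Ck_derivable (Qs _ _ 1) Uy).
move=> cl; exact: (eq_of_cyclic cl Q0).
Qed.

End InChart.

(** The potential is built in the coordinates of one [phi], on a ball that the extension [g] sends
    into one chart of [Y]. Being a solution concerns all parametrizations, so the equation is
    transferred to any other [phi'] by the transition [chi]. *)
Lemma param_solution x0 s0 : V x0 -> s0 \in `[0, 1] ->
  exists H, solution_near w L psi (phi x0, s0) H.
Proof.
move=> Vx0 s01; have [oV [U0 [oU0 [phs phV [ginv [ginvs ginvK]]]]]] := lp.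
have z0V : box V (x0, s0) by split.
have [U [g [oU Uz gU gE]]] := smooth_rep (smooth_isotopy_param isot lp) z0V.
pose p0 := psi (phi x0) s0.
have [_ [_ oC _ _ _]] := gY p0.
have [dp0 _] := gY p0.
have oUg : open (U `&` g @^-1` codom_chart (chart_at p0)).
  by apply: open_preimage => // y Uy; exact: (Ck_continuous (gU 0) Uy).
pose U2 : set EV := (V `*` [set: R]) `&` (U `&` g @^-1` codom_chart (chart_at p0)).
have oU2 : open U2 by apply: openI => //; apply: open_setX => //; exact: openT.
have U2z : U2 (x0, s0).
  split; first by split.
  split=> //; have [_ gz] := gE _ z0V Uz.
  by rewrite /preimage /mkset -gz; exists p0.
have U2V : U2 `<=` V `*` [set: R] by move=> y [].
have U2U : U2 `<=` U by move=> y [_ []].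
have g2 : Cinf U2 g by move=> n; exact: (Ck_subset U2U (gU n)).
have g2E y : box V y -> U2 y -> dom (chart_at p0) (psi (phi y.1) y.2) /\
   chart_at p0 (psi (phi y.1) y.2) = g y.
  by move=> Vy /U2U; exact: gE.
have g2C y : U2 y -> codom_chart (chart_at p0) (g y) by move=> [_ []].
have /nbhs_ballP[r /= r0 Hr] := open_nbhs_nbhs (conj oU2 U2z).
pose S := ball s0 r.
have BS : ball x0 r `*` S `<=` U2 by move=> y By; exact: Hr.
have oS : open S by exact: ball_open.
(* This is b_s on the slice: d/ds stands in the second place, and antisymmetry accounts for the
   minus sign of [bform]. *)
pose B (y : EV) (u : 'rV[R]_k) := chart_form w (chart_at p0) (g y) ('D_((u, 0) : EV) g y)
  ('D_((0, 1) : EV) g y).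
have gd y : U2 y -> differentiable g y by exact: (C1_differentiable oU2 (g2 1)).
have B_linear y a u v : (ball x0 r `*` S) y -> B y (a *: u + v) = a * B y u + B y v.
  move=> /BS Uy; have gdy := gd y Uy.
  have DE : 'D_((a *: u + v, 0) : EV) g y = a *: 'D_((u, 0) : EV) g y + 'D_((v, 0) : EV) g y.
    rewrite !deriveE // -linearP; congr ('d g y _); congr pair.
    by rewrite /= scaler0 add0r.
  by rewrite /B DE; exact: (chart_form_linear mY sw a _ _ _ (g2C y Uy)).
have B_smooth u : Cinf (ball x0 r `*` S) (B^~ u).
  move=> n; apply: (Ck_subset BS).
  exact: (pullback_smooth fEV (finite_dim_rV N) oU2 oC g2 g2C (@chart_form_linear _ _ _ _ mY sw p0)
    (@chart_form_anti _ _ _ _ sw p0) (@chart_form_smooth _ _ _ _ sw p0) (u, 0) (0, 1) n).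
have B_closed y u v : (ball x0 r `*` S) y -> `[0, 1]%classic y.2 ->
   'D_((u, 0) : EV) (B^~ v) y = 'D_((v, 0) : EV) (B^~ u) y.
  by move=> /BS Uy ys; exact: (potential_closed oU2 g2 U2V g2E g2C u v Uy).
have [G Gs GE] := poincare (finite_dim_rV k) oS B_linear B_smooth B_closed.
exists (fun z => G (ginv z.1, z.2)).
have phL x : V x -> (L `&` U0) (phi x) by move=> Vx; rewrite -phV; exists x.
pose O1 := [set q | L q -> U0 q /\ ball x0 r (ginv q)]^°.
have O1E q : L q -> O1 q -> U0 q /\ ball x0 r (ginv q).
  by move=> Lq /interior_subset; exact.
have O1p : O1 (phi x0).
  have [Lp Up] := phL x0 Vx0.
  have NB : nbhs (ginv (phi x0)) (ball x0 r).
    by rewrite ginvK //; apply: open_nbhs_nbhs; split; [exact: ball_open|exact: ballxx].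
  have N1 := smooth_near gY (@charted_vecM _ _) ginvs (conj Lp Up) NB.
  have N2 := open_nbhs_nbhs (conj oU0 Up).
  suff : nbhs (phi x0) [set q | L q -> U0 q /\ ball x0 r (ginv q)] by [].
  apply: filterS (filterI N1 N2) => q [h1 Uq] Lq; split=> //; exact: h1.
have oBS : open (ball x0 r `*` S) by apply: open_setX => //; exact: ball_open.
exists (O1 `*` S); first by split=> //; exact: ballxx.
split.
- by apply: open_setX => //; exact: open_interior.
- have sG := smooth_prod_of_Cinf oBS Gs.
  have sginv := smooth_prod_map (fE := finite_dim_rV N) (fF := finite_dim_rV k)
    (B := `[0, 1]%classic) ginvs.
  have sginv' : @smooth _ _ _ YR (prodM (vecM 'rV[R]_k) (@RR R))
      ((L `*` `[0, 1]) `&` (O1 `*` S)) (fun z => (ginv z.1, z.2)).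
    apply: smooth_subset sginv => -[q t] [[Lq t01] [q1 _]]; split=> //; split=> //.
    by have [] := O1E q Lq q1.
  apply: (smooth_comp (charted_prodM gY (@charted_vecM _ _)) sginv' _ sG).
  by move=> [q t] [[Lq t01] [q1 St]]; split=> //; have [] := O1E q Lq q1.
- move=> k' V' phi' lp' [x s] u [V'x s1] [q1x Ss].
  have [U0x Bx] := O1E _ (local_param_in lp' V'x) q1x.
  have [x1 Vx1 x1E] : exists2 x1, V x1 & phi x1 = phi' x.
    have : (L `&` U0) (phi' x) by split=> //; exact: local_param_in lp' V'x.
    by rewrite -phV => -[x1 Vx1 <-]; exists x1.
  have [oV' _] := lp'.
  have [W [chi [oW [Wx chix] WV' chis chiE]]] := local_param_transition mY lp oV'
    (local_param_smooth lp') (fun x => local_param_in lp' (x := x)) V'x Vx1 (esym x1E).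
  pose EV' : normedModType R := ('rV[R]_k' * R)%type.
  pose m (y : EV') : EV := (chi y.1, y.2).
  have oWT : open (W `*` [set: R]) by apply: open_setX => //; exact: openT.
  have ms : Cinf (W `*` [set: R] : set EV') m.
    move=> n; apply: Ck_pair => //; last exact: Ck_snd.
    exact: (Ck_comp oWT oW (fun y h => h.1) (Ck_fst n oWT) (chis n)).
  have Wz : (W `*` [set: R]) (x, s) by [].
  have mz : m (x, s) = (x1, s) by rewrite /m /= chix.
  have md : differentiable m (x, s) by exact: (C1_differentiable oWT (ms 1) Wz).
  have chid : differentiable chi x by exact: (C1_differentiable oW (chis 1) Wx).
  have Dm v a : 'D_((v, a) : EV') m (x, s) = ('D_v chi x, a).
    by have [_ ->] := derive_prod_map s a (diff_derivable (v := v) chid).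
  have Bz : (ball x0 r `*` S) (x1, s).
    by split=> //; move: Bx; rewrite -x1E /= ginvK.
  have Gd : differentiable G (m (x, s)).
    by rewrite mz; exact: (C1_differentiable oBS (Gs 1) Bz).
  have Vz : box V' (x, s) by split.
  have lhsE : derive_in (box V') ((fun z => G (ginv z.1, z.2)) \o lift phi') (x, s) (u, 0) =
      B (x1, s) ('D_u chi x).
    rewrite -(GE (x1, s) ('D_u chi x) Bz s1) -mz -Dm -(derive_comp _ md Gd).
    apply: derive_in_eq => //; first exact: line_adherent_box.
      apply: filterS (open_nbhs_nbhs (conj oWT Wz)) => -[y t] [Wy _] _.
      by have [Vy yE] := chiE y Wy; rewrite /= yE ginvK.
    by apply: diff_derivable; exact: differentiable_comp.
  rewrite lhsE.
  pose U' : set EV' := (W `*` [set: R]) `&` m @^-1` U2.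
  have oU' : open U'.
    by apply: open_preimage => // y Wy; exact: (Ck_continuous (ms 0) Wy).
  have g's : Cinf U' (g \o m).
    move=> n; apply: (Ck_comp oU' oU2 (fun y h => h.2) _ (g2 n)).
    exact: (Ck_subset (@subIsetl _ _ _) (ms n)).
  have g'E y : box V' y -> U' y -> dom (chart_at p0) (psi (phi' y.1) y.2) /\
      chart_at p0 (psi (phi' y.1) y.2) = (g \o m) y.
    move=> [_ y01] [[Wy _] U2y]; have [Vy ->] := chiE _ Wy.
    exact: (g2E (m y)).
  have U'z : U' (x, s) by split=> //; rewrite /preimage /mkset mz; exact: BS.
  have gdz : differentiable g (m (x, s)) by rewrite mz; exact: gd _ (BS _ Bz).
  rewrite /bform /psi_w (@pullback_chart _ _ _ w mY _
    (finite_dim_prod (finite_dim_rV k') finite_dim_real) (box V')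
    (fun z => psi (phi' z.1) z.2) p0 U' (g \o m) oU' g's g'E (x, s) (0, 1) (u, 0) Vz U'z
    (line_adherent_box _ oV' Vz) (line_adherent_box _ oV' Vz)).
  rewrite -(chart_form_anti sw); last by rewrite /= mz; exact: g2C _ (BS _ Bz).
  by rewrite !(derive_comp _ md gdz) !Dm derive0 /B /= mz.
Qed.

End Existence.

(** * Functions locally constant on slices of constant s *)

Section Leaves.
Context {R : realType}.
Variables (N : nat) (Y : charted 'rV[R]_N).
Hypotheses (mY : manifold Y).
Let gY : charted_by_charts Y := charted_manifold mY.
Let YR := prodM Y (@RR R).
Let gYR : charted_by_charts YR := charted_prodM gY (@charted_vecM R R).

(** Applied with [S] the Lagrangian to the difference of two potentials, and with [S] the fixed
    fibre to a single potential. The radius of the ball serves all parameters near [s], so one value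
    per slice describes [f]. *)
Lemma leaf_constant (S : set Y) k (O : set YR) (f : Y * R -> R) p s :
  submanifold k S -> open O -> S p -> s \in `[0, 1] -> O (p, s) ->
  (forall (V : set 'rV[R]_k) phi y u, local_param S V phi -> box V y -> O (lift phi y) ->
    exists2 g : 'rV[R]_k * R -> R,
     (\forall y' \near y, box V y' -> f (lift phi y') = g y') &
     is_derive y ((u, 0) : 'rV[R]_k * R) g 0) ->
  \forall z \near ((p, s) : YR), S z.1 -> z.2 \in `[0, 1] -> f z = f (p, z.2).
Proof.
move=> subS oO Sp s01 Ops loc.
have [V [phi [lp [x0 Vx0 phx0]]]] := subS p Sp.
have [oV [U0 [oU0 [phs phV [ginv [ginvs ginvK]]]]]] := lp.
have z0V : box V (x0, s) by split.
have ls := smooth_lift (B := `[0, 1]%classic) phs.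
have NO : \forall y \near (x0, s), V y.1 /\ (box V y -> O (lift phi y)).
  apply: filterI; first exact: (cvg_fst (open_nbhs_nbhs (conj oV Vx0))).
  apply: (smooth_near (@charted_vecM _ _) gYR ls z0V).
  by apply: open_nbhs_nbhs; split; rewrite /lift /= ?phx0.
have /nbhs_ballP[r /= r0 Hr] := NO.
have Up : (S `&` U0) p by rewrite -phV; exists x0.
have N1 : \forall q \near p, (S `&` U0) q -> ball x0 r (ginv q).
  apply: (smooth_near gY (@charted_vecM _ _) ginvs Up).
  rewrite -phx0 ginvK //; apply: open_nbhs_nbhs; split; [exact: ball_open|exact: ballxx].
have N2 : nbhs p U0 by exact: (open_nbhs_nbhs (conj oU0 Up.2)).
have N3 : nbhs s (ball s r) by exact: nbhsx_ballx.
have N4 : \forall z \near ((p, s) : YR),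
    (((S `&` U0) z.1 -> ball x0 r (ginv z.1)) /\ U0 z.1) /\ ball s r z.2.
  apply: filterI; first exact: (cvg_fst (filterI N1 N2)).
  exact: (cvg_snd N3).
apply: filterS N4 => -[q t] [[h1 Uq] Bt] Sq t01.
have Bq : ball x0 r (ginv q) by apply: h1.
have [x Vx xq] : exists2 x, V x & phi x = q.
  have : (S `&` U0) q by split.
  by rewrite -phV => -[x Vx <-]; exists x.
have Bx : ball x0 r x by move: Bq; rewrite -xq ginvK.
rewrite -xq -phx0.
apply: (@slice_constant _ _ x0 r t (f \o lift phi) _ x Bx) => x' u Bx'.
have BxV y : ball x0 r y -> V y.
  by move=> By; have [] := Hr (y, s) (conj By (ballxx _ r0)).
have Vx't : box V (x', t) by split=> //; exact: BxV.
have Ox't : O (lift phi (x', t)).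
  by have [_] := Hr (x', t) (conj Bx' Bt); apply.
have [g fg dg] := loc V phi (x', t) u lp Vx't Ox't.
exists g => //; apply: filterS fg => -[y t'] /= fgy By tt'; apply: fgy.
by split; [exact: BxV|rewrite /= tt'].
Qed.

End Leaves.

(** * Corrections of potentials by functions of s *)

Section SolutionTheory.
Context {R : realType}.
Variables (N : nat) (Y : charted 'rV[R]_N) (w : mform2 Y).
Hypotheses (mY : manifold Y) (sw : symplectic_form w).
Variables (L : set Y) (psi : Y -> R -> Y).
Hypothesis isot : lagrangian_isotopy w L psi.
Let gY : charted_by_charts Y := charted_manifold mY.
Let YR := prodM Y (@RR R).
Let A : set YR := L `*` `[0, 1].
Let gYR : charted_by_charts YR := charted_prodM gY (@charted_vecM R R).
Let sol := solution_near w L psi.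

Lemma solution_diff k z H H' : submanifold k L -> A z -> sol z H -> sol z H' ->
  exists c : R -> R, \forall z' \near z, A z' -> H z' = H' z' + c z'.2.
Proof.
case: z => p s; move=> subL /= [Lp s01] [ O1 O1z sH] [ O2 O2z sH'].
have [oO1 _ _] := sH; have [oO2 _ _] := sH'.
exists (fun t => H (p, t) - H' (p, t)).
have key : \forall z' \near ((p, s) : YR), L z'.1 -> z'.2 \in `[0, 1] ->
    (H \- H') z' = (H \- H') (p, z'.2).
  apply: (leaf_constant mY subL (openI oO1 oO2)) => //.
  move=> V phi y u lp Vy [ O1y O2y].
  have [U1 [g1 [oU1 Uy1 g1s Hg1 dg1]]] := solution_rep mY sH lp Vy O1y.
  have [U2 [g2 [oU2 Uy2 g2s Hg2 dg2]]] := solution_rep mY sH' lp Vy O2y.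
  exists (g1 - g2).
    have NU := open_nbhs_nbhs (conj (openI oU1 oU2) (conj Uy1 Uy2)).
    by apply: filterS NU => y' [U1y' U2y'] Vy'; rewrite /= Hg1 // Hg2.
  have d1 := DeriveDef (Ck_derivable (u := ((u, 0) : 'rV[R]_k * R)) (g1s 1) Uy1) (dg1 u).
  have d2 := DeriveDef (Ck_derivable (u := ((u, 0) : 'rV[R]_k * R)) (g2s 1) Uy2) (dg2 u).
  by apply: (is_derive_eq (is_deriveB d1 d2)); exact: subrr.
apply: filterS key => z' Hz' [Lz' sz'].
by have /= <- := Hz' Lz' sz'; rewrite addrC subrK.
Qed.

Definition smooth_in_param (c : R -> R) (s : R) := exists S (cc : R -> R),
  [/\ open S, S s, Cinf S cc & forall t, S t -> t \in `[0, 1] -> c t = cc t].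

Lemma smooth_in_paramB c c' s : smooth_in_param c s -> smooth_in_param c' s ->
  smooth_in_param (fun t => c t - c' t) s.
Proof.
move=> [S [cc [oS Ss ccs cE]]] [S' [cc' [oS' Ss' ccs' cE']]].
have oSS : open (S `&` S') by exact: openI.
exists (S `&` S'), (fun t => cc t + (-1 : R) *: cc' t); split=> //.
  move=> n; apply: Ck_add => //; first exact: (Ck_subset (@subIsetl _ _ _) (ccs n)).
  apply: Ck_scale => //; first exact: Ck_cst.
  exact: (Ck_subset (@subIsetr _ _ _) (ccs' n)).
by move=> t [St S't] t01; rewrite cE // cE' // scaleN1r.
Qed.

Lemma smooth_in_param_cst (a s : R) : smooth_in_param (fun=> a) s.
Proof. by exists setT, (cst a); split=> //; [exact: openT|move=> n; exact: Ck_cst]. Qed.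

Lemma solution_slice p s G : L p -> s \in `[0, 1] -> sol (p, s) G ->
  smooth_in_param (fun t => G (p, t)) s.
Proof.
move=> Lp s01 [ O Oz [oO sG _]].
have [U [g [oU Uz gs Gg]]] := sG (p, s) (conj (conj Lp s01) Oz).
pose a := chart_at p p.
have oa : continuous (fun t : R => (a, t)).
  move=> t; apply: (cvg_pair (F := nbhs t) (G := nbhs a) (H := nbhs t));
    [exact: cvg_cst|exact: cvg_id].
have op : continuous (fun t : R => (p, t)).
  move=> t; apply: (cvg_pair (F := nbhs t) (G := nbhs p) (H := nbhs t));
    [exact: cvg_cst|exact: cvg_id].
pose S := (fun t : R => (a, t)) @^-1` U `&` (fun t : R => (p, t)) @^-1` O.
have oS : open S.
  by apply: openI; apply: open_comp.
exists S, (fun t => g (a, t)); split=> //.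
  move=> n; apply: (Ck_comp oS oU (fun t h => h.1) _ (gs n)).
  by apply: Ck_pair => //; [exact: Ck_cst|exact: Ck_id].
move=> t [Ut Ot] t01; have [dp _] := gY p.
by have [_] := Gg (p, t) (conj (conj Lp t01) Ot) (conj dp I) Ut.
Qed.

(** Adding a function of s leaves the difference quotients in the directions [(u, 0)] literally
    unchanged; smoothness of [c] serves the smoothness of the sum. *)
Lemma solution_add p s G c : smooth_in_param c s -> sol (p, s) G ->
  sol (p, s) (fun z => G z + c z.2).
Proof.
move=> [S [cc [oS Ss ccs cE]]] [ O Oz [oO sG dG]].
exists (O `&` ([set: Y] `*` S)); first by split.
split.
- by apply: openI => //; apply: open_setX => //; exact: openT.
- move=> [q t] [Aqt [ Oqt [_ /= St]]]; have [U [g [oU Uz gs Gg]]] := sG (q, t) (conj Aqt Oqt).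
  have oT : open ([set: 'rV[R]_N] `*` S) by apply: open_setX => //; exact: openT.
  have oUS : open (U `&` ([set: 'rV[R]_N] `*` S)) by exact: openI.
  exists (U `&` ([set: 'rV[R]_N] `*` S)), (fun y => g y + cc y.2); split=> //.
    move=> n; apply: Ck_add => //; first exact: (Ck_subset (@subIsetl _ _ _) (gs n)).
    exact: (Ck_comp oUS oS (fun y h => h.2.2) (Ck_snd n oUS) (ccs n)).
  move=> [q' t'] [Aq' [ Oq' _]] dq' [Uq' [_ St']]; split=> //=.
  have [_ /= ->] := Gg (q', t') (conj Aq' Oq') dq' Uq'.
  by rewrite (cE t') //; have [] := Aq'.
- move=> k V phi lp y u Vy [ Oy _]; rewrite -(dG k V phi lp y u Vy Oy).
  pose X : 'rV[R]_k * R := (u, 0); pose Gc z := G z + c z.2.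
  have E1 : (fun t : R => t^-1 *: ((Gc \o lift phi) (t *: X + y) - (Gc \o lift phi) y)) =
      (fun t : R => t^-1 *: ((G \o lift phi) (t *: X + y) - (G \o lift phi) y)).
    apply: funext => t; rewrite /Gc /= scaler0 add0r.
    by rewrite opprD addrACA subrr addr0.
  by rewrite /derive_in E1.
Qed.

(** [c] is the difference of two solutions at the point [p], so it inherits their smoothness in s;
    this no longer refers to [p] and can be used at [p']. *)
Lemma solution_transport p p' s G c : L p -> L p' -> s \in `[0, 1] -> sol (p, s) G ->
  sol (p, s) (fun z => G z + c z.2) -> sol (p', s) G -> sol (p', s) (fun z => G z + c z.2).
Proof.
move=> Lp Lp' s01 sG sGc; apply: solution_add.
have := smooth_in_paramB (solution_slice Lp s01 sGc) (solution_slice Lp s01 sG).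
by rewrite (_ : (fun _ => _) = c) //; apply: funext => t /=; rewrite addrC addKr.
Qed.

End SolutionTheory.

Lemma wedge_cancel (R : comPzRingType) (b b' a a' d : R) :
  b * a' - b' * a = (b + a * d) * a' - (b' + a' * d) * a.
Proof. ring. Qed.

Lemma antisym_self (R : numDomainType) (b : R) : b = - b -> b = 0.
Proof. by move=> /eqP; rewrite -addr_eq0 -mulr2n mulrn_eq0 => /eqP. Qed.

(** * Potentials vanishing on the fixed fibre, and exactness *)

Section Initial.
Context {R : realType}.
Variables (N : nat) (Y : charted 'rV[R]_N) (w : mform2 Y).
Hypotheses (mY : manifold Y) (sw : symplectic_form w).
Variables (L : set Y) (psi : Y -> R -> Y).
Hypothesis isot : lagrangian_isotopy w L psi.
Let gY : charted_by_charts Y := charted_manifold mY.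
Let YR := prodM Y (@RR R).
Let A : set YR := L `*` `[0, 1].
Let gYR : charted_by_charts YR := charted_prodM gY (@charted_vecM R R).
Let sol := solution_near w L psi.

Lemma form0 (p : Y) u : w p 0 u = 0.
Proof.
by have [lw _ _ _ _] := sw; have := lw p u (-1) 0 0; rewrite scaler0 addr0 /= mulN1r addNr.
Qed.

Lemma solution_exists k z : submanifold k L -> A z -> exists H, sol z H.
Proof.
case: z => p s subL [Lp s01].
have [V [phi [lp [x0 Vx0 <-]]]] := subL p Lp.
exact: (param_solution mY sw isot lp Vx0 s01).
Qed.

(** On [F] the isotopy stands still, so its s-derivative is the zero vector and b vanishes at points
    of [F]. Parametrizations of [F] are factored through those of [L], on which potentials are
    tested. *)
Lemma solution_constant_on_fixed k k' (F : set Y) p s O G : F `<=` L ->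
  submanifold k L -> submanifold k' F -> (forall q t, F q -> t \in `[0, 1] -> psi q t = q) ->
  F p -> s \in `[0, 1] -> O (p, s) -> solution_on w L psi O G ->
  \forall z \near ((p, s) : YR), F z.1 -> z.2 \in `[0, 1] -> G z = G (p, z.2).
Proof.
move=> FL subL subF fixF Fp s01 Oz sG; have [oO _ _] := sG.
apply: (leaf_constant mY subF oO Fp s01 Oz) => V' phi' [x t] u lp' [V'x t01] Oy.
have [V [phi [lp [x1 Vx1 x1E]]]] := subL (phi' x) (FL _ (local_param_in lp' V'x)).
have [oV' _] := lp'; have [oV _] := lp.
have [W [chi [oW [Wx chix] WV' chis chiE]]] := local_param_transition mY lp oV'
  (local_param_smooth lp') (fun x Vx => FL _ (local_param_in lp' Vx)) V'x Vx1 (esym x1E).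
pose EV' : normedModType R := ('rV[R]_k' * R)%type.
pose EV : normedModType R := ('rV[R]_k * R)%type.
pose m (y : EV') : EV := (chi y.1, y.2).
have oWT : open (W `*` [set: R]) by apply: open_setX => //; exact: openT.
have ms : Cinf (W `*` [set: R] : set EV') m.
  move=> n; apply: Ck_pair => //; last exact: Ck_snd.
  exact: (Ck_comp oWT oW (fun y h => h.1) (Ck_fst n oWT) (chis n)).
have Wz : (W `*` [set: R]) (x, t) by [].
have mz : m (x, t) = (x1, t) by rewrite /m /= chix.
have md : differentiable m (x, t) by exact: (C1_differentiable oWT (ms 1) Wz).
have chid : differentiable chi x by exact: (C1_differentiable oW (chis 1) Wx).
have Dm v a : 'D_((v, a) : EV') m (x, t) = ('D_v chi x, a).
  by have [_ ->] := derive_prod_map t a (diff_derivable (v := v) chid).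
have Vz1 : box V (x1, t) by split.
have O1 : O (lift phi (x1, t)) by rewrite /lift /= x1E.
have [U [g [oU Uz gs Gg dg]]] := solution_rep mY sG lp Vz1 O1.
have gd : differentiable g (m (x, t)).
  by rewrite mz; exact: (C1_differentiable oU (gs 1) Uz).
exists (g \o m).
  have oU' : open ((W `*` [set: R]) `&` m @^-1` U).
    by apply: open_preimage => // y Wy; exact: (Ck_continuous (ms 0) Wy).
  have U'z : ((W `*` [set: R]) `&` m @^-1` U) (x, t).
    by split=> //; rewrite /preimage /mkset mz.
  apply: filterS (open_nbhs_nbhs (conj oU' U'z)) => -[y t'] [[Wy _] Uy] [_ t'01].
  have [Vy yE] := chiE y Wy; rewrite /lift /= yE.
  exact: (Gg (m (y, t'))).
split; first by apply: diff_derivable; exact: differentiable_comp.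
rewrite (derive_comp _ md gd) Dm mz dg /bform /psi_w /pullback_vec /pullback mder_vecM.
rewrite derive_in_line_cst ?form0 ?oppr0 //; first exact: line_adherent_box.
have Fx : F (phi x1) by rewrite x1E; exact: local_param_in lp' V'x.
move=> h; rewrite /= scaler0 add0r => -[_ ht01]; congr (chart_at _ _).
rewrite (fixF (phi x1) t) // fixF //.
Qed.

(** Subtracting the values of [G] at the single point [p] is a correction smooth in s; it normalizes
    all points of [F] near [p] at once, as [G] depends there on s only. *)
Lemma solution_init k k' (F : set Y) z : F `<=` L ->
  submanifold k L -> submanifold k' F -> (forall q t, F q -> t \in `[0, 1] -> psi q t = q) ->
  A z -> F z.1 -> exists2 H, sol z H & \forall z' \near z, A z' -> F z'.1 -> H z' = 0.
Proof.
case: z => p s FL subL subF fixF [Lp s01] Fp.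
have [G [ O Oz sG]] := solution_exists subL (conj Lp s01 : A (p, s)).
have Gsol : sol (p, s) G by exists O.
exists (fun z => G z + (0 - G (p, z.2))).
  apply: (solution_add (c := fun t => 0 - G (p, t)) _ Gsol).
  apply: smooth_in_paramB; first exact: smooth_in_param_cst.
  exact: (solution_slice mY Lp s01 Gsol).
have := solution_constant_on_fixed FL subL subF fixF Fp s01 Oz sG.
by apply: filterS => z' Gz' [_ s'01] Fz'; rewrite Gz' // sub0r subrr.
Qed.

(** A potential on slices controls only the directions [(u, 0)]. In a direction [(u, a)] the
    derivative of H is b plus [a] times the s-derivative of H, and these last terms cancel in the
    antisymmetrization that defines d(H ds). *)
Lemma solution_exact H : (forall z, A z -> sol z H) ->
  @smooth _ _ _ (prodM Y (@RR R)) (@RR R) A H /\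
  forall k (V : set 'rV[R]_k) (phi : 'rV[R]_k -> Y), local_param L V phi ->
  forall z X X', box V z -> wedge (bform w V phi psi) (@dsform R k) z X X' =
     ext_d1 (box V) (Hds phi (fun p s => H (p, s))) z X X'.
Proof.
move=> solH; split.
  apply: (smooth_local gYR) => z Az; have [ O Oz [oO sH _]] := solH z Az.
  by exists O => //; exact: (open_nbhs_nbhs (conj oO Oz)).
move=> k V phi lp z [u a] [u' a'] Vz; have [oV _] := lp.
have Az : A (lift phi z).
  by case: Vz => Vz s01; split=> //; exact: local_param_in lp Vz.
have [ O Oz sH] := solH _ Az.
have [U [g [oU Uz gs Hg dg]]] := solution_rep mY sH lp Vz Oz.
have gd : differentiable g z by exact: (C1_differentiable oU (gs 1) Uz).
have [U1 [g1 [oU1 Uz1 g1s g1E]]] := smooth_rep (smooth_isotopy_param isot lp) Vz.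
have g1d : differentiable g1 z by exact: (C1_differentiable oU1 (g1s 1) Uz1).
have DH (b : R) v c : derive_in (box V) (fun y => Hds phi (fun p s => H (p, s)) y (v, b)) z c =
    'D_c g z * b.
  have := is_deriveZ b (DeriveDef (diff_derivable (v := c) gd) erefl).
  move=> [bgd bgE]; rewrite mulrC -[RHS]bgE; apply: derive_in_eq => //.
    exact: line_adherent_box.
  apply: filterS (open_nbhs_nbhs (conj oU Uz)) => y Uy Vy.
  by rewrite /Hds /dsform /= -(Hg y Vy Uy) mulrC.
have Dg v (b : R) : 'D_((v, b) : 'rV[R]_k * R) g z =
    bform w V phi psi z (v, 0) + b * 'D_((0, 1) : 'rV[R]_k * R) g z.
  rewrite -dg !deriveE //.
  transitivity ('d g z (((v, 0) : 'rV[R]_k * R) + b *: ((0, 1) : 'rV[R]_k * R))).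
    by congr ('d g z _); congr pair; rewrite /= ?scaler0 ?addr0 ?add0r // [RHS]mulr1.
  by rewrite linearD linearZ.
(* The form b does not see the s-component of a vector, because the pullback of omega is
   alternating. *)
have Db v (b : R) : bform w V phi psi z (v, b) = bform w V phi psi z (v, 0).
  have acc X : line_adherent (box V) z X by exact: line_adherent_box.
  pose p0 := psi (phi z.1) z.2.
  have pE X X' : psi_w w V phi psi z X X' =
      chart_form w (chart_at p0) (g1 z) ('D_X g1 z) ('D_X' g1 z).
    exact: (@pullback_chart _ _ _ w mY _ (finite_dim_prod (finite_dim_rV k) finite_dim_real)
      (box V) (fun z => psi (phi z.1) z.2) p0 U1 g1 oU1 g1s g1E z X X' Vz Uz1 (acc X) (acc X')).
  have Cz : codom_chart (chart_at p0) (g1 z).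
    by have [dz <-] := g1E z Vz Uz1; exists p0.
  have D1 : 'D_((v, b) : 'rV[R]_k * R) g1 z =
      b *: 'D_((0, 1) : 'rV[R]_k * R) g1 z + 'D_((v, 0) : 'rV[R]_k * R) g1 z.
    rewrite !deriveE //.
    transitivity ('d g1 z (b *: ((0, 1) : 'rV[R]_k * R) + ((v, 0) : 'rV[R]_k * R))).
      by congr ('d g1 z _); congr pair; rewrite /= ?scaler0 ?addr0 ?add0r // [RHS]mulr1.
    by rewrite linearD linearZ.
  rewrite /bform !pE D1; set e1 := 'D_(0, 1) g1 z; set e2 := 'D_(v, 0) g1 z.
  have e110 : chart_form w (chart_at p0) (g1 z) e1 e1 = 0.
    exact: (antisym_self (chart_form_anti sw e1 e1 Cz)).
  rewrite (chart_form_anti sw e1 (b *: e1 + e2) Cz) (chart_form_linear mY sw b e1 e2 e1 Cz).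
  by rewrite e110 mulr0 add0r opprK; exact: (chart_form_anti sw e2 e1 Cz).
have DDg v (b : R) : 'D_((v, b) : 'rV[R]_k * R) g z =
   bform w V phi psi z (v, b) + b * 'D_((0, 1) : 'rV[R]_k * R) g z by rewrite Db.
transitivity ('D_((u, a) : 'rV[R]_k * R) g z * a' - 'D_((u', a') : 'rV[R]_k * R) g z * a).
  by rewrite (DDg u a) (DDg u' a'); exact: wedge_cancel.
by congr (_ - _); exact: (esym (DH _ _ _)).
Qed.

End Initial.

(** * Transport along the fibration *)

Section Fibration.
Context {R : realType}.
Variables (N : nat) (Y : charted 'rV[R]_N) (v : Y -> @CC R).
Hypotheses (mY : manifold Y) (sv : smooth setT v).
Variables (gamma : @RR R -> @CC R) (gammainv : @CC R -> @RR R) (L : set Y).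
Hypotheses (sgamma : smooth setT gamma) (sgammainv : smooth (range gamma) gammainv).
Hypothesis gammaK : forall t, gammainv (gamma t) = t.
Hypothesis vL : v @` L = range gamma.
Hypothesis trivL : locally_trivial L (range gamma) v.

Let gY : charted_by_charts Y := charted_manifold mY.
Let gR : charted_by_charts (@RR R) := @charted_vecM R R.
Let gC : charted_by_charts (@CC R) := @charted_vecM R (R * R)%type.

(** The real coordinate along which potentials are continued; [gammainv] is meaningful on the curve,
    which contains [v p] for [p] in [L]. *)
Definition curve_param (p : Y) : R := gammainv (v p).

Lemma curve_paramK p : L p -> gamma (curve_param p) = v p.
Proof.
move=> Lp; have : range gamma (v p) by rewrite -vL; exists p.
by move=> [t _ vp]; rewrite /curve_param -vp gammaK.
Qed.

Lemma curve_param_eq p t : L p -> (curve_param p = t <-> v p = gamma t).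
Proof.
move=> Lp; split; first by move=> <-; rewrite curve_paramK.
by rewrite /curve_param => ->; rewrite gammaK.
Qed.

Lemma curve_param_near p : L p -> forall e : R, 0 < e ->
  \forall p' \near p, L p' -> `|curve_param p' - curve_param p| < e.
Proof.
move=> Lp e e0.
have svL : smooth L v by apply: smooth_subset sv.
have st : @smooth _ _ _ Y (@RR R) L curve_param.
  apply: (smooth_comp gY svL _ sgammainv) => q Lq.
  by rewrite -vL; exists q.
have := smooth_near gY gR st Lp (nbhsx_ballx (curve_param p) e e0).
by apply: filterS => q + Lq => /(_ Lq); rewrite -ball_normE /= distrC.
Qed.

(* Reparametrizes the transport paths so that they are defined for all times. *)
Definition clamp (a d t : R) := Num.max (a - d) (Num.min t (a + d)).

Lemma clampP (a d t : R) : 0 <= d -> `|clamp a d t - a| <= d.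
Proof.
move=> d0; rewrite /clamp ler_distl.
by case: (leP t (a + d)) => h; [case: (leP (a - d) t)|case: (leP (a - d) (a + d))] => h'; lra.
Qed.

Lemma clamp_id (a d t : R) : `|t - a| < d -> clamp a d t = t.
Proof.
rewrite ltr_distl /clamp => /andP[h1 h2].
by rewrite min_l ?max_r // ltW.
Qed.

Lemma clamp_continuous (a d : R) : continuous (clamp a d).
Proof.
move=> t; apply: (@continuous_max _ _ (fun=> a - d) (fun t => Num.min t (a + d))).
  exact: cvg_cst.
by apply: (@continuous_min _ _ id (fun=> a + d)); [exact: cvg_id|exact: cvg_cst].
Qed.

(** The path labelled by [q] runs through the points that the trivialization assigns to [q] over the
    curve. It need not pass through [q], since the trivialization may move the fibre over
    [gamma t0]; the second component of its inverse recovers the label. *)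
Lemma curve_transport (t0 : R) : exists2 d, 0 < d &
  exists (transport : R -> Y -> Y) (proj : Y -> Y),
  [/\ forall p, L p -> `|curve_param p - t0| < d ->
        [/\ L (proj p), curve_param (proj p) = t0 & transport (curve_param p) (proj p) = p],
      forall q, L q -> curve_param q = t0 -> continuous (transport^~ q) /\
        (forall t, L (transport t q)),
      forall t q, L q -> curve_param q = t0 -> `|t - t0| < d ->
        curve_param (transport t q) = t /\ proj (transport t q) = q,
      forall p, L p -> `|curve_param p - t0| < d -> forall O, nbhs (proj p) O ->
        \forall p' \near p, L p' -> O (proj p') &
      forall t q O, L q -> curve_param q = t0 -> `|t - t0| < d -> nbhs (transport t q) O ->
        \forall t' \near t & q' \near q, L q' -> curve_param q' = t0 -> O (transport t' q')].
Proof.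
have [_ /(_ (gamma t0))] := trivL.
move=> [|W [theta [Wb [oW [st imt [thinv [sthinv thinvK]]] vth]]]]; first by exists t0.
have gcont : continuous gamma.
  move=> t O Ot; have := smooth_near gR gC sgamma (p := t) Logic.I Ot.
  by apply: filterS => t'; apply.
have /nbhs_ballP[d0 /= d00 Hd] : \forall t \near t0, W (gamma t).
  exact: (gcont t0 _ (open_nbhs_nbhs (conj oW Wb))).
(* Clamped times lie in a closed interval of radius [d]; half of [d0] keeps the curve inside the
   open set [W] at all of them. *)
pose d := d0 / 2; have dp : 0 < d by rewrite divr_gt0.
pose cl := clamp t0 d.
have Wcl t : (range gamma `&` W) (gamma (cl t)).
  split; first by exists (cl t).
  apply: Hd; rewrite -ball_normE /= distrC; apply: le_lt_trans (clampP t0 t (ltW dp)) _.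
  by rewrite /d ltr_pdivrMr // ltr_pMr // ltr1n.
set F := L `&` v @^-1` [set gamma t0] in st imt thinvK vth.
have Fq q : L q -> curve_param q = t0 -> F q.
  by move=> Lq qt; split=> //; apply/curve_param_eq.
have gCY : charted_by_charts (prodM (@CC R) Y) by exact: charted_prodM.
have thF z : ((range gamma `&` W) `*` F) z -> (L `&` v @^-1` W) (theta z).
  by move=> Dz; rewrite -imt; exists z.
have tnear t q O : F q -> nbhs (theta (gamma (cl t), q)) O ->
    \forall z \near (t, q), F z.2 -> O (theta (gamma (cl z.1), z.2)).
  move=> Fq' On.
  have Nth := @smooth_near _ _ _ (prodM (@CC R) Y) Y _ theta (gamma (cl t), q) O gCY gY st
    (conj (Wcl t) Fq') On.
  have pc : (fun z : R * Y => (gamma (cl z.1), z.2)) z @[z --> (t, q)] --> (gamma (cl t), q).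
    apply: (cvg_pair (F := nbhs (t, q)) (G := nbhs (gamma (cl t))) (H := nbhs q)).
      apply: (@cvg_comp _ _ _ fst (gamma \o cl) _ (nbhs t)); first exact: cvg_fst.
      exact: (@cvg_comp _ _ _ cl gamma _ (nbhs (cl t)) _ (@clamp_continuous t0 d t) (gcont (cl t))).
    exact: cvg_snd.
  have Nz : \forall z \near (t, q), ((range gamma `&` W) `*` F) (gamma (cl z.1), z.2) ->
      O (theta (gamma (cl z.1), z.2)) by exact: (pc _ Nth).
  by apply: filterS Nz => z Oz Fz; apply: Oz; split=> //; exact: Wcl.
exists d => //; exists (fun t q => theta (gamma (cl t), q)), (fun p => (thinv p).2); split.
- move=> p Lp pd; have Wp : W (v p).
    rewrite -curve_paramK // -(clamp_id pd); exact: (Wcl (curve_param p)).2.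
  have : (L `&` v @^-1` W) p by split.
  rewrite -imt => -[z [z1 [Lz vz]] zp].
  have pz : thinv p = z by rewrite -zp thinvK.
  rewrite pz; split=> //; first by apply/curve_param_eq.
  rewrite /cl clamp_id // curve_paramK // -zp vth //.
  by rewrite -surjective_pairing.
- move=> q Lq qt; have Fq' := Fq q Lq qt; split=> [t O On|t]; last first.
    by have [] := thF (gamma (cl t), q) (conj (Wcl t) Fq').
  have pc : (fun t : R => (t, q)) t' @[t' --> t] --> (t, q).
    by apply: (cvg_pair (F := nbhs t) (G := nbhs t) (H := nbhs q)); [exact: cvg_id|exact: cvg_cst].
  have Nt : \forall t' \near t, F q -> O (theta (gamma (cl t'), q)).
    exact: (pc _ (tnear t q O Fq' On)).
  by apply: filterS Nt => t'; apply.
- move=> t q Lq qt td; have Fq' := Fq q Lq qt.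
  have Dz : ((range gamma `&` W) `*` F) (gamma (cl t), q) by split=> //; exact: Wcl.
  rewrite thinvK //; split=> //; rewrite /curve_param vth //=; last exact: Wcl.
  by rewrite gammaK /cl clamp_id.
- move=> p Lp pd O On; have Wp : W (v p).
    rewrite -curve_paramK // -(clamp_id pd); exact: (Wcl (curve_param p)).2.
  have On' : nbhs (thinv p) [set z | O z.2].
    have pE : thinv p = ((thinv p).1, (thinv p).2) by rewrite -surjective_pairing.
    rewrite pE; exact: (cvg_snd On).
  have N1 : \forall p' \near p, (L `&` v @^-1` W) p' -> O (thinv p').2.
    exact: (smooth_near gY gCY sthinv (conj Lp Wp) On').
  have N2 : \forall p' \near p, setT p' -> W (v p').
    exact: (smooth_near gY gC sv Logic.I (open_nbhs_nbhs (conj oW Wp))).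
  have N12 : \forall p' \near p, ((L `&` v @^-1` W) p' -> O (thinv p').2) /\ (setT p' -> W (v p')).
    exact: (filterI N1 N2).
  apply: filterS N12 => p' [h1 h2] Lp'.
  by apply: h1; split=> //; exact: h2.
- move=> t q O Lq qt td On.
  apply: filterS (tnear t q O (Fq q Lq qt) On) => z h Lz zt; apply: h; exact: Fq.
Qed.

End Fibration.

Theorem lemma1p9 (R : realType) (N : nat) (Y : charted 'rV[R]_N)
  (w : mform2 Y) (v : Y -> @CC R)
  (HLG : LG_model w v)
  (gamma : @RR R -> @CC R)
  (Hgamma : embedded_curve (regv v) gamma)
  (L : set Y)
  (HL : fibered_lagrangian w v gamma L)
  (h : @RR R -> R -> @CC R)
  (Hh : curve_isotopy (regv v) h)
  (h0 : forall t, h t 0 = gamma t)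
  (psi : Y -> R -> Y)
  (Hpsi : fibered_isotopy w v h L psi)
  (HpsiC : forall p s, L p -> s \in `[0, 1] -> regv v (v (psi p s)))
  (psi0 : forall p, L p -> psi p 0 = p)
  (t0 : R)
  (ht0 : forall s, s \in `[0, 1] -> h t0 s = gamma t0)
  (psit0 : forall s, s \in `[0, 1] ->
     forall p, L p -> v p = gamma t0 -> psi p s = p) :
  exact_isotopy w L psi.
Proof.
have [mY sw sv _ _] := HLG.
have [[sgamma _ [gammainv [sgammainv gammaK0]]] _] := Hgamma.
have gammaK t : gammainv (gamma t) = t by exact: gammaK0.
have [[_ _ [kL [_ subL]]] vL trivL lagF] := HL.
have [isot _] := Hpsi.
have [FL _ [kF [_ subF]]] := lagF (gamma t0) (ex_intro2 _ _ t0 Logic.I erefl).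
pose tau := curve_param v gammainv.
have tauE p : L p -> tau p = t0 -> v p = gamma t0.
  by move=> Lp tp; apply/(curve_param_eq gammaK vL).
have [H solH] : exists H, forall z : Y * R, (L `*` `[0, 1]) z -> solution_near w L psi z H.
  (* The slice over [t0] is the fixed fibre, a submanifold because it is Lagrangian in the fibre of
     [v]; there the initial potentials are normalized to zero. *)
  apply: (@continuation R Y R L `[0, 1]%classic (solution_near w L psi) _ _ _ _ _ tau _ _ t0).
  - move=> z H H'; exact: solution_germ.
  - by move=> z H _ /solution_open; apply: filterS.
  - move=> z Az; exact: (solution_exists mY sw isot subL Az).
  - move=> z H H' Az; exact: (solution_diff mY subL Az).
  - move=> p p' s G c; exact: solution_transport.
  - exact: (curve_param_near mY sv sgammainv vL).
  - exact: (curve_transport mY sv sgamma gammaK vL trivL).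
  - move=> [p s] [Lp s01] tp.
    have Fp : (L `&` fibre v (gamma t0)) p by split=> //; exact: tauE.
    have [H solH H0] := solution_init mY sw isot (@subIsetl _ _ _) subL subF
      (fun q t (Fq : (L `&` fibre v (gamma t0)) q) t01 => psit0 t t01 q Fq.1 Fq.2)
      (conj Lp s01 : (L `*` `[0, 1]) (p, s)) Fp.
    exists H => //; apply: filterS H0 => z' H0 Az' tz'; apply: H0 => //.
    by split; [exact: Az'.1|apply: tauE => //; exact: Az'.1].
have [sH dH] := solution_exact mY sw isot solH.
exists (fun p s => H (p, s)); split; last exact: dH.
by apply: smooth_eq sH => z _; rewrite -surjective_pairing.
Qed.
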